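(* Let $r\ge1$ be an integer, $\nu$ fixed with $\Re(\nu)>-\frac1{r+1}$, $a<b$, $f,g\in C^\infty[a,b]$, with $g(a)=0$, $g^{(j)}(a)=0$ for $j=1,\dots,r$, $g^{(r+1)}(a)\ne0$, and $g(x)\ne0$, $g'(x)\ne0$ for $x\in(a,b]$. Let $\mathcal{H}_\nu[f]=\int_a^bf(x)J_\nu(\omega g(x))\,dx$, $M_j(a,\nu,\omega)=\int_a^b(x-a)^jJ_\nu(\omega g(x))\,dx$, $T_r[\phi](x,y)=\sum_{j=0}^r\frac{\phi^{(j)}(y)}{j!}(x-y)^j$, $\widehat\sigma_0[f]=f$, $\widehat\sigma_k[f](x)=g(x)^{\nu+k}\frac{d}{dx}\left[\frac{\widehat\sigma_{k-1}[f](x)-T_r[\widehat\sigma_{k-1}[f]](x,a)}{g(x)^{\nu+k}g'(x)}\right]$ for $k\ge1$ (values at $a$ by continuous extension). For an integer $m\ge1$ let $$Q_m^A[f]=\sum_{k=0}^{m-1}\frac{1}{(-\omega)^k}\sum_{j=0}^r\frac{\widehat\sigma_k[f]^{(j)}(a)}{j!}M_j(a,\nu+k,\omega)-\sum_{k=1}^m\frac{1}{(-\omega)^k}\left[\frac{\widehat\sigma_{k-1}[f](b)-T_r[\widehat\sigma_{k-1}[f]](b,a)}{g'(b)}\right]J_{\nu+k}(\omega g(b)).$$ Then $\mathcal{H}_\nu[f]-Q_m^A[f]=\mathcal{O}(\omega^{-m-\frac1{r+1}})$ as $\omega\to\infty$.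
   Context: $J_\nu$ is the Bessel function of the first kind of order $\nu$. *)

(* Defs.v *)
From Stdlib Require Import Reals.
From Coquelicot Require Import Coquelicot.

Local Open Scope R_scope.

Definition Cexp (z : C) : C :=
  (exp (Re z) * cos (Im z), exp (Re z) * sin (Im z)).

Definition Carg (z : C) : R :=
  if Rle_dec 0 (Im z) then acos (Re z / Cmod z) else - acos (Re z / Cmod z).

Definition Clog (z : C) : C := (ln (Cmod z), Carg z).

Definition cpow (z w : C) : C :=
  if Req_EM_T (Cmod z) 0 then (if Req_EM_T (Cmod w) 0 then RtoC 1 else RtoC 0)
  else Cexp (Cmult w (Clog z)).

Definition limC (F : (C -> Prop) -> Prop) : C := @lim C_R_CompleteNormedModule F.

Definition CSeries (u : nat -> C) : C := limC (filtermap (sum_n u) eventually).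

(** ---------- reciprocal Gamma function (Gauss' product formula) ----------
   1/Gamma(s) = lim_{n->oo} s (s+1) ... (s+n) / (n! n^s), valid for all s in C *)
Fixpoint poch_prod (s : C) (n : nat) : C :=
  match n with
  | O => s
  | S n' => Cmult (poch_prod s n') (Cplus s (RtoC (INR n)))
  end.

Definition rgamma (s : C) : C :=
  limC (filtermap
          (fun n : nat => Cdiv (poch_prod s n)
                              (Cmult (RtoC (INR (Factorial.fact n))) (cpow (RtoC (INR n)) s)))
          eventually).

Definition BesselJ (nu z : C) : C :=
  CSeries (fun k : nat =>
    Cmult (Cmult (Cdiv (RtoC ((-1) ^ k)) (RtoC (INR (Factorial.fact k))))
                 (rgamma (Cplus nu (RtoC (INR k + 1)))))
          (Cmult (cpow (Cdiv z (RtoC 2)) nu) (Cpow (Cdiv z (RtoC 2)) (2 * k)))).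

Definition Cinf_ab (a b : R) (f : R -> R) : Prop :=
  (forall (n : nat) (x : R), a < x < b -> ex_derive_n f n x) /\
  (forall n : nat, exists l : R, filterlim (Derive_n f n) (at_right a) (locally l)) /\
  (forall n : nat, exists l : R, filterlim (Derive_n f n) (at_left b) (locally l)) /\
  filterlim f (at_right a) (locally (f a)) /\
  filterlim f (at_left b) (locally (f b)).

Definition derA (f : R -> R) (n : nat) (a : R) : R :=
  lim (filtermap (Derive_n f n) (at_right a)).
Definition derB (f : R -> R) (n : nat) (b : R) : R :=
  lim (filtermap (Derive_n f n) (at_left b)).

Definition CDer (phi : R -> C) (x : R) : C :=
  (Derive (fun t => Re (phi t)) x, Derive (fun t => Im (phi t)) x).

Fixpoint CDer_n (n : nat) (phi : R -> C) : R -> C :=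
  match n with
  | O => phi
  | S n' => CDer (CDer_n n' phi)
  end.

Definition CderA (phi : R -> C) (n : nat) (a : R) : C :=
  limC (filtermap (CDer_n n phi) (at_right a)).
Definition CderB (phi : R -> C) (n : nat) (b : R) : C :=
  limC (filtermap (CDer_n n phi) (at_left b)).

Definition Taylor (r : nat) (phi : R -> C) (a x : R) : C :=
  sum_n (fun j : nat => Cmult (Cdiv (CderA phi j a) (RtoC (INR (Factorial.fact j))))
                              (RtoC ((x - a) ^ j))) r.

Definition CInt (phi : R -> C) (a b : R) : C :=
  limC (filtermap (fun e => @RInt C_R_CompleteNormedModule phi e b) (at_right a)).

Definition Hnu (nu : C) (a b : R) (f g : R -> R) (omega : R) : C :=
  CInt (fun x => Cmult (RtoC (f x)) (BesselJ nu (RtoC (omega * g x)))) a b.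

Definition Mj (j : nat) (a b : R) (g : R -> R) (nu : C) (omega : R) : C :=
  CInt (fun x => Cmult (RtoC ((x - a) ^ j)) (BesselJ nu (RtoC (omega * g x)))) a b.

(* sigma-hat_k[f]; values at a and b are taken by continuous extension
   (through CderA / CderB wherever they are used). *)
Fixpoint sigma_hat (nu : C) (r : nat) (a : R) (f g : R -> R) (k : nat) : R -> C :=
  match k with
  | O => fun x => RtoC (f x)
  | S k' =>
      let s := sigma_hat nu r a f g k' in
      let e := Cplus nu (RtoC (INR (S k'))) in
      fun x => Cmult (cpow (RtoC (g x)) e)
                     (CDer (fun t => Cdiv (Cminus (s t) (Taylor r s a t))
                                          (Cmult (cpow (RtoC (g t)) e) (RtoC (Derive g t)))) x)
  end.

Definition QmA (m r : nat) (nu : C) (a b : R) (f g : R -> R) (omega : R) : C :=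
  Cminus
    (sum_n (fun k : nat =>
       Cmult (Cinv (Cpow (RtoC (- omega)) k))
             (sum_n (fun j : nat =>
                Cmult (Cdiv (CderA (sigma_hat nu r a f g k) j a) (RtoC (INR (Factorial.fact j))))
                      (Mj j a b g (Cplus nu (RtoC (INR k))) omega)) r)) (m - 1))
    (sum_n (fun k : nat =>   (* index k here stands for k+1 in the paper, k+1 = 1..m *)
       Cmult (Cmult (Cinv (Cpow (RtoC (- omega)) (S k)))
                    (Cdiv (Cminus (CderB (sigma_hat nu r a f g k) 0 b)
                                  (Taylor r (sigma_hat nu r a f g k) a b))
                          (RtoC (derB g 1 b))))
             (BesselJ (Cplus nu (RtoC (INR (S k)))) (RtoC (omega * g b)))) (m - 1)).

(* Main.v *)
Require Import Defs.
From Stdlib Require Import Reals Lra Lia Factorial Psatz.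
From Coquelicot Require Import Coquelicot.

(** Since [(z^(mu+1) J_(mu+1))' = z^(mu+1) J_mu], integrating [(s - T_r[s]) J_nu(omega g)] by parts
    yields the boundary terms of [Q_m^A] and leaves [(-omega)^(-1)] times the same kind of integral
    for the next [sigma]; hence [H_nu[f] - Q_m^A[f] = (-omega)^(-m) H_(nu+m)[sigma_m]].
    The last integral is [O(omega^(-1/(r+1)))]: split it at distance [omega^(-1/(r+1))] from [a],
    bound the first part trivially and integrate the second by parts once more.  This only needs
    [J_mu] to be bounded on the real line for [Re mu >= 0], which follows from the energy
    [|J|^2 + |J'|^2] of Bessel's equation.  Smoothness of the [sigma_k] up to the endpoint [a]
    comes from [g = (x - a)^(r+1) p] and [g' = (x - a)^r p1] with [p], [p1] smooth and nonvanishing. *)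

Local Open Scope R_scope.

(** * Limits and derivatives of complex-valued functions *)

(** The sign of [g] is not prescribed, so [omega * g] may run over the negative axis, where
    principal powers carry the factor e^(i pi mu); the derivative formulas and the bound for Bessel
    functions are therefore proved at all nonzero real arguments. The only property of the Gamma
    function that enters is 1/Gamma(s) = s/Gamma(s+1): it gives the decay of the Bessel coefficients
    and the three-term recurrence. Since [lim] is total, each limit in the definitions first has to
    be shown to exist; for [CInt] this is where Re nu > -1/(r+1) is used, the integrand growing at
    most like (x - a)^((r+1) Re nu). The main obstacle is that sigma is a quotient by functions
    vanishing at [a], with complex powers of [g]. The powers cancel: with h = (s - T_r[s])/g', the
    next sigma is h' - e h g'/g. The Taylor remainder vanishes one order higher than g', so h
    contains a factor x - a, which removes the simple pole of g'/g and also kills the boundary term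
    at [a]. It remains to divide by x - a within the functions smooth up to [a]; this rests on a
    differential equation for the quotient, not on an integral formula. *)

Section Limits.
Context {T : Type} {F : (T -> Prop) -> Prop} {FF : Filter F}.

Lemma flim_plus (f g : T -> R) (l k : R) :
  filterlim f F (locally l) -> filterlim g F (locally k) ->
  filterlim (fun t => f t + g t) F (locally (l + k)).
Proof.
  intros Hf Hg.
  apply (filterlim_comp_2 f g Rplus Hf Hg (@filterlim_plus _ R_NormedModule l k)).
Qed.

Lemma flim_mult (f g : T -> R) (l k : R) :
  filterlim f F (locally l) -> filterlim g F (locally k) ->
  filterlim (fun t => f t * g t) F (locally (l * k)).
Proof.
  intros Hf Hg.
  apply (filterlim_comp_2 f g Rmult Hf Hg (@filterlim_mult R_AbsRing l k)).
Qed.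

Lemma flim_const (c : R) : filterlim (fun _ : T => c) F (locally c).
Proof. apply filterlim_const. Qed.

Lemma flim_opp (f : T -> R) (l : R) :
  filterlim f F (locally l) -> filterlim (fun t => - f t) F (locally (- l)).
Proof.
  intros Hf. apply (filterlim_comp _ _ _ f Ropp F (locally l) _ Hf).
  apply (@filterlim_opp _ R_NormedModule l).
Qed.

Lemma flim_minus (f g : T -> R) (l k : R) :
  filterlim f F (locally l) -> filterlim g F (locally k) ->
  filterlim (fun t => f t - g t) F (locally (l - k)).
Proof. intros Hf Hg. apply flim_plus; [exact Hf | apply flim_opp, Hg]. Qed.

Lemma flim_comp_continuous (h : R -> R) (f : T -> R) (l : R) :
  continuous h l -> filterlim f F (locally l) ->
  filterlim (fun t => h (f t)) F (locally (h l)).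
Proof. intros Hh Hf. exact (filterlim_comp _ _ _ f h F (locally l) _ Hf Hh). Qed.

Lemma flim_inv (f : T -> R) (l : R) :
  l <> 0 -> filterlim f F (locally l) ->
  filterlim (fun t => / f t) F (locally (/ l)).
Proof.
  intros Hl Hf. apply (flim_comp_continuous Rinv f l); [|exact Hf].
  apply (@ex_derive_continuous R_AbsRing R_NormedModule Rinv l). auto_derive. exact Hl.
Qed.

Lemma flim_div (f g : T -> R) (l k : R) :
  k <> 0 -> filterlim f F (locally l) -> filterlim g F (locally k) ->
  filterlim (fun t => f t / g t) F (locally (l / k)).
Proof. intros Hk Hf Hg. apply flim_mult; [exact Hf | apply flim_inv; assumption]. Qed.

Lemma flim_ext (f g : T -> R) (l : R) :
  F (fun t => f t = g t) -> filterlim f F (locally l) -> filterlim g F (locally l).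
Proof. intros H. apply filterlim_ext_loc, H. Qed.

Lemma flim_squeeze_0 (f h : T -> R) :
  F (fun t => Rabs (f t) <= h t) -> filterlim h F (locally 0) ->
  filterlim f F (locally 0).
Proof.
  intros H Hh. apply filterlim_locally. intros eps.
  pose proof (proj1 (filterlim_locally h 0) Hh eps) as Hh'.
  generalize (filter_and _ _ H Hh'). apply filter_imp. intros t [H1 H2].
  change (Rabs (f t - 0) < eps). change (Rabs (h t - 0) < eps) in H2.
  rewrite Rminus_0_r in *. apply Rle_lt_trans with (1 := H1).
  apply Rle_lt_trans with (2 := H2). apply Rle_abs.
Qed.

(** Componentwise convergence lets the real limit calculus do the work; [limC_Clim] links it to the
    limits in C used by the definitions. *)
Definition Clim (phi : T -> C) (l : C) : Prop :=
  filterlim (fun t => Re (phi t)) F (locally (Re l)) /\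
  filterlim (fun t => Im (phi t)) F (locally (Im l)).

Lemma Clim_ext (f g : T -> C) (l : C) :
  F (fun t => f t = g t) -> Clim f l -> Clim g l.
Proof.
  intros H [H1 H2].
  split; [revert H1 | revert H2]; apply flim_ext; revert H; apply filter_imp;
    intros t E; rewrite E; reflexivity.
Qed.

Lemma Clim_const (c : C) : Clim (fun _ => c) c.
Proof. split; apply flim_const. Qed.

Lemma Clim_RtoC (f : T -> R) (l : R) :
  filterlim f F (locally l) -> Clim (fun t => RtoC (f t)) (RtoC l).
Proof. intros H. split; [exact H | apply flim_const]. Qed.

Lemma Clim_plus (f g : T -> C) (l k : C) :
  Clim f l -> Clim g k -> Clim (fun t => Cplus (f t) (g t)) (Cplus l k).
Proof. intros [H1 H2] [H3 H4]. split; simpl; apply flim_plus; assumption. Qed.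

Lemma Clim_opp (f : T -> C) (l : C) :
  Clim f l -> Clim (fun t => Copp (f t)) (Copp l).
Proof. intros [H1 H2]. split; simpl; apply flim_opp; assumption. Qed.

Lemma Clim_minus (f g : T -> C) (l k : C) :
  Clim f l -> Clim g k -> Clim (fun t => Cminus (f t) (g t)) (Cminus l k).
Proof. intros Hf Hg. apply Clim_plus; [|apply Clim_opp]; assumption. Qed.

Lemma Clim_mult (f g : T -> C) (l k : C) :
  Clim f l -> Clim g k -> Clim (fun t => Cmult (f t) (g t)) (Cmult l k).
Proof.
  intros [H1 H2] [H3 H4]. split; simpl.
  - apply flim_minus; apply flim_mult; assumption.
  - apply flim_plus; apply flim_mult; assumption.
Qed.

Lemma Clim_sum_n (u : nat -> T -> C) (l : nat -> C) (n : nat) :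
  (forall j, (j <= n)%nat -> Clim (u j) (l j)) ->
  Clim (fun t => sum_n (fun j => u j t) n) (sum_n l n).
Proof.
  induction n as [|n IH]; intros H.
  - apply Clim_ext with (u O).
    + apply filter_forall. intros t. now rewrite sum_O.
    + rewrite sum_O. now apply H.
  - apply Clim_ext with (fun t => Cplus (sum_n (fun j => u j t) n) (u (S n) t)).
    + apply filter_forall. intros t. now rewrite sum_Sn.
    + rewrite sum_Sn. apply Clim_plus; [apply IH; intros j Hj|]; apply H; lia.
Qed.

Lemma Re_le_Cmod (z : C) : Rabs (Re z) <= Cmod z.
Proof. apply Rle_trans with (2 := Rmax_Cmod z). apply Rmax_l. Qed.

Lemma Im_le_Cmod (z : C) : Rabs (Im z) <= Cmod z.
Proof. apply Rle_trans with (2 := Rmax_Cmod z). apply Rmax_r. Qed.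

Lemma Cmod_le_abs (z : C) : Cmod z <= Rabs (Re z) + Rabs (Im z).
Proof.
  replace z with (Cplus (RtoC (Re z)) (Cmult Ci (RtoC (Im z)))) at 1.
  - eapply Rle_trans; [apply Cmod_triangle|].
    rewrite Cmod_mult, !Cmod_R, Cmod_Ci. lra.
  - destruct z. unfold Cplus, Cmult, RtoC, Ci, Re, Im. simpl. f_equal; ring.
Qed.

Lemma Clim_squeeze_0 (f : T -> C) (h : T -> R) :
  F (fun t => Cmod (f t) <= h t) -> filterlim h F (locally 0) ->
  Clim f (RtoC 0).
Proof.
  intros H Hh. split; apply flim_squeeze_0 with h; try exact Hh;
    revert H; apply filter_imp; intros t H; eapply Rle_trans; try exact H;
    [apply Re_le_Cmod | apply Im_le_Cmod].
Qed.

End Limits.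

Lemma flim_subfilter {T} (F G : (T -> Prop) -> Prop) (f : T -> R) (l : R) :
  filter_le F G -> filterlim f G (locally l) -> filterlim f F (locally l).
Proof. intros H. apply filterlim_filter_le_1, H. Qed.

(** [lim] is specified only on Cauchy filters. A convergent filter is Cauchy, so completeness
    applies and uniqueness of limits fixes the value. *)
Lemma lim_unique {V : CompleteNormedModule R_AbsRing}
  (F : (V -> Prop) -> Prop) {FF : ProperFilter F} (l : V) :
  filter_le F (locally l) -> lim F = l.
Proof.
  intros H.
  assert (HC : cauchy F).
  { intros eps. exists l. apply H. now exists eps. }
  assert (HL : filterlim (fun x => x) F (locally (lim F))).
  { apply filterlim_locally. exact (complete_cauchy F FF HC). }
  exact (filterlim_locally_unique (fun x => x) _ _ HL H).
Qed.

Section ProperLimits.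
Context {T : Type} {F : (T -> Prop) -> Prop} {FF : ProperFilter F}.

Lemma lim_filterlim (f : T -> R) (l : R) :
  filterlim f F (locally l) -> @lim R_CompleteNormedModule (filtermap f F) = l.
Proof.
  intros H. apply (@lim_unique R_CompleteNormedModule); [|exact H].
  apply filtermap_proper_filter, FF.
Qed.

Lemma limC_Clim (phi : T -> C) (l : C) :
  Clim (F := F) phi l -> limC (filtermap phi F) = l.
Proof.
  intros [H1 H2]. apply (@lim_unique C_R_CompleteNormedModule).
  - apply filtermap_proper_filter, FF.
  - intros P [eps HP].
    pose proof (proj1 (filterlim_locally _ _) H1 eps) as K1.
    pose proof (proj1 (filterlim_locally _ _) H2 eps) as K2.
    unfold filtermap. generalize (filter_and (F := F) _ _ K1 K2).
    apply filter_imp. intros t [B1 B2]. apply HP. split; assumption.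
Qed.

Lemma flim_unique (f : T -> R) (l k : R) :
  filterlim f F (locally l) -> filterlim f F (locally k) -> l = k.
Proof. intros H1 H2. exact (filterlim_locally_unique (V := R_NormedModule) f l k H1 H2). Qed.

Lemma Clim_unique (f : T -> C) (l k : C) :
  Clim (F := F) f l -> Clim (F := F) f k -> l = k.
Proof.
  intros H1 H2. rewrite <- (limC_Clim _ _ H1). now apply limC_Clim.
Qed.

Lemma flim_le (f : T -> R) (l M : R) :
  filterlim f F (locally l) -> F (fun t => f t <= M) -> l <= M.
Proof.
  intros H1 H2. apply Rnot_lt_le. intros H.
  assert (Hp : 0 < l - M) by lra.
  pose proof (proj1 (filterlim_locally _ _) H1 (mkposreal _ Hp)) as K1.
  destruct (filter_ex _ (filter_and _ _ K1 H2)) as [t [A B]].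
  change (Rabs (f t - l) < l - M) in A. apply Rabs_def2 in A. lra.
Qed.

(** The factor 2 is the price of treating real and imaginary parts separately; only orders of
    magnitude matter later. *)
Lemma Clim_Cmod_le (f : T -> C) (l : C) (M : R) :
  Clim (F := F) f l -> F (fun t => Cmod (f t) <= M) -> Cmod l <= 2 * M.
Proof.
  intros [H1 H2] H.
  assert (Rabs (Re l) <= M).
  { apply flim_le with (fun t => Rabs (Re (f t))).
    - apply (flim_comp_continuous Rabs); [apply continuous_Rabs | exact H1].
    - revert H. apply filter_imp. intros t. apply Rle_trans, Re_le_Cmod. }
  assert (Rabs (Im l) <= M).
  { apply flim_le with (fun t => Rabs (Im (f t))).
    - apply (flim_comp_continuous Rabs); [apply continuous_Rabs | exact H2].
    - revert H. apply filter_imp. intros t. apply Rle_trans, Im_le_Cmod. }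
  pose proof (Cmod_le_abs l). lra.
Qed.

End ProperLimits.

Arguments Clim {T} F phi l.

(** * Componentwise derivatives and the complex exponential *)

Definition Cderiv (phi : R -> C) (x : R) (l : C) : Prop :=
  is_derive (fun t => Re (phi t)) x (Re l) /\
  is_derive (fun t => Im (phi t)) x (Im l).

Lemma Cderiv_CDer (phi : R -> C) (x : R) (l : C) :
  Cderiv phi x l -> CDer phi x = l.
Proof.
  intros [H1 H2]. unfold CDer.
  apply injective_projections; apply is_derive_unique; assumption.
Qed.

Lemma is_derive_eq (f : R -> R) (x l k : R) :
  is_derive f x l -> l = k -> is_derive f x k.
Proof. now intros H <-. Qed.

Lemma Cderiv_eq (f : R -> C) (x : R) (l k : C) :
  Cderiv f x l -> l = k -> Cderiv f x k.
Proof. now intros H <-. Qed.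

Lemma Cderiv_ext_loc (f g : R -> C) (x : R) (l : C) :
  locally x (fun t => f t = g t) -> Cderiv f x l -> Cderiv g x l.
Proof.
  intros H [H1 H2].
  split; [revert H1 | revert H2]; apply is_derive_ext_loc; revert H;
    apply filter_imp; intros t E; now rewrite E.
Qed.

Lemma Cderiv_const (c : C) (x : R) : Cderiv (fun _ => c) x (RtoC 0).
Proof. split; apply (@is_derive_const R_AbsRing R_NormedModule). Qed.

Lemma Cderiv_RtoC (f : R -> R) (x l : R) :
  is_derive f x l -> Cderiv (fun t => RtoC (f t)) x (RtoC l).
Proof.
  intros H. split; [exact H|].
  exact (@is_derive_const R_AbsRing R_NormedModule 0 x).
Qed.

Lemma Cderiv_plus (f g : R -> C) (x : R) (l k : C) :
  Cderiv f x l -> Cderiv g x k ->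
  Cderiv (fun t => Cplus (f t) (g t)) x (Cplus l k).
Proof.
  intros [H1 H2] [H3 H4].
  split; simpl; apply (@is_derive_plus R_AbsRing R_NormedModule); assumption.
Qed.

Lemma Cderiv_mult (f g : R -> C) (x : R) (l k : C) :
  Cderiv f x l -> Cderiv g x k ->
  Cderiv (fun t => Cmult (f t) (g t)) x (Cplus (Cmult l (g x)) (Cmult (f x) k)).
Proof.
  intros [H1 H2] [H3 H4]. split; simpl.
  - eapply is_derive_eq.
    + apply (@is_derive_minus R_AbsRing R_NormedModule);
        apply Derive.is_derive_mult; eassumption.
    + unfold minus, plus, opp; simpl. unfold Re, Im. ring.
  - eapply is_derive_eq.
    + apply (@is_derive_plus R_AbsRing R_NormedModule);
        apply Derive.is_derive_mult; eassumption.
    + unfold minus, plus, opp; simpl. unfold Re, Im. ring.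
Qed.

Lemma Cderiv_minus (f g : R -> C) (x : R) (l k : C) :
  Cderiv f x l -> Cderiv g x k ->
  Cderiv (fun t => Cminus (f t) (g t)) x (Cminus l k).
Proof.
  intros [H1 H2] [H3 H4].
  split; simpl; apply (@is_derive_minus R_AbsRing R_NormedModule); assumption.
Qed.

Lemma Cderiv_comp (f : R -> C) (h : R -> R) (x dh : R) (l : C) :
  Cderiv f (h x) l -> is_derive h x dh ->
  Cderiv (fun t => f (h t)) x (Cmult (RtoC dh) l).
Proof.
  intros [H1 H2] Hh. split.
  - eapply is_derive_eq.
    + apply (@is_derive_comp R_AbsRing R_NormedModule (fun t => Re (f t)) h); eassumption.
    + unfold scal; simpl. unfold mult; simpl. unfold Re, Im. ring.
  - eapply is_derive_eq.
    + apply (@is_derive_comp R_AbsRing R_NormedModule (fun t => Im (f t)) h); eassumption.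
    + unfold scal; simpl. unfold mult; simpl. unfold Re, Im. ring.
Qed.

Lemma Cderiv_Clim (f : R -> C) (x : R) (l : C) :
  Cderiv f x l -> Clim (locally x) f (f x).
Proof.
  intros [H1 H2]; split.
  - apply (@ex_derive_continuous R_AbsRing R_NormedModule (fun t => Re (f t))). now exists (Re l).
  - apply (@ex_derive_continuous R_AbsRing R_NormedModule (fun t => Im (f t))). now exists (Im l).
Qed.

Lemma Cderiv_Cexp (z : R -> C) (x : R) (l : C) :
  Cderiv z x l -> Cderiv (fun t => Cexp (z t)) x (Cmult l (Cexp (z x))).
Proof.
  intros [H1 H2]. split; simpl.
  - eapply is_derive_eq.
    + apply Derive.is_derive_mult.
      * apply (@is_derive_comp R_AbsRing R_NormedModule exp); [apply is_derive_exp | exact H1].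
      * apply (@is_derive_comp R_AbsRing R_NormedModule cos); [apply is_derive_cos | exact H2].
    + unfold scal; simpl. unfold mult; simpl. unfold Re, Im. ring.
  - eapply is_derive_eq.
    + apply Derive.is_derive_mult.
      * apply (@is_derive_comp R_AbsRing R_NormedModule exp); [apply is_derive_exp | exact H1].
      * apply (@is_derive_comp R_AbsRing R_NormedModule sin); [apply is_derive_sin | exact H2].
    + unfold scal; simpl. unfold mult; simpl. unfold Re, Im. ring.
Qed.

Lemma Cexp_plus (z w : C) : Cexp (Cplus z w) = Cmult (Cexp z) (Cexp w).
Proof.
  unfold Cexp, Cmult. destruct z as [x y], w as [u v]. simpl.
  rewrite exp_plus, cos_plus, sin_plus. f_equal; ring.
Qed.

Lemma Cmod_Cexp (z : C) : Cmod (Cexp z) = exp (Re z).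
Proof.
  unfold Cmod, Cexp. simpl.
  replace (_ + _) with (exp (Re z) * exp (Re z) * (Rsqr (sin (Im z)) + Rsqr (cos (Im z))))
    by (unfold Rsqr; ring).
  rewrite sin2_cos2, Rmult_1_r. apply sqrt_square, Rlt_le, exp_pos.
Qed.

Lemma Cexp_0 : Cexp (RtoC 0) = RtoC 1.
Proof. unfold Cexp. simpl. rewrite exp_0, cos_0, sin_0. unfold RtoC. f_equal; ring. Qed.

(** * The reciprocal Gamma function *)

(** A real number has imaginary part 0 and so falls under the branch [0 <= Im z] of [Carg]: its
    argument is 0 or pi, never -pi. *)
Lemma cpow_real (x : R) (w : C) :
  x <> 0 -> cpow (RtoC x) w = Cexp (Cmult w (ln (Rabs x), acos (x / Rabs x))).
Proof.
  intros Hx. unfold cpow, Clog, Carg. rewrite !Cmod_R.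
  destruct (Req_EM_T (Rabs x) 0) as [E|_].
  - now apply Rabs_no_R0 in E.
  - simpl. destruct (Rle_dec 0 0) as [_|N]; [reflexivity | lra].
Qed.

Lemma cpow_pos (x : R) (w : C) :
  0 < x -> cpow (RtoC x) w = Cexp (Cmult w (RtoC (ln x))).
Proof.
  intros Hx. rewrite cpow_real by lra. rewrite Rabs_pos_eq by lra.
  replace (x / x) with 1 by (field; lra). now rewrite acos_1.
Qed.

Lemma Cexp_neq_0 (z : C) : Cexp z <> RtoC 0.
Proof.
  intros E. pose proof (Cmod_Cexp z) as H. rewrite E, Cmod_0 in H.
  pose proof (exp_pos (Re z)). lra.
Qed.

Lemma Cexp_opp (z : C) : Cexp (Copp z) = Cinv (Cexp z).
Proof.
  assert (H : Cmult (Cexp (Copp z)) (Cexp z) = RtoC 1).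
  { rewrite <- Cexp_plus. replace (Cplus (Copp z) z) with (RtoC 0) by ring. apply Cexp_0. }
  rewrite <- (Cmult_1_r (Cexp (Copp z))), <- (Cinv_r (Cexp z)) by apply Cexp_neq_0.
  rewrite Cmult_assoc, H. ring.
Qed.

Lemma exp_le_exp (x y : R) : x <= y -> exp x <= exp y.
Proof. intros [H|<-]; [now apply Rlt_le, exp_increasing | apply Rle_refl]. Qed.

Definition gauss_prod (s : C) (n : nat) : C :=
  Cdiv (poch_prod s n)
    (Cmult (RtoC (INR (Factorial.fact n))) (cpow (RtoC (INR n)) s)).

(** With e = 1/(n+1) this is the quotient of consecutive Gauss products, (1 + s/(n+1)) (n/(n+1))^s.
    Letting e vary over the reals makes it differentiable. *)
Definition gauss_ratio (s : C) (e : R) : C :=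
  Cmult (Cplus (RtoC 1) (Cmult s (RtoC e))) (Cexp (Cmult s (RtoC (ln (1 - e))))).

Lemma gauss_prod_S (s : C) (n : nat) : (1 <= n)%nat ->
  gauss_prod s (S n) = Cmult (gauss_prod s n) (gauss_ratio s (/ INR (S n))).
Proof.
  intros Hn. unfold gauss_prod, gauss_ratio.
  assert (Hn0 : 0 < INR n) by (apply lt_0_INR; lia).
  assert (HN0 : 0 < INR (S n)) by (apply lt_0_INR; lia).
  rewrite !cpow_pos by assumption.
  replace (1 - / INR (S n)) with (INR n / INR (S n))
    by (rewrite S_INR; field; rewrite <- S_INR; lra).
  unfold Rdiv. rewrite ln_mult, ln_Rinv by (try apply Rinv_0_lt_compat; assumption).
  rewrite RtoC_plus, RtoC_opp, Cmult_plus_distr_l, Cexp_plus.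
  replace (Cmult s (Copp (RtoC (ln (INR (S n))))))
    with (Copp (Cmult s (RtoC (ln (INR (S n)))))) by ring.
  rewrite Cexp_opp.
  change (poch_prod s (S n)) with (Cmult (poch_prod s n) (Cplus s (RtoC (INR (S n))))).
  change (Factorial.fact (S n)) with ((S n) * Factorial.fact n)%nat.
  rewrite mult_INR, RtoC_mult, RtoC_inv by lra.
  pose proof (Cexp_neq_0 (Cmult s (RtoC (ln (INR n))))).
  pose proof (Cexp_neq_0 (Cmult s (RtoC (ln (INR (S n)))))).
  assert (RtoC (INR (S n)) <> RtoC 0) by (intros E; apply RtoC_inj in E; lra).
  assert (RtoC (INR (Factorial.fact n)) <> RtoC 0)
    by (intros E; apply RtoC_inj in E; now apply INR_fact_neq_0 in E).
  field. repeat split; assumption.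
Qed.

(** The derivative of (1 + s e)(1 - e)^s is -s(1 + s) e/(1 - e) times (1 - e)^s. It vanishes at e =
    0, so the ratio differs from 1 only to second order; adding the mean value bounds of the two
    components doubles the constant. *)
Lemma gauss_ratio_bound (s : C) :
  exists D, 0 <= D /\ forall e, 0 <= e <= / 2 ->
    Cmod (Cminus (gauss_ratio s e) (RtoC 1)) <= D * e ^ 2.
Proof.
  (* For |t| <= 1/2 the leading 2 bounds 1/(1 - t), and the exponential bounds the modulus of (1 -
     t)^s, because |ln (1 - t)| <= ln 2. *)
  set (D := 2 * Cmod s * Cmod (Cplus (RtoC 1) s) * exp (Rabs (Re s) * ln 2)).
  assert (HD : 0 <= D).
  { unfold D. repeat apply Rmult_le_pos; try apply Cmod_ge_0; try lra.
    apply Rlt_le, exp_pos. }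
  set (dpsi := fun t : R =>
    Cmult (Cmult (Copp (Cmult s (Cplus (RtoC 1) s))) (RtoC (t / (1 - t))))
          (Cexp (Cmult s (RtoC (ln (1 - t)))))).
  assert (Hd : forall t, t < 1 -> Cderiv (gauss_ratio s) t (dpsi t)).
  { intros t Ht. unfold gauss_ratio. eapply Cderiv_eq.
    - apply Cderiv_mult.
      + apply Cderiv_plus; [apply Cderiv_const|].
        apply Cderiv_mult; [apply Cderiv_const|].
        apply Cderiv_RtoC. apply (is_derive_id (K := R_AbsRing)).
      + apply Cderiv_Cexp. apply Cderiv_mult; [apply Cderiv_const|].
        apply (Cderiv_RtoC (fun t => ln (1 - t)) t (- / (1 - t))).
        auto_derive; [lra | field; lra].
    - unfold dpsi, Rdiv. change (@one R_AbsRing) with 1.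
      assert (RtoC (1 - t) <> RtoC 0) by (intros E; apply RtoC_inj in E; lra).
      rewrite RtoC_mult, RtoC_opp, RtoC_inv by lra.
      rewrite RtoC_minus in *.
      field. assumption. }
  assert (Hb : forall t, Rabs t <= / 2 -> Cmod (dpsi t) <= D * Rabs t).
  { intros t Ht. apply Rabs_le_between in Ht. unfold dpsi.
    rewrite !Cmod_mult, Cmod_opp, Cmod_mult, Cmod_R, Cmod_Cexp.
    assert (H1 : Rabs (t / (1 - t)) <= 2 * Rabs t).
    { unfold Rdiv. rewrite Rabs_mult, Rmult_comm.
      apply Rmult_le_compat_r; [apply Rabs_pos|].
      rewrite Rabs_pos_eq by (apply Rlt_le, Rinv_0_lt_compat; lra).
      rewrite <- (Rinv_inv 2). apply Rinv_le_contravar; lra. }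
    assert (H2 : exp (Re (Cmult s (RtoC (ln (1 - t))))) <= exp (Rabs (Re s) * ln 2)).
    { apply exp_le_exp. replace (Re (Cmult s (RtoC (ln (1 - t))))) with (Re s * ln (1 - t))
        by (unfold Re; simpl; ring).
      apply Rle_trans with (1 := Rle_abs _). rewrite Rabs_mult.
      apply Rmult_le_compat_l; [apply Rabs_pos|].
      apply Rabs_le. split.
      - rewrite <- ln_Rinv by lra. apply ln_le; lra.
      - apply ln_le; lra. }
    unfold D.
    replace (2 * Cmod s * Cmod (Cplus (RtoC 1) s) * exp (Rabs (Re s) * ln 2) * Rabs t)
      with (Cmod s * Cmod (Cplus (RtoC 1) s) * (2 * Rabs t) * exp (Rabs (Re s) * ln 2)) by ring.
    apply Rmult_le_compat; [|apply Rlt_le, exp_pos| |exact H2].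
    - repeat apply Rmult_le_pos; try apply Cmod_ge_0. apply Rabs_pos.
    - apply Rmult_le_compat_l; [|exact H1]. apply Rmult_le_pos; apply Cmod_ge_0. }
  assert (H0 : gauss_ratio s 0 = RtoC 1).
  { unfold gauss_ratio. rewrite Rminus_0_r, ln_1, Cmult_0_r, Cexp_0. ring. }
  exists (2 * D). split; [lra|]. intros e He.
  assert (Hk : forall t, Rabs (t - 0) <= Rabs (e - 0) ->
            t < 1 /\ Cmod (dpsi t) <= D * e).
  { intros t Ht. rewrite !Rminus_0_r, (Rabs_pos_eq e) in Ht by lra. split.
    - apply Rabs_le_between in Ht. lra.
    - apply Rle_trans with (1 := Hb t ltac:(lra)). apply Rmult_le_compat_l; lra. }
  assert (K1 : Rabs (Re (gauss_ratio s e) - Re (gauss_ratio s 0)) <= D * e * Rabs (e - 0)).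
  { apply (bounded_variation (fun t => Re (gauss_ratio s t)) (fun t => Re (dpsi t)) (D * e) 0 e).
    intros t Ht. destruct (Hk t Ht) as [A B]. split; [apply Hd, A|].
    eapply Rle_trans; [apply Re_le_Cmod | exact B]. }
  assert (K2 : Rabs (Im (gauss_ratio s e) - Im (gauss_ratio s 0)) <= D * e * Rabs (e - 0)).
  { apply (bounded_variation (fun t => Im (gauss_ratio s t)) (fun t => Im (dpsi t)) (D * e) 0 e).
    intros t Ht. destruct (Hk t Ht) as [A B]. split; [apply Hd, A|].
    eapply Rle_trans; [apply Im_le_Cmod | exact B]. }
  rewrite H0, (Rminus_0_r e), (Rabs_pos_eq e) in K1, K2 by lra.
  eapply Rle_trans; [apply Cmod_le_abs|].
  replace (2 * D * e ^ 2) with (D * e * e + D * e * e) by ring.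
  apply Rplus_le_compat; assumption.
Qed.

(** The bounds telescope: all increments from n on add up to at most B/n, so the sequence is
    Cauchy. *)
Lemma Clim_of_summable_increments (p : nat -> C) (B : R) :
  (forall n, (1 <= n)%nat ->
     Cmod (Cminus (p (S n)) (p n)) <= B * (/ INR n - / INR (S n))) ->
  exists l, Clim eventually p l.
Proof.
  intros H.
  assert (HB : 0 <= B).
  { pose proof (H 1%nat (le_n 1)) as H1. pose proof (Cmod_ge_0 (Cminus (p 2%nat) (p 1%nat))).
    simpl in H1. lra. }
  assert (Hc : forall n k, (1 <= n)%nat ->
    Cmod (Cminus (p (n + k)%nat) (p n)) <= B * (/ INR n - / INR (n + k))).
  { intros n k Hn. induction k as [|k IH].
    - rewrite Nat.add_0_r. unfold Cminus. rewrite Cplus_opp_r, Cmod_0. lra.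
    - rewrite Nat.add_succ_r.
      replace (Cminus (p (S (n + k))) (p n))
        with (Cplus (Cminus (p (S (n + k))) (p (n + k)%nat)) (Cminus (p (n + k)%nat) (p n))) by ring.
      eapply Rle_trans; [apply Cmod_triangle|].
      pose proof (H (n + k)%nat ltac:(lia)). lra. }
  assert (Hcauchy : forall eps : posreal, exists N : nat, forall n m : nat,
    (N <= n)%nat -> (N <= m)%nat -> Cmod (Cminus (p n) (p m)) < eps).
  { intros eps.
    destruct (nfloor_ex (Rmax 0 (B / eps))) as [N [_ HN]]; [apply Rmax_l|].
    assert (HN' : forall n m, (S N <= n)%nat -> (n <= m)%nat -> Cmod (Cminus (p m) (p n)) < eps).
    { intros n m Hn Hm. replace m with (n + (m - n))%nat by lia.
      eapply Rle_lt_trans; [apply Hc; lia|].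
      assert (0 < INR n) by (apply lt_0_INR; lia).
      assert (0 < / INR (n + (m - n))) by (apply Rinv_0_lt_compat, lt_0_INR; lia).
      assert (B / eps < INR n).
      { apply Rle_lt_trans with (1 := Rmax_r 0 _). apply Rlt_le_trans with (1 := HN).
        rewrite <- S_INR. now apply le_INR. }
      apply Rle_lt_trans with (B * / INR n).
      - apply Rmult_le_compat_l; lra.
      - apply (Rmult_lt_reg_r (INR n)); [assumption|].
        rewrite Rmult_assoc, Rinv_l, Rmult_1_r by lra.
        apply (Rmult_lt_reg_r (/ eps)); [apply Rinv_0_lt_compat, cond_pos|].
        replace (eps * INR n * / eps) with (INR n) by (field; apply Rgt_not_eq, cond_pos).
        assumption. }
    exists (S N). intros n m Hn Hm. destruct (Nat.le_ge_cases n m) as [L|L].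
    - replace (Cminus (p n) (p m)) with (Copp (Cminus (p m) (p n))) by ring.
      rewrite Cmod_opp. now apply HN'.
    - now apply HN'. }
  assert (Hre : exists l, filterlim (fun n => Re (p n)) eventually (locally l)).
  { apply (filterlim_locally_cauchy (U := R_CompleteNormedModule)). intros eps.
    destruct (Hcauchy eps) as [N HN]. exists (fun n => (N <= n)%nat).
    split; [now exists N|]. intros u v Hu Hv.
    change (Rabs (Re (p v) - Re (p u)) < eps).
    eapply Rle_lt_trans; [apply (Re_le_Cmod (Cminus (p v) (p u))) | now apply HN]. }
  assert (Him : exists l, filterlim (fun n => Im (p n)) eventually (locally l)).
  { apply (filterlim_locally_cauchy (U := R_CompleteNormedModule)). intros eps.
    destruct (Hcauchy eps) as [N HN]. exists (fun n => (N <= n)%nat).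
    split; [now exists N|]. intros u v Hu Hv.
    change (Rabs (Im (p v) - Im (p u)) < eps).
    eapply Rle_lt_trans; [apply (Im_le_Cmod (Cminus (p v) (p u))) | now apply HN]. }
  destruct Hre as [x Hx], Him as [y Hy]. now exists (x, y).
Qed.

(** An increment is p_n times (ratio - 1), and the second factor is O(1/(n(n+1))). Summability thus
    reduces to a bound on |p_n|, for every complex s. *)
Lemma gauss_prod_cv (s : C) : Clim eventually (gauss_prod s) (rgamma s).
Proof.
  assert (H : exists l, Clim eventually (gauss_prod s) l).
  { destruct (gauss_ratio_bound s) as [D [HD Hr]].
    set (B := Cmod (gauss_prod s 1) * exp D).
    assert (Hr' : forall n, (1 <= n)%nat ->
      Cmod (Cminus (gauss_ratio s (/ INR (S n))) (RtoC 1)) <= D * (/ INR n - / INR (S n))).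
    { intros n Hn. assert (1 <= INR n) by (apply (le_INR 1 n); lia).
      assert (E : INR (S n) = INR n + 1) by apply S_INR.
      eapply Rle_trans; [apply Hr; split|].
      - apply Rlt_le, Rinv_0_lt_compat; lra.
      - apply Rinv_le_contravar; lra.
      - apply Rmult_le_compat_l; [exact HD|].
        replace (/ INR n - / INR (S n)) with (/ (INR n * INR (S n))) by (rewrite E; field; lra).
        rewrite pow_inv. rewrite E. apply Rinv_le_contravar; nra. }
    (* [|p_n| exp (D / n)] is nonincreasing, since
       [|p_(n+1)| <= (1 + D (1/n - 1/(n+1))) |p_n|]. *)
    assert (HB : forall n, (1 <= n)%nat -> Cmod (gauss_prod s n) * exp (D / INR n) <= B).
    { intros n Hn. induction Hn as [|n Hn IH].
      - simpl INR. unfold B, Rdiv. rewrite Rinv_1, Rmult_1_r. apply Rle_refl.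
      - eapply Rle_trans; [|exact IH]. rewrite gauss_prod_S by exact Hn.
        rewrite Cmod_mult, Rmult_assoc. apply Rmult_le_compat_l; [apply Cmod_ge_0|].
        replace (D / INR n) with (D * (/ INR n - / INR (S n)) + D / INR (S n)) by (unfold Rdiv; ring).
        rewrite exp_plus. apply Rmult_le_compat_r; [apply Rlt_le, exp_pos|].
        eapply Rle_trans; [|apply exp_ineq1_le].
        replace (gauss_ratio s (/ INR (S n)))
          with (Cplus (RtoC 1) (Cminus (gauss_ratio s (/ INR (S n))) (RtoC 1))) by ring.
        eapply Rle_trans; [apply Cmod_triangle|]. rewrite Cmod_1. pose proof (Hr' n Hn). lra. }
    apply Clim_of_summable_increments with (B * D). intros n Hn.
    rewrite gauss_prod_S by exact Hn.
    replace (Cminus (Cmult (gauss_prod s n) (gauss_ratio s (/ INR (S n)))) (gauss_prod s n))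
      with (Cmult (gauss_prod s n) (Cminus (gauss_ratio s (/ INR (S n))) (RtoC 1))) by ring.
    rewrite Cmod_mult, Rmult_assoc.
    apply Rmult_le_compat; try apply Cmod_ge_0; [|apply Hr', Hn].
    apply Rle_trans with (2 := HB n Hn).
    rewrite <- (Rmult_1_r (Cmod _)) at 1. apply Rmult_le_compat_l; [apply Cmod_ge_0|].
    eapply Rle_trans; [|apply exp_ineq1_le].
    assert (0 <= D / INR n); [|lra]. apply Rdiv_le_0_compat; [lra | apply lt_0_INR; lia]. }
  destruct H as [l Hl]. unfold rgamma. fold (gauss_prod s).
  now rewrite (limC_Clim _ _ Hl).
Qed.

Lemma poch_prod_shift (s : C) (n : nat) :
  Cmult s (poch_prod (Cplus s (RtoC 1)) n) =
  Cmult (poch_prod s n) (Cplus s (RtoC (INR (S n)))).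
Proof.
  induction n as [|n IH].
  - simpl. reflexivity.
  - change (poch_prod (Cplus s (RtoC 1)) (S n))
      with (Cmult (poch_prod (Cplus s (RtoC 1)) n) (Cplus (Cplus s (RtoC 1)) (RtoC (INR (S n))))).
    rewrite Cmult_assoc, IH.
    change (poch_prod s (S n)) with (Cmult (poch_prod s n) (Cplus s (RtoC (INR (S n))))).
    rewrite (S_INR (S n)), RtoC_plus. ring.
Qed.

(** For the Gauss products, s p_n(s+1) = p_n(s) (1 + (s+1)/n), and the last factor tends to 1. No
    division by s occurs, so the poles of Gamma are included. *)
Lemma rgamma_shift (s : C) : rgamma s = Cmult s (rgamma (Cplus s (RtoC 1))).
Proof.
  apply (Clim_unique (F := eventually)
    (fun n => Cmult (gauss_prod s n) (Cplus (RtoC 1) (Cmult (Cplus s (RtoC 1)) (RtoC (/ INR n)))))).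
  - replace (rgamma s) with (Cmult (rgamma s) (Cplus (RtoC 1) (Cmult (Cplus s (RtoC 1)) (RtoC 0)))) by ring.
    apply Clim_mult; [apply gauss_prod_cv|]. apply Clim_plus; [apply Clim_const|].
    apply Clim_mult; [apply Clim_const|]. apply Clim_RtoC.
    apply (is_lim_seq_inv INR p_infty is_lim_seq_INR). discriminate.
  - apply Clim_ext with (fun n => Cmult s (gauss_prod (Cplus s (RtoC 1)) n)).
    + exists 1%nat. intros n Hn. unfold gauss_prod.
      assert (0 < INR n) by (apply lt_0_INR; lia).
      rewrite !cpow_pos by assumption.
      unfold Cdiv. rewrite Cmult_assoc, poch_prod_shift, S_INR, RtoC_plus, RtoC_inv by lra.
      assert (E : Cexp (Cmult (Cplus s (RtoC 1)) (RtoC (ln (INR n)))) =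
                  Cmult (Cexp (Cmult s (RtoC (ln (INR n))))) (RtoC (INR n))).
      { replace (Cmult (Cplus s (RtoC 1)) (RtoC (ln (INR n))))
          with (Cplus (Cmult s (RtoC (ln (INR n)))) (RtoC (ln (INR n)))) by ring.
        rewrite Cexp_plus. f_equal. unfold Cexp. simpl.
        rewrite cos_0, sin_0, exp_ln by assumption. unfold RtoC. f_equal; ring. }
      rewrite E.
      pose proof (Cexp_neq_0 (Cmult s (RtoC (ln (INR n))))).
      assert (RtoC (INR n) <> RtoC 0) by (intros E'; apply RtoC_inj in E'; lra).
      assert (RtoC (INR (Factorial.fact n)) <> RtoC 0)
        by (intros E'; apply RtoC_inj in E'; now apply INR_fact_neq_0 in E').
      field. repeat split; assumption.
    + apply Clim_mult; [apply Clim_const | apply gauss_prod_cv].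
Qed.

(** * Bessel functions of complex order on the real line *)

Lemma RtoC_neq_0 (x : R) : x <> 0 -> RtoC x <> RtoC 0.
Proof. intros H E. now apply RtoC_inj in E. Qed.

Lemma acos_m1 : acos (-1) = PI.
Proof. replace (-1) with (Ropp 1) by ring. rewrite acos_opp, acos_1. ring. Qed.

Lemma cpow_neg (x : R) (w : C) :
  x < 0 -> cpow (RtoC x) w = Cexp (Cmult w (ln (- x), PI)).
Proof.
  intros Hx. rewrite cpow_real by lra. rewrite Rabs_left by lra.
  replace (x / - x) with (-1) by (field; lra). now rewrite acos_m1.
Qed.

Lemma cpow_opp (x : R) (w : C) : 0 < x ->
  cpow (RtoC (- x)) w = Cmult (Cexp (Cmult w (0, PI))) (cpow (RtoC x) w).
Proof.
  intros Hx. rewrite cpow_neg, cpow_pos, Ropp_involutive, <- Cexp_plus by lra.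
  f_equal. rewrite <- Cmult_plus_distr_l. f_equal. unfold Cplus, RtoC; simpl.
  f_equal; ring.
Qed.

(** Valid for negative [x] too, since all three powers use the same logarithm of [x]. *)
Lemma cpow_plus (x : R) (v w : C) : x <> 0 ->
  cpow (RtoC x) (Cplus v w) = Cmult (cpow (RtoC x) v) (cpow (RtoC x) w).
Proof.
  intros Hx. rewrite !cpow_real by assumption.
  now rewrite Cmult_plus_distr_r, Cexp_plus.
Qed.

Lemma cpow_neq_0 (x : R) (w : C) : x <> 0 -> cpow (RtoC x) w <> RtoC 0.
Proof. intros Hx. rewrite cpow_real by assumption. apply Cexp_neq_0. Qed.

Lemma cpow_1 (x : R) : x <> 0 -> cpow (RtoC x) (RtoC 1) = RtoC x.
Proof.
  intros Hx. destruct (Rtotal_order x 0) as [H|[H|H]]; [|easy|].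
  - rewrite cpow_neg, Cmult_1_l by assumption. unfold Cexp; simpl.
    rewrite exp_ln, cos_PI, sin_PI by lra. unfold RtoC. f_equal; ring.
  - rewrite cpow_pos, Cmult_1_l by assumption. unfold Cexp; simpl.
    rewrite exp_ln, cos_0, sin_0 by lra. unfold RtoC. f_equal; ring.
Qed.

Lemma Cmod_cpow_pos (x : R) (w : C) : 0 < x -> Cmod (cpow (RtoC x) w) = Rpower x (Re w).
Proof.
  intros Hx. rewrite cpow_pos, Cmod_Cexp by assumption. unfold Rpower. f_equal.
  unfold Re; simpl. ring.
Qed.

Lemma Cderiv_cpow (x : R) (w : C) : x <> 0 ->
  Cderiv (fun t => cpow (RtoC t) w) x
    (Cmult (Cmult w (RtoC (/ x))) (cpow (RtoC x) w)).
Proof.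
  intros Hx. destruct (Rtotal_order x 0) as [H|[H|H]]; [|easy|].
  - apply Cderiv_ext_loc with (fun t => Cexp (Cmult w (Cplus (RtoC (ln (- t))) (0, PI)))).
    + exists (mkposreal (- x) ltac:(lra)). intros t Ht.
      change (Rabs (t - x) < - x) in Ht. apply Rabs_def2 in Ht.
      rewrite cpow_neg by lra. f_equal. f_equal. unfold Cplus, RtoC; simpl. f_equal; ring.
    + eapply Cderiv_eq.
      * apply Cderiv_Cexp. apply Cderiv_mult; [apply Cderiv_const|].
        apply Cderiv_plus; [|apply Cderiv_const].
        apply (Cderiv_RtoC (fun t => ln (- t)) x (/ x)). auto_derive; [lra | field; lra].
      * rewrite cpow_neg by lra.
        replace (Cplus (RtoC (ln (- x))) (0, PI)) with (ln (- x), PI)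
          by (unfold Cplus, RtoC; simpl; f_equal; ring).
        ring.
  - apply Cderiv_ext_loc with (fun t => Cexp (Cmult w (RtoC (ln t)))).
    + exists (mkposreal x H). intros t Ht.
      change (Rabs (t - x) < x) in Ht. apply Rabs_def2 in Ht.
      rewrite cpow_pos by lra. reflexivity.
    + eapply Cderiv_eq.
      * apply Cderiv_Cexp. apply Cderiv_mult; [apply Cderiv_const|].
        apply (Cderiv_RtoC ln x (/ x)). now apply is_derive_ln.
      * rewrite cpow_pos by lra. ring.
Qed.

(** * The power series of the Bessel function, its derivative and recurrences *)

Definition bessel_coef (mu : C) (k : nat) : C :=
  Cmult (Cdiv (RtoC ((-1) ^ k)) (RtoC (INR (Factorial.fact k))))
        (rgamma (Cplus mu (RtoC (INR k + 1)))).

(* The entire function with [J_mu z = (z/2)^mu * bessel_entire mu ((z/2)^2)]. *)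
Definition bessel_entire (mu : C) (y : R) : C :=
  (PSeries (fun k => Re (bessel_coef mu k)) y, PSeries (fun k => Im (bessel_coef mu k)) y).

(** For k >= 1 the modulus of mu + k + 1 is at least its real part, hence at least 1, so the
    functional equation makes |1/Gamma(mu+k+1)| nonincreasing in k. The term k = 0 is counted
    separately, as Re mu + 1 may be below 1. *)
Lemma bessel_coef_bound (mu : C) : - 1 < Re mu ->
  exists B, forall k, Cmod (bessel_coef mu k) <= B / INR (Factorial.fact k).
Proof.
  intros Hmu.
  set (G := fun k : nat => rgamma (Cplus mu (RtoC (INR k + 1)))).
  assert (HG : forall k, G k = Cmult (Cplus mu (RtoC (INR k + 1))) (G (S k))).
  { intros k. unfold G. rewrite rgamma_shift. f_equal. f_equal.
    rewrite S_INR, !RtoC_plus. ring. }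
  assert (HG1 : forall k, Cmod (G (S k)) <= Cmod (G 1%nat)).
  { induction k as [|k IH]; [apply Rle_refl|].
    apply Rle_trans with (2 := IH). rewrite (HG (S k)), Cmod_mult.
    rewrite <- (Rmult_1_l (Cmod (G (S (S k))))) at 1.
    apply Rmult_le_compat_r; [apply Cmod_ge_0|].
    eapply Rle_trans; [|apply (Re_le_Cmod _)].
    eapply Rle_trans; [|apply Rle_abs].
    change (1 <= Re mu + (INR (S k) + 1)). rewrite S_INR. pose proof (pos_INR k). lra. }
  exists (Cmod (G 0%nat) + Cmod (G 1%nat)). intros k.
  unfold bessel_coef. fold (G k). unfold Cdiv.
  assert (Hf : 0 < INR (Factorial.fact k)) by apply INR_fact_lt_0.
  rewrite !Cmod_mult, <- RtoC_inv, !Cmod_R, <- RPow_abs by lra.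
  rewrite Rabs_m1, pow1, Rmult_1_l.
  rewrite (Rabs_pos_eq (/ _)) by (apply Rlt_le, Rinv_0_lt_compat, Hf).
  unfold Rdiv. rewrite Rmult_comm. apply Rmult_le_compat_r.
  - apply Rlt_le, Rinv_0_lt_compat, Hf.
  - pose proof (Cmod_ge_0 (G 0%nat)). pose proof (Cmod_ge_0 (G 1%nat)).
    destruct k as [|k]; [lra|]. pose proof (HG1 k). lra.
Qed.

(** The terms are dominated by those of the exponential series, which are bounded at every
    radius. *)
Lemma CV_radius_factorial (u : nat -> R) (B : R) :
  (forall k, Rabs (u k) <= B / INR (Factorial.fact k)) -> CV_radius u = p_infty.
Proof.
  intros H.
  assert (HR : forall r : R, Rbar_le r (CV_radius u)).
  { intros r. apply (CV_radius_bounded u).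
    assert (Hs : ex_series (fun k => / INR (Factorial.fact k) * Rabs r ^ k)).
    { exists (exp (Rabs r)). apply is_pseries_R. apply is_exp_Reals. }
    pose proof (ex_series_lim_0 _ Hs) as H0.
    destruct (filterlim_bounded (fun k => / INR (Factorial.fact k) * Rabs r ^ k)) as [M HM].
    { now exists 0. }
    exists (Rabs B * M). intros k. rewrite Rabs_mult, <- RPow_abs.
    specialize (HM k). change (Rabs (/ INR (Factorial.fact k) * Rabs r ^ k) <= M) in HM.
    assert (Hf : 0 < / INR (Factorial.fact k)) by apply Rinv_0_lt_compat, INR_fact_lt_0.
    assert (Hr : 0 <= Rabs r ^ k) by apply pow_le, Rabs_pos.
    rewrite Rabs_pos_eq in HM by (apply Rmult_le_pos; lra).
    apply Rle_trans with (Rabs B * / INR (Factorial.fact k) * Rabs r ^ k).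
    - apply Rmult_le_compat_r; [exact Hr|]. apply Rle_trans with (1 := H k).
      apply Rmult_le_compat_r; [lra | apply Rle_abs].
    - rewrite Rmult_assoc. apply Rmult_le_compat_l; [apply Rabs_pos | exact HM]. }
  destruct (CV_radius u) as [r| |] eqn:E.
  - specialize (HR (r + 1)). simpl in HR. lra.
  - reflexivity.
  - exact (False_ind _ (HR 0)).
Qed.

Lemma bessel_coef_radius (mu : C) : - 1 < Re mu ->
  CV_radius (fun k => Re (bessel_coef mu k)) = p_infty /\
  CV_radius (fun k => Im (bessel_coef mu k)) = p_infty.
Proof.
  intros H. destruct (bessel_coef_bound mu H) as [B HB].
  split; apply CV_radius_factorial with B; intros k;
    eapply Rle_trans; try apply HB; [apply Re_le_Cmod | apply Im_le_Cmod].
Qed.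

Lemma bessel_entire_cv (mu : C) (y : R) : - 1 < Re mu ->
  Clim eventually (sum_n (fun k => Cmult (bessel_coef mu k) (RtoC (y ^ k))))
    (bessel_entire mu y).
Proof.
  intros H. destruct (bessel_coef_radius mu H) as [R1 R2].
  assert (E : forall n,
    sum_n (fun k => Cmult (bessel_coef mu k) (RtoC (y ^ k))) n =
    (sum_n (fun k => Re (bessel_coef mu k) * y ^ k) n,
     sum_n (fun k => Im (bessel_coef mu k) * y ^ k) n)).
  { induction n as [|n IH].
    - rewrite !sum_O. generalize (bessel_coef mu 0). intros [u v].
      unfold Cmult, RtoC; simpl. f_equal; ring.
    - rewrite !sum_Sn, IH. generalize (bessel_coef mu (S n)). intros [u v].
      unfold plus; simpl. unfold Cplus, Cmult, RtoC; simpl. f_equal; ring. }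
  apply Clim_ext with (fun n =>
    (sum_n (fun k => Re (bessel_coef mu k) * y ^ k) n,
     sum_n (fun k => Im (bessel_coef mu k) * y ^ k) n)).
  { apply filter_forall. intros n. symmetry. apply E. }
  split; apply (proj1 (is_pseries_R _ _ _)), PSeries_correct, CV_radius_inside.
  - change (Rbar_lt (Rabs y) (CV_radius (fun k => Re (bessel_coef mu k)))). now rewrite R1.
  - change (Rbar_lt (Rabs y) (CV_radius (fun k => Im (bessel_coef mu k)))). now rewrite R2.
Qed.

(** This is why termwise differentiation raises the order by one. Only the factorial and the sign
    change; the Gamma factors of both sides coincide. *)
Lemma bessel_coef_derive (mu : C) (k : nat) :
  Cmult (RtoC (INR (S k))) (bessel_coef mu (S k)) = Copp (bessel_coef (Cplus mu (RtoC 1)) k).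
Proof.
  unfold bessel_coef.
  replace (Cplus (Cplus mu (RtoC 1)) (RtoC (INR k + 1))) with (Cplus mu (RtoC (INR (S k) + 1)))
    by (rewrite S_INR, !RtoC_plus; ring).
  change (Factorial.fact (S k)) with (S k * Factorial.fact k)%nat.
  rewrite mult_INR. change ((-1) ^ S k) with (-1 * (-1) ^ k).
  rewrite !RtoC_mult.
  assert (RtoC (INR (S k)) <> RtoC 0) by (apply RtoC_neq_0, not_0_INR; lia).
  assert (RtoC (INR (Factorial.fact k)) <> RtoC 0) by apply RtoC_neq_0, INR_fact_neq_0.
  replace (RtoC (-1)) with (Copp (RtoC 1)) by (rewrite <- RtoC_opp; reflexivity).
  field. split; assumption.
Qed.

Lemma bessel_coef_shift (mu : C) (k : nat) :
  bessel_coef mu k =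
  Cmult (Cplus (Cplus mu (RtoC 1)) (RtoC (INR k))) (bessel_coef (Cplus mu (RtoC 1)) k).
Proof.
  unfold bessel_coef. rewrite (rgamma_shift (Cplus mu (RtoC (INR k + 1)))).
  replace (Cplus (Cplus mu (RtoC (INR k + 1))) (RtoC 1))
    with (Cplus (Cplus mu (RtoC 1)) (RtoC (INR k + 1))) by (rewrite !RtoC_plus; ring).
  rewrite RtoC_plus. ring.
Qed.

Lemma Cderiv_bessel_entire (mu : C) (y : R) : - 1 < Re mu ->
  Cderiv (bessel_entire mu) y (Copp (bessel_entire (Cplus mu (RtoC 1)) y)).
Proof.
  intros H. destruct (bessel_coef_radius mu H) as [R1 R2].
  split; (eapply is_derive_eq; [apply is_derive_PSeries|]).
  - change (Rbar_lt (Rabs y) (CV_radius (fun k => Re (bessel_coef mu k)))). now rewrite R1.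
  - simpl. rewrite <- PSeries_opp. apply PSeries_ext. intros k.
    change (INR (S k) * Re (bessel_coef mu (S k)) =
            Re (Copp (bessel_coef (Cplus mu (RtoC 1)) k))).
    rewrite <- bessel_coef_derive. generalize (bessel_coef mu (S k)) (INR (S k)).
    intros [u v] n. simpl. ring.
  - change (Rbar_lt (Rabs y) (CV_radius (fun k => Im (bessel_coef mu k)))). now rewrite R2.
  - simpl. rewrite <- PSeries_opp. apply PSeries_ext. intros k.
    change (INR (S k) * Im (bessel_coef mu (S k)) =
            Im (Copp (bessel_coef (Cplus mu (RtoC 1)) k))).
    rewrite <- bessel_coef_derive. generalize (bessel_coef mu (S k)) (INR (S k)).
    intros [u v] n. simpl. ring.
Qed.

(** Write c_k(mu) for the coefficients. The functional equation splits c_k(mu) into (mu+1) c_k(mu+1)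
    + k c_k(mu+1), and k c_k(mu+1) = -c_(k-1)(mu+2). *)
Lemma bessel_entire_rec (mu : C) (y : R) : - 1 < Re mu ->
  bessel_entire mu y =
  Cminus (Cmult (Cplus mu (RtoC 1)) (bessel_entire (Cplus mu (RtoC 1)) y))
         (Cmult (RtoC y) (bessel_entire (Cplus (Cplus mu (RtoC 1)) (RtoC 1)) y)).
Proof.
  intros H.
  assert (H1 : - 1 < Re (Cplus mu (RtoC 1))) by (change (-1 < Re mu + 1); lra).
  assert (H2 : - 1 < Re (Cplus (Cplus mu (RtoC 1)) (RtoC 1))) by (change (-1 < Re mu + 1 + 1); lra).
  assert (HS : filterlim S eventually eventually).
  { intros P [N HN]. exists N. intros n Hn. apply HN. lia. }
  assert (Hshift : forall (u : nat -> C) l, Clim eventually u l ->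
            Clim eventually (fun n => u (S n)) l).
  { intros u l [A B]. split.
    - apply (filterlim_comp _ _ _ S (fun n => Re (u n)) _ _ _ HS A).
    - apply (filterlim_comp _ _ _ S (fun n => Im (u n)) _ _ _ HS B). }
  pose (s := fun mu => sum_n (fun k => Cmult (bessel_coef mu k) (RtoC (y ^ k)))).
  apply (Clim_unique (F := eventually) (fun n => s mu (S n))).
  { apply Hshift. now apply bessel_entire_cv. }
  (* Multiplication by [y] raises the degree, so the sum of order mu + 2 stops one index earlier and
     the partial sums agree exactly. *)
  apply Clim_ext with (fun n =>
     Cminus (Cmult (Cplus mu (RtoC 1)) (s (Cplus mu (RtoC 1)) (S n)))
            (Cmult (RtoC y) (s (Cplus (Cplus mu (RtoC 1)) (RtoC 1)) n))).
  - apply filter_forall. intros n. unfold s. clear s.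
    assert (K : forall k, Cmult (bessel_coef mu (S k)) (RtoC (y ^ S k)) =
       Cminus (Cmult (Cplus mu (RtoC 1)) (Cmult (bessel_coef (Cplus mu (RtoC 1)) (S k)) (RtoC (y ^ S k))))
              (Cmult (RtoC y) (Cmult (bessel_coef (Cplus (Cplus mu (RtoC 1)) (RtoC 1)) k) (RtoC (y ^ k))))).
    { intros k. rewrite bessel_coef_shift, Cmult_plus_distr_r, bessel_coef_derive.
      change (y ^ S k) with (y * y ^ k). rewrite RtoC_mult. ring. }
    assert (SS : forall (u : nat -> C) n, sum_n u (S n) = Cplus (sum_n u n) (u (S n)))
      by (intros u k; exact (sum_Sn u k)).
    induction n as [|n IH].
    + rewrite !SS, !sum_O, K. rewrite (bessel_coef_shift mu 0).
      change (INR 0) with 0. change (y ^ 0) with 1. ring.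
    + rewrite (SS (fun k => Cmult (bessel_coef mu k) (RtoC (y ^ k))) (S n)), K, <- IH.
      rewrite !SS. ring.
  - apply Clim_minus; apply Clim_mult; try apply Clim_const.
    + apply Hshift. now apply bessel_entire_cv.
    + now apply bessel_entire_cv.
Qed.

Lemma BesselJ_entire (mu : C) (t : R) : - 1 < Re mu ->
  BesselJ mu (RtoC t) = Cmult (cpow (RtoC (t / 2)) mu) (bessel_entire mu ((t / 2) ^ 2)).
Proof.
  intros H. unfold BesselJ, CSeries. rewrite <- RtoC_div by lra.
  apply (limC_Clim (F := eventually)).
  apply Clim_ext with (fun n => Cmult (cpow (RtoC (t / 2)) mu)
    (sum_n (fun k => Cmult (bessel_coef mu k) (RtoC (((t / 2) ^ 2) ^ k))) n)).
  - apply filter_forall. intros n. symmetry.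
    assert (K : forall k, Cmult (Cmult (Cdiv (RtoC ((-1) ^ k)) (RtoC (INR (Factorial.fact k))))
         (rgamma (Cplus mu (RtoC (INR k + 1)))))
         (Cmult (cpow (RtoC (t / 2)) mu) (Cpow (RtoC (t / 2)) (2 * k))) =
         Cmult (cpow (RtoC (t / 2)) mu) (Cmult (bessel_coef mu k) (RtoC (((t / 2) ^ 2) ^ k)))).
    { intros k. fold (bessel_coef mu k). rewrite <- RtoC_pow, pow_mult. ring. }
    induction n as [|n IH]; [rewrite !sum_O; apply K|].
    rewrite !sum_Sn, IH, K. unfold plus; simpl. ring.
  - apply Clim_mult; [apply Clim_const | now apply bessel_entire_cv].
Qed.

Lemma Cderiv_BesselJ (mu : C) (t : R) : - 1 < Re mu -> t <> 0 ->
  Cderiv (fun t => BesselJ mu (RtoC t)) t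
    (Cminus (Cmult (Cmult mu (RtoC (/ t))) (BesselJ mu (RtoC t)))
            (BesselJ (Cplus mu (RtoC 1)) (RtoC t))).
Proof.
  intros H Ht.
  assert (H1 : - 1 < Re (Cplus mu (RtoC 1))) by (change (-1 < Re mu + 1); lra).
  assert (Ht2 : t / 2 <> 0) by lra.
  apply Cderiv_ext_loc with
    (fun t => Cmult (cpow (RtoC (t / 2)) mu) (bessel_entire mu ((t / 2) ^ 2))).
  { apply filter_forall. intros u. symmetry. now apply BesselJ_entire. }
  rewrite !BesselJ_entire, cpow_plus, cpow_1 by assumption.
  eapply Cderiv_eq.
  - apply Cderiv_mult.
    + apply (Cderiv_comp (fun t => cpow (RtoC t) mu) (fun t => t / 2) t (/ 2)).
      * apply Cderiv_cpow, Ht2.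
      * auto_derive; [easy | field].
    (* The inner derivative t/2 is the factor that turns (t/2)^mu into (t/2)^(mu+1). *)
    + apply (Cderiv_comp (bessel_entire mu) (fun t => (t / 2) ^ 2) t (t / 2)).
      * apply Cderiv_bessel_entire, H.
      * auto_derive; [easy | field].
  - replace (/ t) with (/ 2 * / (t / 2)) by (field; assumption).
    rewrite RtoC_mult. ring.
Qed.

(** [bessel_entire_rec] multiplied by a power of t/2. It serves to eliminate the order mu + 2 from
    the derivative of J_(mu+1). *)
Lemma BesselJ_rec (mu : C) (t : R) : - 1 < Re mu -> t <> 0 ->
  Cplus (BesselJ mu (RtoC t)) (BesselJ (Cplus (Cplus mu (RtoC 1)) (RtoC 1)) (RtoC t)) =
  Cmult (Cmult (RtoC 2) (Cmult (Cplus mu (RtoC 1)) (RtoC (/ t))))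
        (BesselJ (Cplus mu (RtoC 1)) (RtoC t)).
Proof.
  intros H Ht.
  assert (H1 : - 1 < Re (Cplus mu (RtoC 1))) by (change (-1 < Re mu + 1); lra).
  assert (H2 : - 1 < Re (Cplus (Cplus mu (RtoC 1)) (RtoC 1))) by (change (-1 < Re mu + 1 + 1); lra).
  assert (Ht2 : t / 2 <> 0) by lra.
  rewrite !BesselJ_entire, !cpow_plus, cpow_1, (bessel_entire_rec mu) by assumption.
  replace (/ t) with (/ 2 * / (t / 2)) by (field; assumption).
  rewrite RtoC_mult, !RtoC_inv, RtoC_pow by lra.
  assert (RtoC (t / 2) <> RtoC 0) by now apply RtoC_neq_0.
  field. assumption.
Qed.

(* Equivalent to [(z^(mu+1) J_(mu+1))' = z^(mu+1) J_mu]. *)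
Lemma Cderiv_BesselJ_succ (mu : C) (t : R) : - 1 < Re mu -> t <> 0 ->
  Cderiv (fun t => BesselJ (Cplus mu (RtoC 1)) (RtoC t)) t
    (Cminus (BesselJ mu (RtoC t))
            (Cmult (Cmult (Cplus mu (RtoC 1)) (RtoC (/ t))) (BesselJ (Cplus mu (RtoC 1)) (RtoC t)))).
Proof.
  intros H Ht. eapply Cderiv_eq.
  - apply Cderiv_BesselJ; [change (-1 < Re mu + 1); lra | exact Ht].
  - replace (BesselJ (Cplus (Cplus mu (RtoC 1)) (RtoC 1)) (RtoC t))
      with (Cminus (Cplus (BesselJ mu (RtoC t)) (BesselJ (Cplus (Cplus mu (RtoC 1)) (RtoC 1)) (RtoC t)))
                   (BesselJ mu (RtoC t))) by ring.
    rewrite BesselJ_rec by assumption. ring.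
Qed.

(** * Boundedness of Bessel functions *)

Lemma derive_nonpos_le (f df : R -> R) (a b : R) : a <= b ->
  (forall x, a <= x <= b -> is_derive f x (df x)) ->
  (forall x, a <= x <= b -> df x <= 0) -> f b <= f a.
Proof.
  intros Hab Hd Hs.
  destruct (MVT_gen f a b df) as [c [Hc E]].
  - rewrite Rmin_left, Rmax_right by lra. intros x Hx. apply Hd. lra.
  - rewrite Rmin_left, Rmax_right by lra. intros x Hx.
    apply derivable_continuous_pt. exists (df x). apply is_derive_Reals, Hd, Hx.
  - rewrite Rmin_left, Rmax_right in Hc by lra. pose proof (Hs c Hc).
    assert (0 <= - df c * (b - a)) by (apply Rmult_le_pos; lra). lra.
Qed.

Lemma continuous_Cmod_bounded (f : R -> C) (a b : R) :
  (forall x, a <= x <= b -> Clim (locally x) f (f x)) ->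
  exists M, forall x, a <= x <= b -> Cmod (f x) <= M.
Proof.
  intros H.
  destruct (bounded_continuity (V := R_NormedModule) (fun x => Re (f x)) a b) as [M1 H1].
  { intros x Hx. apply (H x Hx). }
  destruct (bounded_continuity (V := R_NormedModule) (fun x => Im (f x)) a b) as [M2 H2].
  { intros x Hx. apply (H x Hx). }
  exists (M1 + M2). intros x Hx. eapply Rle_trans; [apply Cmod_le_abs|].
  specialize (H1 x Hx). specialize (H2 x Hx).
  change (Rabs (Re (f x)) < M1) in H1. change (Rabs (Im (f x)) < M2) in H2. lra.
Qed.

Lemma BesselJ_opp (mu : C) (t : R) : - 1 < Re mu -> 0 < t ->
  BesselJ mu (RtoC (- t)) = Cmult (Cexp (Cmult mu (0, PI))) (BesselJ mu (RtoC t)).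
Proof.
  intros H Ht. rewrite !BesselJ_entire by assumption.
  replace (- t / 2) with (- (t / 2)) by field.
  rewrite cpow_opp by lra. replace ((- (t / 2)) ^ 2) with ((t / 2) ^ 2) by ring. ring.
Qed.

(** This is J_mu', kept as an expression in J_mu and J_(mu+1): these two can be differentiated again
    without leaving the pair, and Bessel's equation results. *)
Definition BesselJ_deriv (mu : C) (t : R) : C :=
  Cminus (Cmult (Cmult mu (RtoC (/ t))) (BesselJ mu (RtoC t)))
         (BesselJ (Cplus mu (RtoC 1)) (RtoC t)).

Lemma bessel_equation (mu : C) (t : R) : - 1 < Re mu -> t <> 0 ->
  Cderiv (BesselJ_deriv mu) t
    (Cminus (Cmult (Cmult (Cmult mu mu) (RtoC (/ t ^ 2))) (BesselJ mu (RtoC t)))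
            (Cplus (BesselJ mu (RtoC t)) (Cmult (RtoC (/ t)) (BesselJ_deriv mu t)))).
Proof.
  intros H Ht. unfold BesselJ_deriv at 1. eapply Cderiv_eq.
  - apply Cderiv_minus.
    + apply (Cderiv_mult (fun t => Cmult mu (RtoC (/ t)))).
      * apply Cderiv_mult; [apply Cderiv_const|].
        apply (Cderiv_RtoC (fun t => / t) t (- / t ^ 2)).
        auto_derive; [exact Ht | field; exact Ht].
      * apply Cderiv_BesselJ; assumption.
    + apply Cderiv_BesselJ_succ; assumption.
  - unfold BesselJ_deriv.
    replace (/ t ^ 2) with (/ t * / t) by (field; exact Ht).
    rewrite RtoC_opp, RtoC_mult. ring.
Qed.

(** Near 0 the power (t/2)^mu is bounded because Re mu >= 0; beyond 1 the energy stays bounded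
    because 1/t^2 is integrable; the negative axis differs by the constant factor e^(i pi mu). *)
Lemma BesselJ_bounded (mu : C) : 0 <= Re mu ->
  exists K, forall t, t <> 0 -> Cmod (BesselJ mu (RtoC t)) <= K.
Proof.
  intros Hmu0. assert (Hmu : - 1 < Re mu) by lra.
  assert (Hsmall : exists K, forall t, 0 < t <= 1 -> Cmod (BesselJ mu (RtoC t)) <= K).
  { destruct (continuous_Cmod_bounded (bessel_entire mu) 0 1) as [M HM].
    { intros x _. eapply Cderiv_Clim, Cderiv_bessel_entire, Hmu. }
    exists M. intros t Ht. rewrite BesselJ_entire, Cmod_mult, Cmod_cpow_pos by lra.
    apply Rle_trans with (1 * Cmod (bessel_entire mu ((t / 2) ^ 2))).
    - apply Rmult_le_compat_r; [apply Cmod_ge_0|].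
      unfold Rpower. rewrite <- exp_0. apply exp_le_exp.
      assert (ln (t / 2) <= 0) by (rewrite <- ln_1; apply ln_le; lra). nra.
    - rewrite Rmult_1_l. apply HM. nra. }
  assert (Hlarge : exists K, forall t, 1 <= t -> Cmod (BesselJ mu (RtoC t)) <= K).
  { pose (u := fun t => BesselJ mu (RtoC t)). pose (w := BesselJ_deriv mu).
    pose (E := fun t => Re (u t) * Re (u t) + Im (u t) * Im (u t) +
                        (Re (w t) * Re (w t) + Im (w t) * Im (w t))).
    set (q := Cmult mu mu). set (Q := Rabs (Re q) + Rabs (Im q)).
    (* The energy satisfies [E' <= Q / t^2 * E], so [E exp (Q / t)] decreases. *)
    assert (HE : forall t, 1 <= t -> exists dE, is_derive E t dE /\ dE <= Q / t ^ 2 * E t).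
    { intros t Ht. assert (Ht0 : t <> 0) by lra.
      destruct (Cderiv_BesselJ mu t Hmu Ht0) as [U1 U2].
      destruct (bessel_equation mu t Hmu Ht0) as [W1 W2].
      fold (BesselJ_deriv mu t) in U1, U2. fold q (u t) (w t) in W1, W2. fold (w t) in U1, U2.
      eexists. split.
      - unfold E. apply (@is_derive_plus R_AbsRing R_NormedModule);
          apply (@is_derive_plus R_AbsRing R_NormedModule);
          apply Derive.is_derive_mult; eassumption.
      - clearbody q. unfold E. destruct (u t) as [a b]. destruct (w t) as [c d].
        unfold plus; simpl. unfold Re, Im; simpl. fold (Re q) (Im q).
        replace (/ (t * (t * 1))) with (/ t ^ 2) by reflexivity.
        replace (Q / (t * (t * 1))) with (Q * / t ^ 2) by reflexivity.
        assert (Hi : 0 < / t) by (apply Rinv_0_lt_compat; lra).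
        assert (Hi2 : 0 < / t ^ 2) by (apply Rinv_0_lt_compat; nra).
        set (i := / t) in *. set (j := / t ^ 2) in *.
        pose proof (pow2_ge_0 (a + c)). pose proof (pow2_ge_0 (b + d)).
        pose proof (pow2_ge_0 (a - c)). pose proof (pow2_ge_0 (b - d)).
        pose proof (pow2_ge_0 (d + a)). pose proof (pow2_ge_0 (c - b)).
        pose proof (pow2_ge_0 (d - a)). pose proof (pow2_ge_0 (c + b)).
        (* The order being complex, mu^2 acts through its real and its imaginary part; each cross
           term is controlled by 2|xy| <= x^2 + y^2. *)
        assert (K1 : 2 * (Re q * (c * a + d * b)) <= Rabs (Re q) * (a * a + b * b + (c * c + d * d))).
        { apply Rle_trans with (Rabs (Re q) * Rabs (2 * (c * a + d * b))).
          - rewrite <- Rabs_mult. eapply Rle_trans; [|apply Rle_abs]. lra.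
          - apply Rmult_le_compat_l; [apply Rabs_pos|]. apply Rabs_le; split; simpl in *; lra. }
        assert (K2 : 2 * (Im q * (d * a - c * b)) <= Rabs (Im q) * (a * a + b * b + (c * c + d * d))).
        { apply Rle_trans with (Rabs (Im q) * Rabs (2 * (d * a - c * b))).
          - rewrite <- Rabs_mult. eapply Rle_trans; [|apply Rle_abs]. lra.
          - apply Rmult_le_compat_l; [apply Rabs_pos|]. apply Rabs_le; split; simpl in *; lra. }
        (* The first-order term of Bessel's equation is a damping: it contributes -2|J'|^2/t to E'
           and may be dropped. *)
        assert (K3 : 0 <= i * (c * c + d * d)) by (apply Rmult_le_pos; nra).
        assert (K4 : j * (2 * (Re q * (c * a + d * b)) + 2 * (Im q * (d * a - c * b))) <=
                     j * (Q * (a * a + b * b + (c * c + d * d)))).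
        { apply Rmult_le_compat_l; [lra|]. unfold Q. lra. }
        lra. }
    assert (HQ : 0 <= Q) by (unfold Q; pose proof (Rabs_pos (Re q)); pose proof (Rabs_pos (Im q)); lra).
    assert (HE0 : forall t, Rsqr (Cmod (u t)) <= E t).
    { intros t. unfold E, Cmod, Rsqr.
      rewrite sqrt_sqrt by (apply Rplus_le_le_0_compat; apply pow2_ge_0).
      unfold Re, Im. nra. }
    (* The value at t = 1 of the nonincreasing function E(t) exp (Q/t), which dominates E(t). *)
    set (B := E 1 * exp (Q / 1)).
    exists (sqrt B). intros t Ht. fold (u t).
    apply Rsqr_incr_0; [|apply Cmod_ge_0 | apply sqrt_pos].
    assert (HEt : E t <= B).
    { apply Rle_trans with (E t * exp (Q / t)).
      - rewrite <- (Rmult_1_r (E t)) at 1. apply Rmult_le_compat_l.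
        + apply Rle_trans with (2 := HE0 t). apply Rle_0_sqr.
        + rewrite <- exp_0. apply exp_le_exp. apply Rdiv_le_0_compat; lra.
      - unfold B.
        apply (derive_nonpos_le (fun t => E t * exp (Q / t))
          (fun t => Derive E t * exp (Q / t) + E t * (exp (Q / t) * (- Q / t ^ 2))) 1 t Ht).
        + intros x Hx. destruct (HE x ltac:(lra)) as [dE [D1 D2]].
          apply (Derive.is_derive_mult E (fun t => exp (Q / t))).
          * now rewrite (is_derive_unique _ _ _ D1).
          * auto_derive; [lra | fold (Q / x); field; lra].
        + intros x Hx. destruct (HE x ltac:(lra)) as [dE [D1 D2]].
          rewrite (is_derive_unique _ _ _ D1).
          replace (dE * exp (Q / x) + E x * (exp (Q / x) * (- Q / x ^ 2)))
            with (- (exp (Q / x) * (Q / x ^ 2 * E x - dE))) by (field; lra).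
          assert (0 <= exp (Q / x) * (Q / x ^ 2 * E x - dE)); [|lra].
          apply Rmult_le_pos; [apply Rlt_le, exp_pos | lra]. }
    apply Rle_trans with (1 := HE0 t). apply Rle_trans with (1 := HEt).
    rewrite Rsqr_sqrt; [apply Rle_refl|].
    apply Rle_trans with (2 := HEt), Rle_trans with (2 := HE0 t), Rle_0_sqr. }
  destruct Hsmall as [K1 HK1], Hlarge as [K2 HK2].
  assert (Hpos : forall t, 0 < t -> Cmod (BesselJ mu (RtoC t)) <= Rmax K1 K2).
  { intros t Ht. destruct (Rle_lt_dec t 1) as [L|L].
    - eapply Rle_trans; [apply HK1; lra | apply Rmax_l].
    - eapply Rle_trans; [apply HK2; lra | apply Rmax_r]. }
  exists (Rmax (Rmax K1 K2) (Cmod (Cexp (Cmult mu (0, PI))) * Rmax K1 K2)). intros t Ht.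
  destruct (Rlt_le_dec t 0) as [L|L].
  - eapply Rle_trans; [|apply Rmax_r]. replace t with (- - t) by ring.
    rewrite BesselJ_opp, Cmod_mult by lra.
    apply Rmult_le_compat_l; [apply Cmod_ge_0 | apply Hpos; lra].
  - eapply Rle_trans; [|apply Rmax_l]. apply Hpos. lra.
Qed.

(** * Functions smooth up to the boundary *)

Lemma is_derive_sub_const (a x : R) : is_derive (fun y => y - a) x 1.
Proof. auto_derive; [easy | ring]. Qed.

Lemma is_derive_sub_pow (a x : R) (n : nat) :
  is_derive (fun y => (y - a) ^ S n) x (INR (S n) * (x - a) ^ n).
Proof.
  eapply is_derive_eq; [apply is_derive_pow, is_derive_sub_const|].
  simpl Init.Nat.pred. cbv beta. ring.
Qed.

Section SmoothUpToBoundary.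
Variables a b : R.
Hypothesis Hab : a < b.

Lemma at_right_between : at_right a (fun x => a < x < b).
Proof.
  exists (mkposreal (b - a) ltac:(lra)). intros x Hx Hlt.
  change (Rabs (x - a) < b - a) in Hx. apply Rabs_def2 in Hx. lra.
Qed.

Lemma at_left_between : at_left b (fun x => a < x < b).
Proof.
  exists (mkposreal (b - a) ltac:(lra)). intros x Hx Hlt.
  change (Rabs (x - b) < b - a) in Hx. apply Rabs_def2 in Hx. lra.
Qed.

Lemma locally_between (x : R) : a < x < b -> locally x (fun y => a < y < b).
Proof.
  intros Hx. apply filter_and.
  - apply open_gt, Hx.
  - apply open_lt, Hx.
Qed.

Lemma flim_at_right_id : filterlim (fun x => x - a) (at_right a) (locally 0).
Proof.
  replace 0 with (a - a) by ring. apply flim_minus; [|apply flim_const].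
  intros P HP. unfold filtermap. now apply filter_le_within.
Qed.

Lemma flim_at_left_id : filterlim (fun x => x - a) (at_left b) (locally (b - a)).
Proof.
  apply flim_minus; [|apply flim_const].
  intros P HP. unfold filtermap. now apply filter_le_within.
Qed.

Lemma flim_pow {T} {F : (T -> Prop) -> Prop} {FF : Filter F} (f : T -> R) (l : R) (n : nat) :
  filterlim f F (locally l) -> filterlim (fun x => f x ^ n) F (locally (l ^ n)).
Proof.
  intros H. induction n as [|n IH]; [apply flim_const | apply flim_mult; assumption].
Qed.

(** Only the open interval and one-sided limits are consulted, never values at the endpoints. The
    derivative is an existential witness, so that closure proofs can supply a formula for it. *)
Fixpoint Cn_up (n : nat) (phi : R -> R) : Prop :=
  (exists l, filterlim phi (at_right a) (locally l)) /\
  (exists l, filterlim phi (at_left b) (locally l)) /\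
  match n with
  | O => forall x, a < x < b -> continuous phi x
  | S n' => exists psi, (forall x, a < x < b -> is_derive phi x (psi x)) /\ Cn_up n' psi
  end.

Definition smooth_up (phi : R -> R) : Prop := forall n, Cn_up n phi.

Lemma Cn_up_limits (n : nat) (phi : R -> R) : Cn_up n phi ->
  (exists l, filterlim phi (at_right a) (locally l)) /\
  (exists l, filterlim phi (at_left b) (locally l)).
Proof. destruct n; simpl; tauto. Qed.

Lemma Cn_up_continuous (n : nat) (phi : R -> R) :
  Cn_up n phi -> forall x, a < x < b -> continuous phi x.
Proof.
  destruct n as [|n]; simpl.
  - tauto.
  - intros [_ [_ [psi [H _]]]] x Hx.
    apply (@ex_derive_continuous R_AbsRing R_NormedModule phi x). exists (psi x). now apply H.
Qed.

Lemma Cn_up_pred (n : nat) : forall phi, Cn_up (S n) phi -> Cn_up n phi.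
Proof.
  induction n as [|n IH]; intros phi H.
  - pose proof (Cn_up_continuous _ _ H). destruct H as [Ha [Hb _]]. simpl. tauto.
  - destruct H as [Ha [Hb [psi [Hd Hs]]]].
    split; [exact Ha|]. split; [exact Hb|]. exists psi. split; [exact Hd | now apply IH].
Qed.

Lemma Cn_up_ext (n : nat) (phi psi : R -> R) :
  (forall x, a < x < b -> phi x = psi x) -> Cn_up n phi -> Cn_up n psi.
Proof.
  intros E H. destruct (Cn_up_limits _ _ H) as [[la Ha] [lb Hb]].
  assert (Ea : exists l, filterlim psi (at_right a) (locally l)).
  { exists la. revert Ha. apply flim_ext.
    generalize at_right_between. apply filter_imp. exact E. }
  assert (Eb : exists l, filterlim psi (at_left b) (locally l)).
  { exists lb. revert Hb. apply flim_ext.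
    generalize at_left_between. apply filter_imp. exact E. }
  destruct n as [|n].
  - split; [exact Ea|]. split; [exact Eb|]. intros x Hx.
    apply continuous_ext_loc with phi; [|now apply (Cn_up_continuous _ _ H)].
    generalize (locally_between x Hx). apply filter_imp. exact E.
  - split; [exact Ea|]. split; [exact Eb|]. destruct H as [_ [_ [chi [Hd Hs]]]].
    exists chi. split; [|exact Hs]. intros x Hx.
    apply is_derive_ext_loc with phi; [|now apply Hd].
    generalize (locally_between x Hx). apply filter_imp. exact E.
Qed.

Lemma Cn_up_derive (n : nat) (phi psi : R -> R) :
  Cn_up (S n) phi -> (forall x, a < x < b -> is_derive phi x (psi x)) -> Cn_up n psi.
Proof.
  intros [_ [_ [chi [Hd Hs]]]] H. apply Cn_up_ext with chi; [|exact Hs].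
  intros x Hx. rewrite <- (is_derive_unique _ _ _ (Hd x Hx)).
  now apply is_derive_unique, H.
Qed.

Lemma Cn_up_const (n : nat) (c : R) : Cn_up n (fun _ => c).
Proof.
  revert c. induction n as [|n IH]; intros c.
  - repeat split; try (exists c; apply flim_const). intros x _. apply continuous_const.
  - repeat split; try (exists c; apply flim_const). exists (fun _ => 0).
    split; [|apply IH]. intros x _. exact (@is_derive_const R_AbsRing R_NormedModule c x).
Qed.

Lemma Cn_up_id (n : nat) : Cn_up n (fun x => x - a).
Proof.
  assert (Hl : (exists l, filterlim (fun x => x - a) (at_right a) (locally l)) /\
               (exists l, filterlim (fun x => x - a) (at_left b) (locally l))).
  { split; [exists 0; apply flim_at_right_id | exists (b - a); apply flim_at_left_id]. }
  pose proof (is_derive_sub_const a) as Hd.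
  destruct Hl as [Ha Hb]. destruct n as [|n]; (split; [exact Ha|]; split; [exact Hb|]).
  - intros x _. apply (@ex_derive_continuous R_AbsRing R_NormedModule (fun x => x - a) x).
    exists 1. apply Hd.
  - exists (fun _ => 1). split; [intros x _; apply Hd | apply Cn_up_const].
Qed.

Lemma Cn_up_plus (n : nat) : forall phi psi,
  Cn_up n phi -> Cn_up n psi -> Cn_up n (fun x => phi x + psi x).
Proof.
  induction n as [|n IH]; intros phi psi H1 H2;
    destruct H1 as [[la1 A1] [[lb1 B1] C1]], H2 as [[la2 A2] [[lb2 B2] C2]];
    (split; [eexists; apply flim_plus; eassumption|]);
    (split; [eexists; apply flim_plus; eassumption|]).
  - intros x Hx. apply (flim_plus phi psi); [now apply C1 | now apply C2].
  - destruct C1 as [d1 [D1 S1]], C2 as [d2 [D2 S2]].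
    exists (fun x => d1 x + d2 x). split; [|now apply IH].
    intros x Hx. apply (@is_derive_plus R_AbsRing R_NormedModule); [now apply D1 | now apply D2].
Qed.

Lemma Cn_up_mult (n : nat) : forall phi psi,
  Cn_up n phi -> Cn_up n psi -> Cn_up n (fun x => phi x * psi x).
Proof.
  induction n as [|n IH]; intros phi psi H1 H2;
    destruct (Cn_up_limits _ _ H1) as [[la1 A1] [lb1 B1]],
             (Cn_up_limits _ _ H2) as [[la2 A2] [lb2 B2]];
    (split; [eexists; apply flim_mult; eassumption|]);
    (split; [eexists; apply flim_mult; eassumption|]).
  - intros x Hx.
    apply (flim_mult phi psi);
      [now apply (Cn_up_continuous _ _ H1) | now apply (Cn_up_continuous _ _ H2)].
  - pose proof (Cn_up_pred _ _ H1) as P1. pose proof (Cn_up_pred _ _ H2) as P2.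
    destruct H1 as [_ [_ [d1 [D1 S1]]]], H2 as [_ [_ [d2 [D2 S2]]]].
    exists (fun x => d1 x * psi x + phi x * d2 x).
    split; [|apply Cn_up_plus; apply IH; assumption].
    intros x Hx. apply Derive.is_derive_mult; [now apply D1 | now apply D2].
Qed.

Lemma Cn_up_inv (n : nat) (phi : R -> R) (la lb : R) :
  Cn_up n phi ->
  filterlim phi (at_right a) (locally la) -> la <> 0 ->
  filterlim phi (at_left b) (locally lb) -> lb <> 0 ->
  (forall x, a < x < b -> phi x <> 0) -> Cn_up n (fun x => / phi x).
Proof.
  intros H Ha Hla Hb Hlb H0. revert H.
  induction n as [|n IH]; intros H;
    (split; [exists (/ la); now apply flim_inv|]);
    (split; [exists (/ lb); now apply flim_inv|]).
  - intros x Hx. apply (flim_inv phi); [now apply H0 | now apply (Cn_up_continuous _ _ H)].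
  - pose proof (IH (Cn_up_pred _ _ H)) as P.
    destruct H as [_ [_ [d [D S]]]].
    exists (fun x => (-1 * d x) * (/ phi x * / phi x)). split.
    + intros x Hx. eapply is_derive_eq; [apply is_derive_inv; [now apply D | now apply H0]|].
      field. now apply H0.
    + apply Cn_up_mult; apply Cn_up_mult; auto using Cn_up_const.
Qed.

Lemma smooth_up_ext (phi psi : R -> R) :
  (forall x, a < x < b -> phi x = psi x) -> smooth_up phi -> smooth_up psi.
Proof. intros E H n. now apply Cn_up_ext with phi. Qed.

Lemma smooth_up_const (c : R) : smooth_up (fun _ => c).
Proof. intros n. apply Cn_up_const. Qed.

Lemma smooth_up_id : smooth_up (fun x => x - a).
Proof. intros n. apply Cn_up_id. Qed.

Lemma smooth_up_plus (phi psi : R -> R) :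
  smooth_up phi -> smooth_up psi -> smooth_up (fun x => phi x + psi x).
Proof. intros H1 H2 n. now apply Cn_up_plus. Qed.

Lemma smooth_up_mult (phi psi : R -> R) :
  smooth_up phi -> smooth_up psi -> smooth_up (fun x => phi x * psi x).
Proof. intros H1 H2 n. now apply Cn_up_mult. Qed.

Lemma smooth_up_minus (phi psi : R -> R) :
  smooth_up phi -> smooth_up psi -> smooth_up (fun x => phi x - psi x).
Proof.
  intros H1 H2. apply smooth_up_ext with (fun x => phi x + -1 * psi x); [intros; ring|].
  auto using smooth_up_plus, smooth_up_mult, smooth_up_const.
Qed.

Lemma smooth_up_is_derive (phi : R -> R) :
  smooth_up phi -> forall x, a < x < b -> is_derive phi x (Derive phi x).
Proof.
  intros H x Hx. destruct (H 1%nat) as [_ [_ [psi [D _]]]].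
  apply Derive_correct. exists (psi x). now apply D.
Qed.

Lemma smooth_up_Derive (phi : R -> R) : smooth_up phi -> smooth_up (Derive phi).
Proof.
  intros H n. apply Cn_up_derive with phi; [apply H|]. now apply smooth_up_is_derive.
Qed.

Lemma smooth_up_Derive_n (phi : R -> R) (n : nat) : smooth_up phi -> smooth_up (Derive_n phi n).
Proof. intros H. induction n as [|n IH]; [exact H | now apply smooth_up_Derive]. Qed.

Lemma derA_spec (phi : R -> R) (n : nat) : smooth_up phi ->
  filterlim (Derive_n phi n) (at_right a) (locally (derA phi n a)).
Proof.
  intros H. destruct (smooth_up_Derive_n phi n H O) as [[l Hl] _].
  now replace (derA phi n a) with l by (symmetry; exact (lim_filterlim _ _ Hl)).
Qed.

Lemma derB_spec (phi : R -> R) (n : nat) : smooth_up phi ->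
  filterlim (Derive_n phi n) (at_left b) (locally (derB phi n b)).
Proof.
  intros H. destruct (smooth_up_Derive_n phi n H O) as [_ [[l Hl] _]].
  now replace (derB phi n b) with l by (symmetry; exact (lim_filterlim _ _ Hl)).
Qed.

Lemma smooth_up_Cinf (phi : R -> R) : Cinf_ab a b phi -> smooth_up phi.
Proof.
  intros [H1 [H2 [H3 _]]] n.
  assert (K : forall k, Cn_up n (Derive_n phi k)); [|exact (K O)].
  induction n as [|n IH]; intros k; (split; [apply H2|]; split; [apply H3|]).
  - intros x Hx. apply (@ex_derive_continuous R_AbsRing R_NormedModule (Derive_n phi k) x).
    exact (H1 (S k) x Hx).
  - exists (Derive_n phi (S k)). split; [|apply IH]. intros x Hx.
    apply Derive_correct. exact (H1 (S k) x Hx).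
Qed.

Lemma smooth_up_bounded (phi : R -> R) : smooth_up phi ->
  exists M, forall x, a < x < b -> Rabs (phi x) <= M.
Proof.
  intros H. destruct (H O) as [[la A] [[lb B] C]].
  destruct (C0_extension_lt (T := R_UniformSpace) phi la lb a b Hab C A B) as [h [Hh [Eh _]]].
  destruct (bounded_continuity (V := R_NormedModule) h a b) as [M HM].
  { intros x _. apply Hh. }
  exists M. intros x Hx. rewrite <- Eh by exact Hx. apply Rlt_le.
  apply (HM x). lra.
Qed.

(** * Division by powers of x - a, and Taylor remainders smooth up to a *)

Lemma antiderivative_power_le (n : nat) (w psi : R -> R) (M d : R) : d <= b ->
  (forall x, a < x < d -> is_derive w x ((x - a) ^ n * psi x)) ->
  filterlim w (at_right a) (locally 0) ->
  (forall x, a < x < d -> psi x <= M) ->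
  forall x, a < x < d -> w x <= M * ((x - a) ^ S n / INR (S n)).
Proof.
  intros Hdb Hd Hw HM x Hx.
  assert (HN : INR (S n) <> 0) by (apply not_0_INR; lia).
  set (c := fun y => M * ((y - a) ^ S n / INR (S n))).
  assert (Hc : forall y, is_derive c y (M * (y - a) ^ n)).
  { intros y. apply is_derive_ext with (fun y => M / INR (S n) * (y - a) ^ S n).
    - intros t. change (M / INR (S n) * (t - a) ^ S n = M * ((t - a) ^ S n / INR (S n))). field. exact HN.
    - eapply is_derive_eq.
      + apply is_derive_scal, is_derive_sub_pow.
      + field. exact HN. }
  assert (Hc0 : filterlim c (at_right a) (locally 0)).
  { replace 0 with (M * (0 ^ S n / INR (S n))) by (simpl pow; field; exact HN).
    apply flim_mult; [apply flim_const|]. apply flim_mult; [|apply flim_const].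
    apply flim_pow, flim_at_right_id. }
  (* [w - c] is nonincreasing and tends to 0 at [a]. As no value at [a] is available, the comparison
     is made with a point y that then tends to [a]. *)
  assert (K : (w x - c x) - (0 - 0) <= 0).
  { apply (flim_le (F := at_right a) (fun y => (w x - c x) - (w y - c y))).
    - apply flim_minus; [apply flim_const|]. apply flim_minus; assumption.
    - exists (mkposreal (x - a) ltac:(lra)). intros y Hy Hlt.
      change (Rabs (y - a) < x - a) in Hy. apply Rabs_def2 in Hy.
      assert (w x - c x <= w y - c y); [|lra].
      apply (derive_nonpos_le (fun t => w t - c t)
               (fun t => (t - a) ^ n * psi t - M * (t - a) ^ n)); [lra| |].
      + intros t Ht. apply (@is_derive_minus R_AbsRing R_NormedModule); [apply Hd; lra | apply Hc].
      + intros t Ht. assert (0 <= (t - a) ^ n * (M - psi t)); [|lra].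
        apply Rmult_le_pos; [apply pow_le; lra | pose proof (HM t); lra]. }
  fold (c x). lra.
Qed.

(** A one-sided l'Hopital rule. Near [a], [psi] lies within e of [L]; the comparison lemma is
    applied to [w] for the upper bound and to its negative for the lower one. *)
Lemma antiderivative_power_lim (n : nat) (w psi : R -> R) (L : R) :
  (forall x, a < x < b -> is_derive w x ((x - a) ^ n * psi x)) ->
  filterlim w (at_right a) (locally 0) ->
  filterlim psi (at_right a) (locally L) ->
  filterlim (fun x => w x / (x - a) ^ S n) (at_right a) (locally (L / INR (S n))).
Proof.
  intros Hd Hw Hpsi.
  assert (HN : 1 <= INR (S n)) by (rewrite S_INR; pose proof (pos_INR n); lra).
  apply filterlim_locally. intros eps.
  set (e := eps / 2).
  assert (He : 0 < e) by (unfold e; pose proof (cond_pos eps); lra).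
  pose proof (proj1 (filterlim_locally psi L) Hpsi (mkposreal e He)) as Hn.
  destruct Hn as [[d Hd0] Hn]. simpl in Hn.
  set (d' := Rmin (a + d) b).
  assert (Hd' : d' <= b) by apply Rmin_r.
  assert (Hd'' : d' <= a + d) by apply Rmin_l.
  assert (Had : a < d') by (apply Rmin_glb_lt; lra).
  assert (HM : forall x, a < x < d' -> Rabs (psi x - L) < e).
  { intros x Hx. apply Hn; [|lra]. change (Rabs (x - a) < d). apply Rabs_def1; lra. }
  assert (U : forall x, a < x < d' -> w x <= (L + e) * ((x - a) ^ S n / INR (S n))).
  { apply antiderivative_power_le with psi; [exact Hd'| |exact Hw|].
    - intros x Hx. apply Hd. lra.
    - intros x Hx. pose proof (HM x Hx) as Hx'. apply Rabs_def2 in Hx'. lra. }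
  assert (V : forall x, a < x < d' -> - w x <= (- L + e) * ((x - a) ^ S n / INR (S n))).
  { apply (antiderivative_power_le n (fun x => - w x) (fun x => - psi x)); [exact Hd'| | |].
    - intros x Hx. eapply is_derive_eq.
      + apply (@is_derive_opp R_AbsRing R_NormedModule). apply Hd. lra.
      + unfold opp; simpl. ring.
    - replace 0 with (- 0) by ring. now apply flim_opp.
    - intros x Hx. pose proof (HM x Hx) as Hx'. apply Rabs_def2 in Hx'. lra. }
  exists (mkposreal (d' - a) ltac:(lra)). intros x Hx Hlt.
  change (Rabs (x - a) < d' - a) in Hx. apply Rabs_def2 in Hx.
  assert (Hx' : a < x < d') by lra. specialize (U x Hx'). specialize (V x Hx').
  change (Rabs (w x / (x - a) ^ S n - L / INR (S n)) < eps).
  assert (Hp : 0 < (x - a) ^ S n) by (apply pow_lt; lra).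
  set (p := (x - a) ^ S n) in *.
  assert (Hi : 0 < / INR (S n) <= 1).
  { split; [apply Rinv_0_lt_compat; lra|]. rewrite <- Rinv_1. apply Rinv_le_contravar; lra. }
  set (i := / INR (S n)) in *. unfold Rdiv in U, V |- *. fold i in U, V |- *.
  assert (Ew : w x = (w x * / p) * p) by (field; lra).
  set (v := w x * / p) in *. rewrite Ew in U, V.
  assert (v <= (L + e) * i) by (apply (Rmult_le_reg_r p); lra).
  assert (- v <= (- L + e) * i) by (apply (Rmult_le_reg_r p); lra).
  assert (e * i <= e) by (rewrite <- (Rmult_1_r e) at 2; apply Rmult_le_compat_l; lra).
  apply Rabs_def1; unfold e in *; lra.
Qed.

(* The equation says [((x - a)^(n+1) v)' = (x - a)^n psi], i.e. [v] is a weighted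
   average of [psi] over [(a, x)]; it is inherited by [v'] with [n + 1] and [psi']. *)
Lemma Cn_up_average (k : nat) : forall n psi v,
  Cn_up k psi ->
  (forall x, a < x < b -> is_derive v x ((psi x - INR (S n) * v x) / (x - a))) ->
  filterlim (fun x => (x - a) ^ S n * v x) (at_right a) (locally 0) ->
  (exists l, filterlim v (at_left b) (locally l)) ->
  Cn_up k v.
Proof.
  induction k as [|k IH]; intros n psi v Hpsi Hv H0 [lb Hb];
    destruct (Cn_up_limits _ _ Hpsi) as [[L HL] [Lb HLb]];
    (split; [exists (L / INR (S n)) |split; [now exists lb|]]).
  1, 3: apply flim_ext with (fun x => (x - a) ^ S n * v x / (x - a) ^ S n);
    [ generalize at_right_between; apply filter_imp; intros x Hx; field; apply pow_nonzero; lra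
    | apply antiderivative_power_lim with psi; [|exact H0 | exact HL];
      intros x Hx; eapply is_derive_eq;
      [ apply (Derive.is_derive_mult (fun x => (x - a) ^ S n) v);
        [apply is_derive_sub_pow | now apply Hv]
      | change ((x - a) ^ S n) with ((x - a) * (x - a) ^ n); field; lra] ].
  - intros x Hx. apply (@ex_derive_continuous R_AbsRing R_NormedModule v x).
    eexists. now apply Hv.
  - exists (fun x => (psi x - INR (S n) * v x) / (x - a)). split; [exact Hv|].
    destruct Hpsi as [_ [_ [dpsi [D HS]]]].
    apply (IH (S n) dpsi); [exact HS| | |].
    + intros x Hx. eapply is_derive_eq.
      * apply is_derive_div; [| |lra].
        -- apply (@is_derive_minus R_AbsRing R_NormedModule); [now apply D|].
           apply is_derive_scal. now apply Hv.
        -- apply is_derive_sub_const.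
      * rewrite (S_INR (S n)). generalize (INR (S n)). intros N.
        unfold minus, plus, opp; simpl. field. lra.
    (* The equation gives (x - a)^(n+2) v' = (x - a)^(n+1) psi - (n+1) (x - a)^(n+1) v, and both
       terms tend to 0. *)
    + apply flim_ext with (fun x => (x - a) ^ S n * psi x - INR (S n) * ((x - a) ^ S n * v x)).
      * generalize at_right_between. apply filter_imp. intros x Hx.
        change ((x - a) ^ S (S n)) with ((x - a) * (x - a) ^ S n). field. lra.
      * replace 0 with (0 ^ S n * L - INR (S n) * 0) by (simpl pow; ring).
        apply flim_minus; apply flim_mult; try apply flim_const; try assumption.
        apply flim_pow, flim_at_right_id.
    + exists ((Lb - INR (S n) * lb) / (b - a)). apply flim_div; [lra| |apply flim_at_left_id].
      apply flim_minus; [exact HLb|]. apply flim_mult; [apply flim_const | exact Hb].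
Qed.

(** Hadamard's lemma. From (x - a) v = phi one gets (x - a) v' = phi' - v, the averaging equation
    with n = 0 and psi = phi'; the limit 0 of phi is its boundary condition. *)
Lemma smooth_up_div_id (phi : R -> R) : smooth_up phi ->
  filterlim phi (at_right a) (locally 0) -> smooth_up (fun x => phi x / (x - a)).
Proof.
  intros H H0 k. apply Cn_up_average with O (Derive phi).
  - now apply smooth_up_Derive.
  - intros x Hx. eapply is_derive_eq.
    + apply is_derive_div; [now apply smooth_up_is_derive| |lra].
      apply is_derive_sub_const.
    + simpl. field. lra.
  - revert H0. apply flim_ext. generalize at_right_between. apply filter_imp.
    intros x Hx. simpl. field. lra.
  - destruct (H O) as [_ [[lb Hb] _]]. exists (lb / (b - a)).
    apply flim_div; [lra | exact Hb | apply flim_at_left_id].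
Qed.

(** Leibniz: the derivative of order j + 1 of (x - a) q is x - a times that of q, plus j + 1 times
    the j-th derivative of q; the first term disappears at [a]. *)
Lemma derA_factor (phi q : R -> R) (c : R) : smooth_up phi -> smooth_up q ->
  (forall x, a < x < b -> phi x = c + (x - a) * q x) ->
  forall j, derA phi (S j) a = INR (S j) * derA q j a.
Proof.
  intros Hphi Hq E.
  assert (K : forall j x, a < x < b ->
    Derive_n phi (S j) x = (x - a) * Derive_n q (S j) x + INR (S j) * Derive_n q j x).
  { induction j as [|j IH]; intros x Hx.
    - change (Derive phi x = (x - a) * Derive q x + 1 * q x).
      apply is_derive_unique.
      apply is_derive_ext_loc with (fun x => c + (x - a) * q x).
      + generalize (locally_between x Hx). apply filter_imp. intros y Hy. symmetry. now apply E.
      + eapply is_derive_eq.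
        * apply (@is_derive_plus R_AbsRing R_NormedModule);
            [apply (@is_derive_const R_AbsRing R_NormedModule)|].
          apply Derive.is_derive_mult; [apply is_derive_sub_const | now apply smooth_up_is_derive].
        * unfold plus, zero; simpl. ring.
    - change (Derive_n phi (S (S j)) x) with (Derive (Derive_n phi (S j)) x).
      apply is_derive_unique.
      apply is_derive_ext_loc with
        (fun x => (x - a) * Derive_n q (S j) x + INR (S j) * Derive_n q j x).
      + generalize (locally_between x Hx). apply filter_imp. intros y Hy. symmetry. now apply IH.
      + eapply is_derive_eq.
        * apply (@is_derive_plus R_AbsRing R_NormedModule).
          -- apply Derive.is_derive_mult; [apply is_derive_sub_const|].
             apply (smooth_up_is_derive (Derive_n q (S j))); [now apply smooth_up_Derive_n | exact Hx].
          -- apply is_derive_scal.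
             apply (smooth_up_is_derive (Derive_n q j)); [now apply smooth_up_Derive_n | exact Hx].
        * change (Derive (Derive_n q (S j)) x) with (Derive_n q (S (S j)) x).
          change (Derive (Derive_n q j) x) with (Derive_n q (S j) x).
          unfold plus; simpl plus. rewrite (S_INR (S j)). simpl. ring. }
  intros j. apply (flim_unique (F := at_right a) (Derive_n phi (S j))).
  - now apply derA_spec.
  - apply flim_ext with (fun x => (x - a) * Derive_n q (S j) x + INR (S j) * Derive_n q j x).
    + generalize at_right_between. apply filter_imp. intros x Hx. symmetry. now apply K.
    + replace (INR (S j) * derA q j a) with (0 * derA q (S j) a + INR (S j) * derA q j a) by ring.
      apply flim_plus; apply flim_mult; try apply flim_const; try now apply derA_spec.
      apply flim_at_right_id.
Qed.

Lemma sum_n_shift (u : nat -> R) (n : nat) :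
  sum_n u (S n) = u O + sum_n (fun j => u (S j)) n.
Proof.
  induction n as [|n IH].
  - rewrite sum_Sn, !sum_O. reflexivity.
  - rewrite sum_Sn, IH, sum_Sn. unfold plus; simpl. ring.
Qed.

Lemma sum_n_scal_l (c : R) (u : nat -> R) (n : nat) :
  sum_n (fun j => c * u j) n = c * sum_n u n.
Proof. exact (sum_n_mult_l (K := R_AbsRing) c u n). Qed.

(** Hadamard's lemma iterated: the Taylor coefficients of the quotient [q] are those of [phi]
    shifted by one. The gain over the usual formula is that [rho] is smooth up to [a]; its limit
    there will show that the leading factor of [g] does not vanish at [a]. *)
Lemma smooth_up_taylor (r : nat) : forall phi, smooth_up phi ->
  exists rho, smooth_up rho /\
    derA rho 0 a = derA phi (S r) a / INR (fact (S r)) /\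
    forall x, a < x < b ->
      phi x = sum_n (fun j => derA phi j a / INR (fact j) * (x - a) ^ j) r + (x - a) ^ S r * rho x.
Proof.
  assert (Hstep : forall phi, smooth_up phi -> exists q, smooth_up q /\
    (forall x, a < x < b -> phi x = derA phi 0 a + (x - a) * q x)).
  { intros phi H. exists (fun x => (phi x - derA phi 0 a) / (x - a)). split.
    - apply (smooth_up_div_id (fun x => phi x - derA phi 0 a)).
      + apply smooth_up_minus; [exact H | apply smooth_up_const].
      + replace 0 with (derA phi 0 a - derA phi 0 a) by ring.
        apply flim_minus; [now apply (derA_spec phi 0) | apply flim_const].
    - intros x Hx. field. lra. }
  induction r as [|r IH]; intros phi H; destruct (Hstep phi H) as [q [Hq E]];
    pose proof (derA_factor phi q _ H Hq E) as D.
  - exists q. split; [exact Hq|]. split.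
    + rewrite D. simpl. field.
    + intros x Hx. rewrite sum_O, E by exact Hx. simpl. field.
  - destruct (IH q Hq) as [rho [Hr [Ha Er]]]. exists rho. split; [exact Hr|].
    assert (F : forall j, derA q j a / INR (fact j) = derA phi (S j) a / INR (fact (S j))).
    { intros j. rewrite D. change (fact (S j)) with (S j * fact j)%nat. rewrite mult_INR.
      field. split; [apply INR_fact_neq_0 | apply not_0_INR; lia]. }
    split.
    + rewrite Ha. apply F.
    + intros x Hx. rewrite E, Er, sum_n_shift by exact Hx.
      rewrite (sum_n_ext (fun j => derA phi (S j) a / INR (fact (S j)) * (x - a) ^ S j)
        (fun j => (x - a) * (derA q j a / INR (fact j) * (x - a) ^ j))).
      * rewrite sum_n_scal_l. simpl. field.
      * intros j. rewrite F. simpl. ring.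
Qed.

End SmoothUpToBoundary.

(** * Improper integrals *)

Lemma Rpower_lim_0 (a p : R) : 0 < p ->
  filterlim (fun x => Rpower (x - a) p) (at_right a) (locally 0).
Proof.
  intros Hp. apply filterlim_locally. intros eps.
  exists (mkposreal (exp (ln eps / p)) (exp_pos _)). intros x Hx Hlt.
  change (Rabs (x - a) < exp (ln eps / p)) in Hx. rewrite Rabs_pos_eq in Hx by lra.
  change (Rabs (Rpower (x - a) p - 0) < eps). rewrite Rminus_0_r.
  unfold Rpower. rewrite Rabs_pos_eq by (apply Rlt_le, exp_pos).
  apply Rlt_le_trans with (exp (ln eps)); [|rewrite exp_ln; [apply Rle_refl | apply cond_pos]].
  apply exp_increasing.
  assert (L : ln (x - a) < ln eps / p).
  { rewrite <- (ln_exp (ln eps / p)). apply ln_increasing; lra. }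
  apply (Rmult_lt_reg_r (/ p)); [now apply Rinv_0_lt_compat|].
  replace (p * ln (x - a) * / p) with (ln (x - a)) by (field; lra). exact L.
Qed.

Lemma is_derive_Rpower_sub (a p x : R) : a < x ->
  is_derive (fun x => Rpower (x - a) p) x (p * Rpower (x - a) (p - 1)).
Proof.
  intros Hx. unfold Rpower. auto_derive; [lra|].
  replace ((p - 1) * ln (x + - a)) with (p * ln (x + - a) + - ln (x + - a)) by ring.
  unfold Rminus. rewrite (Rmult_plus_distr_r p (-(1))), exp_plus.
  replace (-(1) * ln (x + - a)) with (- ln (x + - a)) by ring.
  rewrite exp_Ropp, exp_ln by lra. field. lra.
Qed.

Section Integration.
Variables a b : R.
Hypothesis Hab : a < b.

(** Makes every integral over [c, b] with c > a proper. Nothing is required at [a], where the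
    integrands may blow up. *)
Definition left_regular (phi : R -> R) : Prop :=
  (forall x, a < x < b -> continuous phi x) /\
  (exists l, filterlim phi (at_left b) (locally l)).

Lemma left_regular_extend (phi : R -> R) : left_regular phi ->
  exists h, (forall x, a < x -> continuous h x) /\ (forall x, x < b -> h x = phi x).
Proof.
  intros [H [l Hl]].
  destruct (C0_extension_right (T := R_UniformSpace) phi l a b Hab H Hl) as [h [H1 [H2 _]]].
  now exists h.
Qed.

Lemma left_regular_ex_RInt (phi : R -> R) (c d : R) :
  left_regular phi -> a < c <= d -> d <= b -> ex_RInt phi c d.
Proof.
  intros H Hc Hd. destruct (left_regular_extend phi H) as [h [H1 H2]].
  apply ex_RInt_ext with h.
  - rewrite Rmin_left, Rmax_right by lra. intros x Hx. apply H2. lra.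
  - apply (ex_RInt_continuous (V := R_CompleteNormedModule)).
    rewrite Rmin_left, Rmax_right by lra. intros x Hx. apply H1. lra.
Qed.

(** Antiderivatives are known only on the open interval, so the fundamental theorem is applied on
    [c, d] and d sent to [b]. *)
Lemma left_regular_RInt_lim (phi : R -> R) (c : R) :
  left_regular phi -> a < c < b ->
  filterlim (fun d => RInt phi c d) (at_left b) (locally (RInt phi c b)).
Proof.
  intros H Hc. destruct (left_regular_extend phi H) as [h [H1 H2]].
  assert (E : forall d, c <= d <= b -> RInt h c d = RInt phi c d).
  { intros d Hd. apply RInt_ext. rewrite Rmin_left, Rmax_right by lra.
    intros x Hx. apply H2. lra. }
  rewrite <- E by lra.
  apply flim_ext with (fun d => RInt h c d).
  - exists (mkposreal (b - c) ltac:(lra)). intros d Hd Hlt.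
    change (Rabs (d - b) < b - c) in Hd. apply Rabs_def2 in Hd. apply E. lra.
  - apply flim_subfilter with (locally b).
    + intros P HP. now apply filter_le_within.
    + apply (continuous_RInt_1 (V := R_NormedModule) h c b).
      generalize (open_gt a b Hab). apply filter_imp. intros z Hz.
      apply (RInt_correct (V := R_CompleteNormedModule)).
      apply (ex_RInt_continuous (V := R_CompleteNormedModule)).
      intros x [Hx _]. apply H1. apply Rlt_le_trans with (2 := Hx).
      apply Rmin_glb_lt; lra.
Qed.

Lemma RInt_dominated (phi Phi dPhi : R -> R) (c d : R) :
  left_regular phi -> a < c <= d -> d <= b ->
  (forall x, a < x -> is_derive Phi x (dPhi x)) ->
  (forall x, a < x -> continuous dPhi x) ->
  (forall x, c < x < d -> Rabs (phi x) <= dPhi x) ->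
  Rabs (RInt phi c d) <= Phi d - Phi c.
Proof.
  intros H Hc Hd D1 D2 Hle.
  pose proof (left_regular_ex_RInt phi c d H Hc Hd) as Hex.
  assert (HP : is_RInt dPhi c d (Phi d - Phi c)).
  { apply (is_RInt_derive (V := R_CompleteNormedModule) Phi dPhi);
      rewrite Rmin_left, Rmax_right by lra; intros x Hx; [apply D1 | apply D2]; lra. }
  eapply Rle_trans; [apply abs_RInt_le; [lra | exact Hex]|].
  rewrite <- (is_RInt_unique _ _ _ _ HP).
  apply RInt_le; [lra| |now exists (Phi d - Phi c)|exact Hle].
  exact (ex_RInt_norm phi c d Hex).
Qed.

Definition Cleft_regular (phi : R -> C) : Prop :=
  left_regular (fun x => Re (phi x)) /\ left_regular (fun x => Im (phi x)).

Lemma Cleft_regular_intro (phi : R -> C) (l : C) :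
  (forall x, a < x < b -> Clim (locally x) phi (phi x)) -> Clim (at_left b) phi l ->
  Cleft_regular phi.
Proof.
  intros H [L1 L2]. split; split; try (eexists; eassumption); intros x Hx; apply (H x Hx).
Qed.

Lemma Cleft_regular_elim (phi : R -> C) : Cleft_regular phi ->
  (forall x, a < x < b -> Clim (locally x) phi (phi x)) /\ exists l, Clim (at_left b) phi l.
Proof.
  intros [[H1 [l1 L1]] [H2 [l2 L2]]]. split.
  - intros x Hx. split; [now apply H1 | now apply H2].
  - now exists (l1, l2).
Qed.

Lemma Cleft_regular_plus (f g : R -> C) : Cleft_regular f -> Cleft_regular g ->
  Cleft_regular (fun x => Cplus (f x) (g x)).
Proof.
  intros Hf Hg. destruct (Cleft_regular_elim _ Hf) as [Cf [lf Lf]].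
  destruct (Cleft_regular_elim _ Hg) as [Cg [lg Lg]].
  eapply Cleft_regular_intro; [intros x Hx|]; apply Clim_plus; eauto.
Qed.

Lemma Cleft_regular_mult (f g : R -> C) : Cleft_regular f -> Cleft_regular g ->
  Cleft_regular (fun x => Cmult (f x) (g x)).
Proof.
  intros Hf Hg. destruct (Cleft_regular_elim _ Hf) as [Cf [lf Lf]].
  destruct (Cleft_regular_elim _ Hg) as [Cg [lg Lg]].
  eapply Cleft_regular_intro; [intros x Hx|]; apply Clim_mult; eauto.
Qed.

Lemma Cleft_regular_const (c : C) : Cleft_regular (fun _ => c).
Proof. apply Cleft_regular_intro with c; intros; apply Clim_const. Qed.

Definition CRInt (phi : R -> C) (c d : R) : C :=
  (RInt (fun x => Re (phi x)) c d, RInt (fun x => Im (phi x)) c d).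

Definition improper_integral (phi : R -> C) (l : C) : Prop :=
  Cleft_regular phi /\ Clim (at_right a) (fun e => CRInt phi e b) l.

Lemma CInt_improper (phi : R -> C) (l : C) : improper_integral phi l -> CInt phi a b = l.
Proof.
  intros [[H1 H2] HL]. unfold CInt. apply (limC_Clim (F := at_right a)).
  apply Clim_ext with (2 := HL).
  generalize (at_right_between a b Hab). apply filter_imp. intros e He.
  symmetry. apply (is_RInt_unique (V := C_R_CompleteNormedModule)).
  apply (is_RInt_fct_extend_pair (U := R_NormedModule) (V := R_NormedModule)).
  - apply (RInt_correct (V := R_CompleteNormedModule) (fun x => Re (phi x))).
    apply left_regular_ex_RInt; [exact H1 | lra | lra].
  - apply (RInt_correct (V := R_CompleteNormedModule) (fun x => Im (phi x))).
    apply left_regular_ex_RInt; [exact H2 | lra | lra].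
Qed.

Lemma CRInt_ext (f g : R -> C) (c d : R) : c <= d ->
  (forall x, c < x < d -> f x = g x) -> CRInt f c d = CRInt g c d.
Proof.
  intros Hcd H. unfold CRInt. f_equal; apply RInt_ext;
    rewrite Rmin_left, Rmax_right by lra; intros x Hx; now rewrite H.
Qed.

Lemma CRInt_plus (f g : R -> C) (c d : R) :
  Cleft_regular f -> Cleft_regular g -> a < c <= d -> d <= b ->
  CRInt (fun x => Cplus (f x) (g x)) c d = Cplus (CRInt f c d) (CRInt g c d).
Proof.
  intros [F1 F2] [G1 G2] Hc Hd. unfold CRInt, Cplus; simpl. f_equal.
  - apply (RInt_plus (V := R_CompleteNormedModule) (fun x => Re (f x)) (fun x => Re (g x)));
      now apply left_regular_ex_RInt.
  - apply (RInt_plus (V := R_CompleteNormedModule) (fun x => Im (f x)) (fun x => Im (g x)));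
      now apply left_regular_ex_RInt.
Qed.

Lemma CRInt_scal (k : C) (f : R -> C) (c d : R) :
  Cleft_regular f -> a < c <= d -> d <= b ->
  CRInt (fun x => Cmult k (f x)) c d = Cmult k (CRInt f c d).
Proof.
  intros [F1 F2] Hc Hd.
  pose proof (RInt_correct (V := R_CompleteNormedModule) _ _ _ (left_regular_ex_RInt _ c d F1 Hc Hd)) as I1.
  pose proof (RInt_correct (V := R_CompleteNormedModule) _ _ _ (left_regular_ex_RInt _ c d F2 Hc Hd)) as I2.
  destruct k as [k1 k2]. unfold CRInt, Cmult; simpl. f_equal; apply is_RInt_unique.
  - apply (is_RInt_minus (V := R_NormedModule)); now apply (is_RInt_scal (V := R_NormedModule)).
  - apply (is_RInt_plus (V := R_NormedModule)); now apply (is_RInt_scal (V := R_NormedModule)).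
Qed.

Lemma CRInt_Chasles (f : R -> C) (c d : R) : Cleft_regular f -> a < c <= d -> d <= b ->
  CRInt f c b = Cplus (CRInt f c d) (CRInt f d b).
Proof.
  intros [F1 F2] Hc Hd. unfold CRInt, Cplus; simpl. f_equal; symmetry.
  - apply (RInt_Chasles (V := R_CompleteNormedModule) (fun x => Re (f x)));
      apply left_regular_ex_RInt; try assumption; lra.
  - apply (RInt_Chasles (V := R_CompleteNormedModule) (fun x => Im (f x)));
      apply left_regular_ex_RInt; try assumption; lra.
Qed.

Lemma CRInt_dominated (phi : R -> C) (Phi dPhi : R -> R) (c d : R) :
  Cleft_regular phi -> a < c <= d -> d <= b ->
  (forall x, a < x -> is_derive Phi x (dPhi x)) ->
  (forall x, a < x -> continuous dPhi x) ->
  (forall x, c < x < d -> Cmod (phi x) <= dPhi x) ->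
  Cmod (CRInt phi c d) <= 2 * (Phi d - Phi c).
Proof.
  intros [F1 F2] Hc Hd D1 D2 Hle. eapply Rle_trans; [apply Cmod_le_abs|]. simpl.
  assert (A : Rabs (RInt (fun x => Re (phi x)) c d) <= Phi d - Phi c).
  { apply RInt_dominated with dPhi; try assumption. intros x Hx.
    eapply Rle_trans; [apply Re_le_Cmod | now apply Hle]. }
  assert (B : Rabs (RInt (fun x => Im (phi x)) c d) <= Phi d - Phi c).
  { apply RInt_dominated with dPhi; try assumption. intros x Hx.
    eapply Rle_trans; [apply Im_le_Cmod | now apply Hle]. }
  lra.
Qed.

Lemma CRInt_derive (F f : R -> C) (L : C) (c : R) :
  Cleft_regular f -> a < c < b ->
  (forall x, a < x < b -> Cderiv F x (f x)) -> Clim (at_left b) F L ->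
  CRInt f c b = Cminus L (F c).
Proof.
  intros [F1 F2] Hc HD [L1 L2].
  assert (N : at_left b (fun d => c < d < b)).
  { apply at_left_between; lra. }
  unfold CRInt. apply injective_projections; simpl.
  - apply (flim_unique (F := at_left b) (fun d => RInt (fun x => Re (f x)) c d)).
    + now apply left_regular_RInt_lim.
    + apply flim_ext with (fun d => Re (F d) - Re (F c)); [|now apply flim_minus; [|apply flim_const]].
      revert N. apply filter_imp. intros d Hd. symmetry. apply is_RInt_unique.
      apply (is_RInt_derive (V := R_CompleteNormedModule) (fun x => Re (F x)));
        rewrite Rmin_left, Rmax_right by lra; intros x Hx; [apply HD | apply F1]; lra.
  - apply (flim_unique (F := at_left b) (fun d => RInt (fun x => Im (f x)) c d)).
    + now apply left_regular_RInt_lim.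
    + apply flim_ext with (fun d => Im (F d) - Im (F c)); [|now apply flim_minus; [|apply flim_const]].
      revert N. apply filter_imp. intros d Hd. symmetry. apply is_RInt_unique.
      apply (is_RInt_derive (V := R_CompleteNormedModule) (fun x => Im (F x)));
        rewrite Rmin_left, Rmax_right by lra; intros x Hx; [apply HD | apply F2]; lra.
Qed.

Lemma improper_integral_plus (f g : R -> C) (l k : C) :
  improper_integral f l -> improper_integral g k ->
  improper_integral (fun x => Cplus (f x) (g x)) (Cplus l k).
Proof.
  intros [F1 F2] [G1 G2]. split; [now apply Cleft_regular_plus|].
  apply Clim_ext with (fun e => Cplus (CRInt f e b) (CRInt g e b)); [|now apply Clim_plus].
  generalize (at_right_between a b Hab). apply filter_imp. intros e He.
  symmetry. apply CRInt_plus; try assumption; lra.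
Qed.

Lemma improper_integral_scal (k : C) (f : R -> C) (l : C) :
  improper_integral f l -> improper_integral (fun x => Cmult k (f x)) (Cmult k l).
Proof.
  intros [F1 F2]. split; [apply Cleft_regular_mult; [apply Cleft_regular_const | exact F1]|].
  apply Clim_ext with (fun e => Cmult k (CRInt f e b)); [|apply Clim_mult; [apply Clim_const | exact F2]].
  generalize (at_right_between a b Hab). apply filter_imp. intros e He.
  symmetry. apply CRInt_scal; try assumption; lra.
Qed.

Lemma Cleft_regular_ext (f g : R -> C) :
  (forall x, a < x < b -> f x = g x) -> Cleft_regular f -> Cleft_regular g.
Proof.
  intros E H. destruct (Cleft_regular_elim _ H) as [Cf [l Lf]].
  apply Cleft_regular_intro with l.
  - intros x Hx. rewrite <- E by exact Hx. apply Clim_ext with f; [|now apply Cf].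
    generalize (locally_between a b x Hx). apply filter_imp. exact E.
  - apply Clim_ext with f; [|exact Lf].
    generalize (at_left_between a b Hab). apply filter_imp. exact E.
Qed.

Lemma improper_integral_ext (f g : R -> C) (l : C) :
  (forall x, a < x < b -> f x = g x) -> improper_integral f l -> improper_integral g l.
Proof.
  intros E [F1 F2]. split; [now apply Cleft_regular_ext with f|].
  apply Clim_ext with (fun e => CRInt f e b); [|exact F2].
  generalize (at_right_between a b Hab). apply filter_imp. intros e He.
  apply CRInt_ext; [lra|]. intros x Hx. apply E. lra.
Qed.

Lemma improper_integral_sum_n (u : nat -> R -> C) (l : nat -> C) (n : nat) :
  (forall j, (j <= n)%nat -> improper_integral (u j) (l j)) ->
  improper_integral (fun x => sum_n (fun j => u j x) n) (sum_n l n).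
Proof.
  induction n as [|n IH]; intros H.
  - rewrite sum_O. apply improper_integral_ext with (u O); [|now apply H].
    intros x _. now rewrite sum_O.
  - rewrite sum_Sn.
    apply improper_integral_ext with (fun x => Cplus (sum_n (fun j => u j x) n) (u (S n) x)).
    + intros x _. now rewrite sum_Sn.
    + apply improper_integral_plus; [apply IH; intros j Hj|]; apply H; lia.
Qed.

(** The majorant has the primitive K (x - a)^(alpha+1)/(alpha+1), which tends to 0 at [a] because
    alpha > -1; hence the integrals over [e, b] are Cauchy as e tends to [a]. *)
Lemma improper_integral_ex (phi : R -> C) (K alpha : R) :
  Cleft_regular phi -> -1 < alpha ->
  (forall x, a < x < b -> Cmod (phi x) <= K * Rpower (x - a) alpha) ->
  exists l, improper_integral phi l.
Proof.
  intros H Halpha Hle.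
  set (Phi := fun x => K / (alpha + 1) * Rpower (x - a) (alpha + 1)).
  assert (D1 : forall x, a < x -> is_derive Phi x (K * Rpower (x - a) alpha)).
  { intros x Hx. unfold Phi. eapply is_derive_eq.
    - apply is_derive_scal, is_derive_Rpower_sub, Hx.
    - replace (alpha + 1 - 1) with alpha by ring. field. lra. }
  assert (D2 : forall x, a < x -> continuous (fun x => K * Rpower (x - a) alpha) x).
  { intros x Hx.
    apply (@ex_derive_continuous R_AbsRing R_NormedModule (fun x => K * Rpower (x - a) alpha) x).
    unfold Rpower. auto_derive. lra. }
  assert (HPhi : filterlim Phi (at_right a) (locally 0)).
  { replace 0 with (K / (alpha + 1) * 0) by ring. apply flim_mult; [apply flim_const|].
    apply Rpower_lim_0. lra. }
  assert (Hcauchy : forall eps : posreal, exists P, at_right a P /\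
    forall u v, P u -> P v -> Cmod (Cminus (CRInt phi v b) (CRInt phi u b)) < eps).
  { intros eps.
    (* The integral over [u, v] is at most 2 (|Phi u| + |Phi v|), the 2 coming from the two
       components. *)
    assert (He : 0 < eps / 4) by (pose proof (cond_pos eps); lra).
    pose proof (proj1 (filterlim_locally Phi 0) HPhi (mkposreal _ He)) as N.
    exists (fun x => a < x < b /\ Rabs (Phi x) < eps / 4). split.
    - generalize (filter_and _ _ (at_right_between a b Hab) N). apply filter_imp.
      intros x [Hx Hb]. split; [exact Hx|]. change (Rabs (Phi x - 0) < eps / 4) in Hb.
      now rewrite Rminus_0_r in Hb.
    - assert (Q : forall u v, a < u < b -> a < v < b -> Rabs (Phi u) < eps / 4 ->
        Rabs (Phi v) < eps / 4 -> u <= v ->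
        Cmod (Cminus (CRInt phi v b) (CRInt phi u b)) < eps).
      { intros u v Hu Hv Bu Bv Huv.
        rewrite (CRInt_Chasles phi u v H) by lra.
        replace (Cminus (CRInt phi v b) (Cplus (CRInt phi u v) (CRInt phi v b)))
          with (Copp (CRInt phi u v)) by ring.
        rewrite Cmod_opp. eapply Rle_lt_trans.
        - apply (CRInt_dominated phi Phi (fun x => K * Rpower (x - a) alpha)); try assumption; try lra.
          intros x Hx. apply Hle. lra.
        - apply Rabs_def2 in Bu. apply Rabs_def2 in Bv. lra. }
      intros u v [Hu Bu] [Hv Bv]. destruct (Rle_lt_dec u v) as [L|L].
      + now apply Q.
      + replace (Cminus (CRInt phi v b) (CRInt phi u b))
          with (Copp (Cminus (CRInt phi u b) (CRInt phi v b))) by ring.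
        rewrite Cmod_opp. apply Q; try assumption. lra. }
  assert (H1 : exists l, filterlim (fun e => Re (CRInt phi e b)) (at_right a) (locally l)).
  { apply (filterlim_locally_cauchy (U := R_CompleteNormedModule)). intros eps.
    destruct (Hcauchy eps) as [P [HP HQ]]. exists P. split; [exact HP|]. intros u v Hu Hv.
    eapply Rle_lt_trans; [apply (Re_le_Cmod (Cminus (CRInt phi v b) (CRInt phi u b))) | now apply HQ]. }
  assert (H2 : exists l, filterlim (fun e => Im (CRInt phi e b)) (at_right a) (locally l)).
  { apply (filterlim_locally_cauchy (U := R_CompleteNormedModule)). intros eps.
    destruct (Hcauchy eps) as [P [HP HQ]]. exists P. split; [exact HP|]. intros u v Hu Hv.
    eapply Rle_lt_trans; [apply (Im_le_Cmod (Cminus (CRInt phi v b) (CRInt phi u b))) | now apply HQ]. }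
  destruct H1 as [x Hx], H2 as [y Hy]. exists (x, y). split; [exact H | split; [exact Hx | exact Hy]].
Qed.

End Integration.

(** * The integration by parts step *)

Lemma CDer_n_components (phi : R -> C) (n : nat) (x : R) :
  CDer_n n phi x = (Derive_n (fun t => Re (phi t)) n x, Derive_n (fun t => Im (phi t)) n x).
Proof.
  revert x. induction n as [|n IH]; intros x.
  - simpl. unfold Re, Im. now destruct (phi x).
  - change (CDer_n (S n) phi x) with (CDer (CDer_n n phi) x). unfold CDer. simpl.
    f_equal; apply Derive_ext; intros t; now rewrite IH.
Qed.

(** * Complex-valued functions smooth up to the boundary *)

Section ComplexSmooth.
Variables a b : R.
Hypothesis Hab : a < b.

Definition Csmooth_up (s : R -> C) : Prop :=
  smooth_up a b (fun x => Re (s x)) /\ smooth_up a b (fun x => Im (s x)).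

Lemma Csmooth_up_ext (f g : R -> C) :
  (forall x, a < x < b -> f x = g x) -> Csmooth_up f -> Csmooth_up g.
Proof.
  intros E [H1 H2].
  split; [apply (smooth_up_ext a b Hab) with (2 := H1) | apply (smooth_up_ext a b Hab) with (2 := H2)];
    intros x Hx; now rewrite E.
Qed.

Lemma Csmooth_up_const (c : C) : Csmooth_up (fun _ => c).
Proof. split; apply smooth_up_const. Qed.

Lemma Csmooth_up_RtoC (f : R -> R) : smooth_up a b f -> Csmooth_up (fun x => RtoC (f x)).
Proof. intros H. split; [exact H | exact (smooth_up_const a b 0)]. Qed.

Lemma Csmooth_up_plus (f g : R -> C) : Csmooth_up f -> Csmooth_up g ->
  Csmooth_up (fun x => Cplus (f x) (g x)).
Proof. intros [F1 F2] [G1 G2]. split; now apply smooth_up_plus. Qed.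

Lemma Csmooth_up_mult (f g : R -> C) : Csmooth_up f -> Csmooth_up g ->
  Csmooth_up (fun x => Cmult (f x) (g x)).
Proof.
  intros [F1 F2] [G1 G2]. split.
  - apply (smooth_up_minus a b Hab); now apply smooth_up_mult.
  - apply smooth_up_plus; now apply smooth_up_mult.
Qed.

Lemma Csmooth_up_minus (f g : R -> C) : Csmooth_up f -> Csmooth_up g ->
  Csmooth_up (fun x => Cminus (f x) (g x)).
Proof. intros [F1 F2] [G1 G2]. split; now apply (smooth_up_minus a b Hab). Qed.

Lemma Csmooth_up_Cderiv (s : R -> C) : Csmooth_up s ->
  forall x, a < x < b -> Cderiv s x (CDer s x).
Proof.
  intros [H1 H2] x Hx.
  split; [apply (smooth_up_is_derive a b _ H1 x Hx) | apply (smooth_up_is_derive a b _ H2 x Hx)].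
Qed.

Lemma Csmooth_up_CDer (s : R -> C) : Csmooth_up s -> Csmooth_up (CDer s).
Proof.
  intros [H1 H2].
  split; [apply (smooth_up_Derive a b Hab _ H1) | apply (smooth_up_Derive a b Hab _ H2)].
Qed.

Lemma CderA_components (s : R -> C) (j : nat) : Csmooth_up s ->
  CderA s j a = (derA (fun x => Re (s x)) j a, derA (fun x => Im (s x)) j a).
Proof.
  intros [H1 H2]. unfold CderA. apply (limC_Clim (F := at_right a)).
  split; simpl.
  - apply flim_ext with (Derive_n (fun x => Re (s x)) j); [|now apply (derA_spec a b Hab)].
    apply filter_forall. intros x. now rewrite CDer_n_components.
  - apply flim_ext with (Derive_n (fun x => Im (s x)) j); [|now apply (derA_spec a b Hab)].
    apply filter_forall. intros x. now rewrite CDer_n_components.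
Qed.

Lemma CderB_lim (s : R -> C) : Csmooth_up s -> Clim (at_left b) s (CderB s 0 b).
Proof.
  intros [H1 H2].
  assert (H : Clim (at_left b) s
    (derB (fun x => Re (s x)) 0 b, derB (fun x => Im (s x)) 0 b)).
  { split; simpl; [apply (derB_spec a b Hab _ O H1) | apply (derB_spec a b Hab _ O H2)]. }
  replace (CderB s 0 b) with (derB (fun x => Re (s x)) 0 b, derB (fun x => Im (s x)) 0 b);
    [exact H|].
  symmetry. exact (limC_Clim (F := at_left b) s _ H).
Qed.

Lemma Csmooth_up_bounded (s : R -> C) : Csmooth_up s ->
  exists M, forall x, a < x < b -> Cmod (s x) <= M.
Proof.
  intros [H1 H2]. destruct (smooth_up_bounded a b Hab _ H1) as [M1 B1].
  destruct (smooth_up_bounded a b Hab _ H2) as [M2 B2]. exists (M1 + M2). intros x Hx.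
  eapply Rle_trans; [apply Cmod_le_abs|]. pose proof (B1 x Hx). pose proof (B2 x Hx). lra.
Qed.

Lemma smooth_up_left_regular (f : R -> R) : smooth_up a b f -> left_regular a b f.
Proof. intros H. destruct (H O) as [_ [L C]]. now split. Qed.

Lemma Csmooth_up_left_regular (s : R -> C) : Csmooth_up s -> Cleft_regular a b s.
Proof. intros [H1 H2]. split; now apply smooth_up_left_regular. Qed.

Lemma left_regular_inv_pow (n : nat) : left_regular a b (fun x => / (x - a) ^ n).
Proof.
  split.
  - intros x Hx. apply (flim_inv (fun x => (x - a) ^ n)).
    + apply pow_nonzero. lra.
    + apply flim_pow, (@ex_derive_continuous R_AbsRing R_NormedModule (fun x => x - a) x).
      exists 1. apply is_derive_sub_const.
  - exists (/ (b - a) ^ n). apply flim_inv; [apply pow_nonzero; lra|].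
    apply flim_pow, flim_at_left_id.
Qed.

Lemma Cleft_regular_RtoC (f : R -> R) : left_regular a b f -> Cleft_regular a b (fun x => RtoC (f x)).
Proof. intros H. split; [exact H | exact (smooth_up_left_regular _ (smooth_up_const a b 0))]. Qed.

Lemma Csmooth_up_taylor (r : nat) (s : R -> C) : Csmooth_up s ->
  exists rho, Csmooth_up rho /\ forall x, a < x < b ->
    s x = Cplus (Taylor r s a x) (Cmult (RtoC ((x - a) ^ S r)) (rho x)).
Proof.
  intros H. destruct (smooth_up_taylor a b Hab r _ (proj1 H)) as [rho1 [R1 [_ E1]]].
  destruct (smooth_up_taylor a b Hab r _ (proj2 H)) as [rho2 [R2 [_ E2]]].
  exists (fun x => (rho1 x, rho2 x)). split; [now split|]. intros x Hx.
  assert (T : Taylor r s a x =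
    (sum_n (fun j => derA (fun x => Re (s x)) j a / INR (fact j) * (x - a) ^ j) r,
     sum_n (fun j => derA (fun x => Im (s x)) j a / INR (fact j) * (x - a) ^ j) r)).
  { unfold Taylor. clear E1 E2 R1 R2.
    assert (K : forall j, Cmult (Cdiv (CderA s j a) (RtoC (INR (fact j)))) (RtoC ((x - a) ^ j)) =
      (derA (fun x => Re (s x)) j a / INR (fact j) * (x - a) ^ j,
       derA (fun x => Im (s x)) j a / INR (fact j) * (x - a) ^ j)).
    { intros j. rewrite CderA_components by exact H. unfold Cdiv.
      rewrite <- RtoC_inv by apply INR_fact_neq_0. unfold Cmult, RtoC, Rdiv; simpl. f_equal; ring. }
    induction r as [|n IH].
    - rewrite !sum_O. apply K.
    - rewrite !sum_Sn, IH, K. reflexivity. }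
  rewrite T. specialize (E1 x Hx). specialize (E2 x Hx).
  destruct (s x) as [u v]. simpl in E1, E2. rewrite E1, E2.
  unfold Cplus, Cmult, RtoC; simpl. f_equal; ring.
Qed.

End ComplexSmooth.

(** The power is monotone in its base, in a direction depending on the sign of [beta]; the sum of
    the endpoint values covers both cases. *)
Lemma Rpower_between (m z M beta : R) : 0 < m <= z -> z <= M ->
  Rpower z beta <= Rpower m beta + Rpower M beta.
Proof.
  intros Hm HM. unfold Rpower.
  pose proof (exp_pos (beta * ln m)). pose proof (exp_pos (beta * ln M)).
  assert (ln m <= ln z) by (apply ln_le; lra). assert (ln z <= ln M) by (apply ln_le; lra).
  destruct (Rle_lt_dec 0 beta) as [L|L].
  - assert (exp (beta * ln z) <= exp (beta * ln M)); [apply exp_le_exp; nra | lra].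
  - assert (exp (beta * ln z) <= exp (beta * ln m)); [apply exp_le_exp; nra | lra].
Qed.

Lemma Cmod_cpow_le (w : C) : exists K, 0 <= K /\
  forall x, x <> 0 -> Cmod (cpow (RtoC x) w) <= K * Rpower (Rabs x) (Re w).
Proof.
  set (c := Cmod (Cexp (Cmult w (0, PI)))).
  assert (Hc : 0 <= c) by apply Cmod_ge_0.
  exists (1 + c). split; [lra|]. intros x Hx.
  assert (HR : 0 < Rpower (Rabs x) (Re w)) by apply exp_pos.
  destruct (Rlt_le_dec x 0) as [L|L].
  - replace (RtoC x) with (RtoC (- - x)) by (now rewrite Ropp_involutive).
    rewrite cpow_opp, Cmod_mult, Cmod_cpow_pos by lra. fold c.
    rewrite Rabs_left in * by exact L. lra.
  - rewrite Cmod_cpow_pos by lra. rewrite Rabs_pos_eq in * by exact L. nra.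
Qed.

(* [p] and [p1] are the nonvanishing factors in [g = (x - a)^(r+1) p] and
   [g' = (x - a)^r p1]; [ip] and [ip1] are their reciprocals. *)
Section Phase.
Variables (a b gb : R) (r : nat) (g p ip p1 ip1 : R -> R).
Hypothesis Hab : a < b.
Hypothesis Hr : (1 <= r)%nat.
Hypothesis Hg : smooth_up a b g.
Hypothesis Hg0 : forall x, a < x < b -> g x <> 0.
Hypothesis Hgb : filterlim g (at_left b) (locally gb).
Hypothesis Hgb0 : gb <> 0.
Hypothesis Hp : smooth_up a b p.
Hypothesis Hip : smooth_up a b ip.
Hypothesis Hp1 : smooth_up a b p1.
Hypothesis Hip1 : smooth_up a b ip1.
Hypothesis Eg : forall x, a < x < b -> g x = (x - a) ^ S r * p x.
Hypothesis Eg' : forall x, a < x < b -> Derive g x = (x - a) ^ r * p1 x.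
Hypothesis Eip : forall x, a < x < b -> p x * ip x = 1.
Hypothesis Eip1 : forall x, a < x < b -> p1 x * ip1 x = 1.

(** This is g'/g: a simple pole at [a] times a smooth factor. The exponent [^ 1] puts the pole in
    the form handled by [left_regular_inv_pow]. *)
Definition log_deriv (x : R) : R := p1 x * ip x * / (x - a) ^ 1.

Lemma log_deriv_spec (x : R) : a < x < b -> Derive g x = log_deriv x * g x.
Proof.
  intros Hx. rewrite Eg', Eg by exact Hx. unfold log_deriv.
  replace (p1 x * ip x * / (x - a) ^ 1 * ((x - a) ^ S r * p x))
    with ((x - a) ^ r * p1 x * (p x * ip x)) by (simpl; field; lra).
  rewrite Eip by exact Hx. ring.
Qed.

Lemma log_deriv_regular : Cleft_regular a b (fun x => RtoC (log_deriv x)).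
Proof.
  apply (Cleft_regular_ext a b Hab) with
    (fun x => Cmult (RtoC (p1 x * ip x)) (RtoC (/ (x - a) ^ 1))).
  - intros x _. unfold log_deriv. now rewrite !RtoC_mult.
  - apply Cleft_regular_mult; apply Cleft_regular_RtoC.
    + apply smooth_up_left_regular, smooth_up_mult; assumption.
    + now apply left_regular_inv_pow.
Qed.

(** In the chain rule (mu+1)/(omega g) meets omega g', and omega cancels to leave (mu+1) g'/g. This
    is why the functions sigma do not depend on omega. *)
Lemma bessel_phase_deriv (mu : C) (omega x : R) :
  - 1 < Re mu -> omega <> 0 -> a < x < b ->
  Cderiv (fun x => BesselJ (Cplus mu (RtoC 1)) (RtoC (omega * g x))) x
    (Cminus (Cmult (RtoC (omega * Derive g x)) (BesselJ mu (RtoC (omega * g x))))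
            (Cmult (Cmult (Cplus mu (RtoC 1)) (RtoC (log_deriv x)))
                   (BesselJ (Cplus mu (RtoC 1)) (RtoC (omega * g x))))).
Proof.
  intros Hmu Hom Hx.
  assert (Hn : omega * g x <> 0) by (apply Rmult_integral_contrapositive; split; auto).
  eapply Cderiv_eq.
  - apply (Cderiv_comp (fun t => BesselJ (Cplus mu (RtoC 1)) (RtoC t)) (fun x => omega * g x)).
    + now apply Cderiv_BesselJ_succ.
    + apply is_derive_scal. now apply (smooth_up_is_derive a b).
  - rewrite log_deriv_spec by exact Hx.
    replace (RtoC (log_deriv x)) with
      (Cmult (RtoC (omega * (log_deriv x * g x))) (RtoC (/ (omega * g x)))).
    + ring.
    + rewrite <- RtoC_mult. f_equal. field. split; [now apply Hg0 | exact Hom].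
Qed.

Lemma bessel_phase_lim (mu : C) (omega : R) : - 1 < Re mu -> omega <> 0 ->
  Clim (at_left b) (fun x => BesselJ mu (RtoC (omega * g x))) (BesselJ mu (RtoC (omega * gb))).
Proof.
  intros Hmu Hom.
  assert (Hn : omega * gb <> 0) by (apply Rmult_integral_contrapositive; split; auto).
  assert (L : filterlim (fun x => omega * g x) (at_left b) (locally (omega * gb)))
    by (apply flim_mult; [apply flim_const | exact Hgb]).
  destruct (Cderiv_Clim _ _ _ (Cderiv_BesselJ mu _ Hmu Hn)) as [C1 C2]. split.
  - exact (flim_comp_continuous (fun t => Re (BesselJ mu (RtoC t))) _ _ C1 L).
  - exact (flim_comp_continuous (fun t => Im (BesselJ mu (RtoC t))) _ _ C2 L).
Qed.

Lemma bessel_phase_regular (mu : C) (omega : R) : - 1 < Re mu -> omega <> 0 ->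
  Cleft_regular a b (fun x => BesselJ mu (RtoC (omega * g x))).
Proof.
  intros Hmu Hom. apply Cleft_regular_intro with (BesselJ mu (RtoC (omega * gb))).
  - intros x Hx.
    assert (Hn : omega * g x <> 0) by (apply Rmult_integral_contrapositive; split; auto).
    eapply Cderiv_Clim.
    apply (Cderiv_comp (fun t => BesselJ mu (RtoC t)) (fun x => omega * g x)).
    + now apply Cderiv_BesselJ.
    + apply is_derive_scal. now apply (smooth_up_is_derive a b).
  - now apply bessel_phase_lim.
Qed.

(** The fundamental theorem for h J_(mu+1)(omega g). The factor [h] is left free because two choices
    are needed: (s - T_r[s])/g' in the expansion step and s/g' in the final estimate. The lower
    limit stays above [a], where the second choice may be singular. *)
Lemma bessel_by_parts (mu hb : C) (omega c : R) (h h' : R -> C) :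
  - 1 < Re mu -> omega <> 0 -> a < c < b ->
  (forall x, a < x < b -> Cderiv h x (h' x)) ->
  Cleft_regular a b h -> Cleft_regular a b h' -> Clim (at_left b) h hb ->
  Cplus
    (Cmult (RtoC omega)
       (CRInt (fun x => Cmult (Cmult (h x) (RtoC (Derive g x))) (BesselJ mu (RtoC (omega * g x)))) c b))
    (CRInt (fun x => Cmult (Cminus (h' x) (Cmult (Cmult (Cplus mu (RtoC 1)) (h x)) (RtoC (log_deriv x))))
                           (BesselJ (Cplus mu (RtoC 1)) (RtoC (omega * g x)))) c b) =
  Cminus (Cmult hb (BesselJ (Cplus mu (RtoC 1)) (RtoC (omega * gb))))
         (Cmult (h c) (BesselJ (Cplus mu (RtoC 1)) (RtoC (omega * g c)))).
Proof.
  intros Hmu Hom Hc Hd Rh Rh' Lh.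
  assert (Hmu1 : - 1 < Re (Cplus mu (RtoC 1))) by (change (-1 < Re mu + 1); lra).
  pose proof (bessel_phase_regular mu omega Hmu Hom) as RJ.
  pose proof (bessel_phase_regular _ omega Hmu1 Hom) as RP.
  assert (Rg : Cleft_regular a b (fun x => RtoC (Derive g x))).
  { apply Cleft_regular_RtoC, smooth_up_left_regular, smooth_up_Derive; assumption. }
  assert (R1 : Cleft_regular a b
    (fun x => Cmult (Cmult (h x) (RtoC (Derive g x))) (BesselJ mu (RtoC (omega * g x)))))
    by (apply Cleft_regular_mult; [apply Cleft_regular_mult|]; assumption).
  assert (R2 : Cleft_regular a b
    (fun x => Cmult (Cminus (h' x) (Cmult (Cmult (Cplus mu (RtoC 1)) (h x)) (RtoC (log_deriv x))))
                           (BesselJ (Cplus mu (RtoC 1)) (RtoC (omega * g x))))).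
  { apply Cleft_regular_mult; [|exact RP].
    apply (Cleft_regular_ext a b Hab) with (fun x => Cplus (h' x)
       (Cmult (Cmult (Copp (Cplus mu (RtoC 1))) (h x)) (RtoC (log_deriv x)))).
    - intros x _. ring.
    - apply Cleft_regular_plus; [exact Rh'|]. apply Cleft_regular_mult; [|apply log_deriv_regular].
      apply Cleft_regular_mult; [apply Cleft_regular_const | exact Rh]. }
  rewrite <- (CRInt_scal a b) by (try exact R1; lra).
  rewrite <- (CRInt_plus a b); try lra; [| |exact R2].
  - apply (CRInt_derive a b Hab
      (fun x => Cmult (h x) (BesselJ (Cplus mu (RtoC 1)) (RtoC (omega * g x))))); [|exact Hc| |].
    + apply Cleft_regular_plus; [|exact R2].
      apply Cleft_regular_mult; [apply Cleft_regular_const | exact R1].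
    + intros x Hx. eapply Cderiv_eq.
      * apply Cderiv_mult; [now apply Hd | now apply bessel_phase_deriv].
      * cbv beta. rewrite (RtoC_mult omega (Derive g x)). ring.
    + apply Clim_mult; [exact Lh | now apply bessel_phase_lim].
  - apply Cleft_regular_mult; [apply Cleft_regular_const | exact R1].
Qed.

(** Serves integrability only, so the constant may depend on omega. The point is |omega g/2| = (x -
    a)^(r+1) omega |p|/2, with omega |p|/2 between two positive constants. *)
Lemma bessel_phase_le (mu : C) (omega : R) : - 1 < Re mu -> 0 < omega ->
  exists K, 0 <= K /\ forall x, a < x < b ->
    Cmod (BesselJ mu (RtoC (omega * g x))) <= K * Rpower (x - a) (INR (S r) * Re mu).
Proof.
  intros Hmu Hom.
  destruct (smooth_up_bounded a b Hab p Hp) as [Mp Bp].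
  destruct (smooth_up_bounded a b Hab ip Hip) as [Mi Bi].
  destruct (smooth_up_bounded a b Hab g Hg) as [Mg Bg].
  destruct (Cmod_cpow_le mu) as [K1 [HK1 Bc]].
  destruct (continuous_Cmod_bounded (bessel_entire mu) 0 ((omega * Mg / 2) ^ 2)) as [M HM].
  { intros x _. eapply Cderiv_Clim, Cderiv_bessel_entire, Hmu. }
  (* A lower bound for omega |p|/2: |p| |ip| = 1 and |ip| <= |Mi| + 1, the 1 keeping the denominator
     positive. *)
  set (m := omega / (2 * (Rabs Mi + 1))).
  assert (Hm : 0 < m).
  { unfold m. apply Rdiv_lt_0_compat; [exact Hom|]. pose proof (Rabs_pos Mi). lra. }
  set (K2 := Rpower m (Re mu) + Rpower (omega * Mp / 2) (Re mu)).
  assert (HK2 : 0 <= K2).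
  { unfold K2, Rpower. apply Rplus_le_le_0_compat; apply Rlt_le, exp_pos. }
  exists (K1 * K2 * Rabs M). split.
  { repeat apply Rmult_le_pos; try assumption. apply Rabs_pos. }
  intros x Hx.
  rewrite BesselJ_entire, Cmod_mult by exact Hmu.
  assert (Hn : omega * g x / 2 <> 0).
  { apply Rmult_integral_contrapositive. split; [|lra].
    apply Rmult_integral_contrapositive. split; [lra | now apply Hg0]. }
  assert (HA : Cmod (bessel_entire mu ((omega * g x / 2) ^ 2)) <= Rabs M).
  { apply Rle_trans with (2 := Rle_abs M). apply HM. split; [apply pow2_ge_0|].
    rewrite <- (pow2_abs (omega * g x / 2)). apply pow_incr. split; [apply Rabs_pos|].
    unfold Rdiv. rewrite !Rabs_mult, (Rabs_pos_eq omega), (Rabs_pos_eq (/ 2)) by lra.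
    pose proof (Bg x Hx). apply Rmult_le_compat_r; [lra|]. apply Rmult_le_compat_l; lra. }
  assert (HC : Cmod (cpow (RtoC (omega * g x / 2)) mu) <=
               K1 * (Rpower (x - a) (INR (S r) * Re mu) * K2)).
  { eapply Rle_trans; [now apply Bc|]. apply Rmult_le_compat_l; [exact HK1|].
    assert (Hx0 : 0 < x - a) by lra.
    assert (Hpn : 0 < Rabs (p x)).
    { apply Rabs_pos_lt. intros E. pose proof (Eip x Hx) as E'. rewrite E in E'. lra. }
    replace (Rabs (omega * g x / 2)) with ((x - a) ^ S r * (omega * Rabs (p x) / 2)).
    - rewrite <- Rpower_mult_distr; [|apply pow_lt, Hx0|].
      + rewrite <- Rpower_pow, Rpower_mult by exact Hx0.
        apply Rmult_le_compat_l; [apply Rlt_le, exp_pos|].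
        apply Rpower_between.
        * split; [exact Hm|]. unfold m, Rdiv. rewrite Rmult_assoc.
          apply Rmult_le_compat_l; [lra|]. rewrite Rinv_mult, Rmult_comm.
          apply Rmult_le_compat_r; [lra|].
          assert (Hi : Rabs (p x) * Rabs (ip x) = 1).
          { rewrite <- Rabs_mult, Eip by exact Hx. apply Rabs_R1. }
          pose proof (Bi x Hx). pose proof (Rle_abs Mi). pose proof (Rabs_pos (ip x)).
          apply (Rmult_le_reg_r (Rabs Mi + 1)); [lra|]. rewrite Rinv_l by lra.
          rewrite <- Hi. apply Rmult_le_compat_l; lra.
        * pose proof (Bp x Hx). unfold Rdiv. apply Rmult_le_compat_r; [lra|].
          apply Rmult_le_compat_l; lra.
      + apply Rdiv_lt_0_compat; [|lra]. now apply Rmult_lt_0_compat.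
    - rewrite Eg by exact Hx. unfold Rdiv.
      rewrite !Rabs_mult, (Rabs_pos_eq omega), (Rabs_pos_eq (/ 2)) by lra.
      rewrite (Rabs_pos_eq ((x - a) ^ S r)) by (apply Rlt_le, pow_lt, Hx0). ring. }
  apply Rle_trans with (K1 * (Rpower (x - a) (INR (S r) * Re mu) * K2) * Rabs M).
  - apply Rmult_le_compat; try apply Cmod_ge_0; assumption.
  - apply Req_le. ring.
Qed.

Lemma INR_Sr : 2 <= INR (S r).
Proof. rewrite S_INR. apply le_INR in Hr. simpl in Hr. lra. Qed.

Lemma Re_gt_m1 (mu : C) : -1 < INR (S r) * Re mu -> -1 < Re mu.
Proof. intros H. pose proof INR_Sr. nra. Qed.

Lemma bessel_phase_integrable (mu : C) (omega : R) (s : R -> C) :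
  -1 < INR (S r) * Re mu -> 0 < omega -> Csmooth_up a b s ->
  exists l, improper_integral a b (fun x => Cmult (s x) (BesselJ mu (RtoC (omega * g x)))) l.
Proof.
  intros Hmu Hom Hs. pose proof (Re_gt_m1 mu Hmu) as Hmu1.
  destruct (bessel_phase_le mu omega Hmu1 Hom) as [K [HK BK]].
  destruct (Csmooth_up_bounded a b Hab s Hs) as [M BM].
  apply (improper_integral_ex a b Hab) with (Rabs M * K) (INR (S r) * Re mu).
  - apply Cleft_regular_mult; [now apply Csmooth_up_left_regular|].
    apply bessel_phase_regular; lra.
  - exact Hmu.
  - intros x Hx. rewrite Cmod_mult, Rmult_assoc.
    apply Rmult_le_compat; try apply Cmod_ge_0; [|now apply BK].
    apply Rle_trans with (2 := Rle_abs M). now apply BM.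
Qed.

(** * The sigma recursion, one step of the expansion, and the remainder *)

Definition sigma_next (e : C) (s : R -> C) : R -> C := fun x =>
  Cmult (cpow (RtoC (g x)) e)
    (CDer (fun t => Cdiv (Cminus (s t) (Taylor r s a t))
                         (Cmult (cpow (RtoC (g t)) e) (RtoC (Derive g t)))) x).

Lemma Derive_g_neq_0 (x : R) : a < x < b -> Derive g x <> 0.
Proof.
  intros Hx E. rewrite Eg' in E by exact Hx. apply Rmult_integral in E. destruct E as [E|E].
  - revert E. apply pow_nonzero. lra.
  - pose proof (Eip1 x Hx) as E'. rewrite E in E'. lra.
Qed.

(** With the quotient written as h g^(-e), the outer factor g^e cancels the powers left by the
    product rule. No complex power survives, so smoothness can be read off. *)
Lemma sigma_next_eq (e : C) (s h : R -> C) (x : R) : Csmooth_up a b h -> a < x < b ->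
  (forall t, a < t < b -> Cminus (s t) (Taylor r s a t) = Cmult (h t) (RtoC (Derive g t))) ->
  sigma_next e s x = Cminus (CDer h x) (Cmult (Cmult e (h x)) (RtoC (log_deriv x))).
Proof.
  intros Hh Hx E. unfold sigma_next.
  assert (Hinv : forall t, t <> 0 -> Cmult (cpow (RtoC t) (Copp e)) (cpow (RtoC t) e) = RtoC 1).
  { intros t Ht. rewrite <- cpow_plus by exact Ht.
    replace (Cplus (Copp e) e) with (RtoC 0) by ring.
    rewrite cpow_real by exact Ht. rewrite Cmult_0_l. apply Cexp_0. }
  assert (D : Cderiv (fun t => Cmult (h t) (cpow (RtoC (g t)) (Copp e))) x
    (Cplus (Cmult (CDer h x) (cpow (RtoC (g x)) (Copp e)))
           (Cmult (h x) (Cmult (RtoC (Derive g x))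
              (Cmult (Cmult (Copp e) (RtoC (/ g x))) (cpow (RtoC (g x)) (Copp e))))))).
  { apply Cderiv_mult; [now apply (Csmooth_up_Cderiv a b)|].
    apply (Cderiv_comp (fun t => cpow (RtoC t) (Copp e)) g).
    - apply Cderiv_cpow. now apply Hg0.
    - now apply (smooth_up_is_derive a b). }
  assert (D' : Cderiv (fun t => Cdiv (Cminus (s t) (Taylor r s a t))
                 (Cmult (cpow (RtoC (g t)) e) (RtoC (Derive g t)))) x
    (Cplus (Cmult (CDer h x) (cpow (RtoC (g x)) (Copp e)))
           (Cmult (h x) (Cmult (RtoC (Derive g x))
              (Cmult (Cmult (Copp e) (RtoC (/ g x))) (cpow (RtoC (g x)) (Copp e))))))).
  { apply Cderiv_ext_loc with (2 := D).
    generalize (locally_between a b x Hx). apply filter_imp. intros t Ht.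
    rewrite E by exact Ht.
    pose proof (RtoC_neq_0 _ (Derive_g_neq_0 t Ht)) as N1.
    pose proof (cpow_neq_0 (g t) e (Hg0 t Ht)) as N2.
    replace (cpow (RtoC (g t)) (Copp e)) with (Cinv (cpow (RtoC (g t)) e)).
    - field. split; assumption.
    - rewrite <- (Cmult_1_l (Cinv _)), <- (Hinv (g t)) by (now apply Hg0).
      field. exact N2. }
  rewrite (Cderiv_CDer _ x _ D').
  rewrite log_deriv_spec, RtoC_mult by exact Hx.
  replace (Cmult (cpow (RtoC (g x)) e) _) with
    (Cmult (Cmult (cpow (RtoC (g x)) (Copp e)) (cpow (RtoC (g x)) e))
       (Cminus (CDer h x) (Cmult (Cmult e (h x)) (Cmult (RtoC (log_deriv x))
          (Cmult (RtoC (g x)) (RtoC (/ g x))))))) by ring.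
  rewrite Hinv by (now apply Hg0).
  rewrite <- (RtoC_mult (g x)), Rinv_r by (now apply Hg0). ring.
Qed.

Variable dgb : R.
Hypothesis Hdgb : filterlim (Derive g) (at_left b) (locally dgb).
Hypothesis Hdgb0 : dgb <> 0.

Lemma Csmooth_up_pow (j : nat) : Csmooth_up a b (fun x => RtoC ((x - a) ^ j)).
Proof.
  apply Csmooth_up_RtoC. induction j as [|j IH].
  - exact (smooth_up_const a b 1).
  - apply (smooth_up_mult a b (fun x => x - a)); [apply smooth_up_id | exact IH].
Qed.

Lemma Taylor_lim (s : R -> C) : Clim (at_left b) (Taylor r s a) (Taylor r s a b).
Proof.
  unfold Taylor.
  apply (Clim_sum_n (F := at_left b)
    (fun j x => Cmult (Cdiv (CderA s j a) (RtoC (INR (fact j)))) (RtoC ((x - a) ^ j)))).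
  intros j _. apply Clim_mult; [apply Clim_const|].
  apply Clim_RtoC, flim_pow, flim_at_left_id.
Qed.

Lemma sum_n_Cmult_r (u : nat -> C) (z : C) (n : nat) :
  Cmult (sum_n u n) z = sum_n (fun j => Cmult (u j) z) n.
Proof.
  induction n as [|n IH]; [now rewrite !sum_O|].
  rewrite !sum_Sn, <- IH. unfold plus; simpl. ring.
Qed.

Lemma bessel_step (mu : C) (s : R -> C) : -1 < INR (S r) * Re mu -> Csmooth_up a b s ->
  Csmooth_up a b (sigma_next (Cplus mu (RtoC 1)) s) /\
  forall omega, 0 < omega ->
  CInt (fun x => Cmult (s x) (BesselJ mu (RtoC (omega * g x)))) a b =
  Cplus
    (sum_n (fun j => Cmult (Cdiv (CderA s j a) (RtoC (INR (fact j))))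
       (CInt (fun x => Cmult (RtoC ((x - a) ^ j)) (BesselJ mu (RtoC (omega * g x)))) a b)) r)
    (Cmult (RtoC (/ omega))
      (Cminus
        (Cmult (Cdiv (Cminus (CderB s 0 b) (Taylor r s a b)) (RtoC dgb))
               (BesselJ (Cplus mu (RtoC 1)) (RtoC (omega * gb))))
        (CInt (fun x => Cmult (sigma_next (Cplus mu (RtoC 1)) s x)
                         (BesselJ (Cplus mu (RtoC 1)) (RtoC (omega * g x)))) a b))).
Proof.
  intros Hmu Hs. pose proof (Re_gt_m1 mu Hmu) as Hmu1.
  (* Re mu may be negative, but Re mu + 1 is not, so the boundedness of Bessel functions is
     available for the order [e]. *)
  set (e := Cplus mu (RtoC 1)).
  assert (He : 0 <= Re e) by (change (0 <= Re mu + 1); lra).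
  assert (He1 : -1 < INR (S r) * Re e) by (pose proof INR_Sr; nra).
  destruct (Csmooth_up_taylor a b Hab r s Hs) as [rho [Hrho Erho]].
  (* As s - T_r[s] = (x - a)^(r+1) rho and g' = (x - a)^r p1, their quotient [h] is (x - a) k: one
     factor x - a is left over. *)
  set (k := fun x => Cmult (rho x) (RtoC (ip1 x))).
  assert (Hk : Csmooth_up a b k).
  { apply (Csmooth_up_mult a b Hab); [exact Hrho | now apply Csmooth_up_RtoC]. }
  set (h := fun x => Cmult (RtoC (x - a)) (k x)).
  assert (Hh : Csmooth_up a b h).
  { apply (Csmooth_up_mult a b Hab); [|exact Hk]. apply Csmooth_up_RtoC, smooth_up_id. }
  assert (E : forall x, a < x < b ->
    Cminus (s x) (Taylor r s a x) = Cmult (h x) (RtoC (Derive g x))).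
  { intros x Hx. rewrite (Erho x Hx), Eg' by exact Hx. unfold h, k.
    change ((x - a) ^ S r) with ((x - a) * (x - a) ^ r). rewrite !RtoC_mult.
    replace (Cmult (Cmult (RtoC (x - a)) (Cmult (rho x) (RtoC (ip1 x))))
      (Cmult (RtoC ((x - a) ^ r)) (RtoC (p1 x)))) with
      (Cmult (Cmult (RtoC (x - a)) (Cmult (rho x) (RtoC ((x - a) ^ r))))
             (Cmult (RtoC (p1 x)) (RtoC (ip1 x)))) by ring.
    rewrite <- (RtoC_mult (p1 x)), Eip1 by exact Hx. ring. }
  assert (Esig : forall x, a < x < b -> sigma_next e s x =
     Cminus (CDer h x) (Cmult (Cmult e (h x)) (RtoC (log_deriv x)))).
  { intros x Hx. now apply sigma_next_eq. }
  (* The factor x - a of [h] cancels the pole of g'/g, so that h g'/g becomes k p1/p. *)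
  assert (Hsig : Csmooth_up a b (sigma_next e s)).
  { apply (Csmooth_up_ext a b Hab) with
      (fun x => Cminus (CDer h x) (Cmult (Cmult e (k x)) (RtoC (p1 x * ip x)))).
    - intros x Hx. rewrite Esig by exact Hx. f_equal. unfold h, log_deriv.
      rewrite (RtoC_mult (p1 x * ip x)).
      replace (Cmult (Cmult e (Cmult (RtoC (x - a)) (k x)))
        (Cmult (RtoC (p1 x * ip x)) (RtoC (/ (x - a) ^ 1)))) with
        (Cmult (Cmult (Cmult e (k x)) (RtoC (p1 x * ip x)))
          (Cmult (RtoC (x - a)) (RtoC (/ (x - a) ^ 1)))) by ring.
      rewrite <- (RtoC_mult (x - a)). replace ((x - a) * / (x - a) ^ 1) with 1 by (field; lra).
      ring.
    - apply (Csmooth_up_minus a b Hab); [now apply Csmooth_up_CDer|].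
      apply (Csmooth_up_mult a b Hab).
      + apply (Csmooth_up_mult a b Hab); [apply Csmooth_up_const | exact Hk].
      + apply Csmooth_up_RtoC. now apply smooth_up_mult. }
  split; [exact Hsig|]. intros omega Hom.
  set (hb := Cdiv (Cminus (CderB s 0 b) (Taylor r s a b)) (RtoC dgb)).
  assert (Lh : Clim (at_left b) h hb).
  { apply Clim_ext with (fun x => Cmult (Cminus (s x) (Taylor r s a x)) (RtoC (/ Derive g x))).
    - generalize (at_left_between a b Hab). apply filter_imp. intros x Hx. rewrite E by exact Hx.
      rewrite <- Cmult_assoc, <- RtoC_mult, Rinv_r by (now apply Derive_g_neq_0). ring.
    - unfold hb, Cdiv. rewrite <- RtoC_inv by exact Hdgb0.
      apply Clim_mult; [|now apply Clim_RtoC, flim_inv].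
      apply Clim_minus; [now apply (CderB_lim a b Hab) | apply Taylor_lim]. }
  destruct (bessel_phase_integrable mu omega s Hmu Hom Hs) as [l0 I0].
  destruct (bessel_phase_integrable e omega _ He1 Hom Hsig) as [l1 I1].
  assert (IM : forall j, improper_integral a b
      (fun x => Cmult (RtoC ((x - a) ^ j)) (BesselJ mu (RtoC (omega * g x))))
      (CInt (fun x => Cmult (RtoC ((x - a) ^ j)) (BesselJ mu (RtoC (omega * g x)))) a b)).
  { intros j.
    destruct (bessel_phase_integrable mu omega _ Hmu Hom (Csmooth_up_pow j)) as [l I].
    now rewrite (CInt_improper a b Hab _ _ I). }
  set (lT := sum_n (fun j => Cmult (Cdiv (CderA s j a) (RtoC (INR (fact j))))
       (CInt (fun x => Cmult (RtoC ((x - a) ^ j)) (BesselJ mu (RtoC (omega * g x)))) a b)) r).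
  assert (IT : improper_integral a b
    (fun x => Cmult (Taylor r s a x) (BesselJ mu (RtoC (omega * g x)))) lT).
  { apply (improper_integral_ext a b Hab) with (fun x => sum_n (fun j =>
      Cmult (Cdiv (CderA s j a) (RtoC (INR (fact j))))
        (Cmult (RtoC ((x - a) ^ j)) (BesselJ mu (RtoC (omega * g x))))) r).
    - intros x _. unfold Taylor. rewrite sum_n_Cmult_r. apply sum_n_ext. intros j.
      apply Cmult_assoc.
    - apply (improper_integral_sum_n a b Hab (fun j x =>
      Cmult (Cdiv (CderA s j a) (RtoC (INR (fact j))))
        (Cmult (RtoC ((x - a) ^ j)) (BesselJ mu (RtoC (omega * g x)))))).
      intros j _. apply (improper_integral_scal a b Hab). apply IM. }
  assert (ID : improper_integral a b
    (fun x => Cmult (Cmult (h x) (RtoC (Derive g x))) (BesselJ mu (RtoC (omega * g x))))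
    (Cplus l0 (Cmult (Copp (RtoC 1)) lT))).
  { apply (improper_integral_ext a b Hab) with (fun x => Cplus
      (Cmult (s x) (BesselJ mu (RtoC (omega * g x))))
      (Cmult (Copp (RtoC 1)) (Cmult (Taylor r s a x) (BesselJ mu (RtoC (omega * g x)))))).
    - intros x Hx. rewrite <- E by exact Hx. ring.
    - apply (improper_integral_plus a b Hab); [exact I0|].
      now apply (improper_integral_scal a b Hab). }
  rewrite (CInt_improper a b Hab _ _ I0), (CInt_improper a b Hab _ _ I1).
  (* Integration by parts on [c, b] with c tending to [a]. The final 0 is the limit of the boundary
     term at c, which is O(c - a) because [h] has the factor x - a and J_e is bounded. *)
  assert (K : Cplus (Cmult (RtoC omega) (Cplus l0 (Cmult (Copp (RtoC 1)) lT))) l1 =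
    Cminus (Cmult hb (BesselJ e (RtoC (omega * gb)))) (RtoC 0)).
  { apply (Clim_unique (F := at_right a) (fun c => Cplus
      (Cmult (RtoC omega) (CRInt (fun x => Cmult (Cmult (h x) (RtoC (Derive g x)))
                                     (BesselJ mu (RtoC (omega * g x)))) c b))
      (CRInt (fun x => Cmult (sigma_next e s x) (BesselJ e (RtoC (omega * g x)))) c b))).
    - apply Clim_plus; [apply Clim_mult; [apply Clim_const|apply ID] | apply I1].
    - apply Clim_ext with (fun c => Cminus (Cmult hb (BesselJ e (RtoC (omega * gb))))
         (Cmult (h c) (BesselJ e (RtoC (omega * g c))))).
      + generalize (at_right_between a b Hab). apply filter_imp. intros c Hc.
        pose proof (bessel_by_parts mu hb omega c h (CDer h) Hmu1 ltac:(lra) Hc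
          (Csmooth_up_Cderiv a b h Hh) (Csmooth_up_left_regular a b h Hh)
          (Csmooth_up_left_regular a b _ (Csmooth_up_CDer a b Hab h Hh)) Lh) as P.
        fold e in P. rewrite <- P. f_equal.
        apply CRInt_ext; [lra|]. intros x Hx. rewrite Esig by lra. reflexivity.
      + apply Clim_minus; [apply Clim_const|].
        destruct (Csmooth_up_bounded a b Hab k Hk) as [M BM].
        destruct (BesselJ_bounded e He) as [K0 BK].
        apply Clim_squeeze_0 with (fun x => (x - a) * (M * K0)).
        * generalize (at_right_between a b Hab). apply filter_imp. intros x Hx.
          unfold h. rewrite !Cmod_mult, Cmod_R, Rabs_pos_eq, Rmult_assoc by lra.
          apply Rmult_le_compat_l; [lra|].
          apply Rmult_le_compat; try apply Cmod_ge_0; [now apply BM|].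
          apply BK. apply Rmult_integral_contrapositive. split; [lra | now apply Hg0].
        * replace 0 with (0 * (M * K0)) by ring.
          apply flim_mult; [apply flim_at_right_id | apply flim_const]. }
  assert (Hom' : RtoC omega <> RtoC 0) by (apply RtoC_neq_0; lra).
  replace (Cmult hb (BesselJ e (RtoC (omega * gb)))) with
    (Cminus (Cmult hb (BesselJ e (RtoC (omega * gb)))) (RtoC 0)) by ring.
  rewrite <- K, RtoC_inv by lra. field. exact Hom'.
Qed.

(* On [a, c] with [c - a] of order [omega^(-1/(r+1))] the integrand is merely bounded;
   on [c, b] one integration by parts gains a factor [omega^(-1) (c - a)^(-r)]. *)
Lemma bessel_remainder (mu : C) (s : R -> C) : 0 <= Re mu -> Csmooth_up a b s ->
  exists K, forall omega, 1 <= omega ->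
    Cmod (CInt (fun x => Cmult (s x) (BesselJ mu (RtoC (omega * g x)))) a b) <=
    K * Rpower omega (- / INR (S r)).
Proof.
  intros Hmu Hs. pose proof INR_Sr as HSr.
  assert (Hmu1 : -1 < Re mu) by lra.
  set (e := Cplus mu (RtoC 1)).
  assert (He : 0 <= Re e) by (change (0 <= Re mu + 1); lra).
  destruct (BesselJ_bounded mu Hmu) as [K0' BK0']. destruct (BesselJ_bounded e He) as [K1' BK1'].
  set (K0 := Rabs K0'). set (K1 := Rabs K1').
  assert (BK0 : forall t, t <> 0 -> Cmod (BesselJ mu (RtoC t)) <= K0).
  { intros t Ht. eapply Rle_trans; [now apply BK0' | apply Rle_abs]. }
  assert (BK1 : forall t, t <> 0 -> Cmod (BesselJ e (RtoC t)) <= K1).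
  { intros t Ht. eapply Rle_trans; [now apply BK1' | apply Rle_abs]. }
  assert (PK0 : 0 <= K0) by apply Rabs_pos. assert (PK1 : 0 <= K1) by apply Rabs_pos.
  (* Below, h = q/(x - a)^r is s/g', so h g' = s and no Taylor polynomial is subtracted this
     time. *)
  set (q := fun x => Cmult (s x) (RtoC (ip1 x))).
  assert (Hq : Csmooth_up a b q).
  { apply (Csmooth_up_mult a b Hab); [exact Hs | now apply Csmooth_up_RtoC]. }
  set (h := fun x => Cmult (q x) (RtoC (/ (x - a) ^ r))).
  set (h' := fun x => Cplus (Cmult (CDer q x) (RtoC (/ (x - a) ^ r)))
                            (Cmult (q x) (RtoC (- INR r * / (x - a) ^ S r)))).
  (* This is (x - a)^(r+1) (h' - e h g'/g): the integrand left after integration by parts is Z/(x -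
     a)^(r+1) times J_e, with [Z] bounded. *)
  set (Z := fun x => Cminus (Cmult (RtoC (x - a)) (CDer q x))
     (Cplus (Cmult (RtoC (INR r)) (q x)) (Cmult (Cmult e (q x)) (RtoC (p1 x * ip x))))).
  assert (HZ : Csmooth_up a b Z).
  { apply (Csmooth_up_minus a b Hab).
    - apply (Csmooth_up_mult a b Hab); [apply Csmooth_up_RtoC, smooth_up_id | now apply Csmooth_up_CDer].
    - apply Csmooth_up_plus; apply (Csmooth_up_mult a b Hab); try exact Hq; try apply Csmooth_up_const.
      + apply (Csmooth_up_mult a b Hab); [apply Csmooth_up_const | exact Hq].
      + apply Csmooth_up_RtoC. now apply smooth_up_mult. }
  destruct (Csmooth_up_bounded a b Hab s Hs) as [Ms' Bs'].
  destruct (Csmooth_up_bounded a b Hab q Hq) as [Mq' Bq'].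
  destruct (Csmooth_up_bounded a b Hab Z HZ) as [Mz' Bz'].
  set (Ms := Rabs Ms'). set (Mq := Rabs Mq'). set (Mz := Rabs Mz').
  assert (Bs : forall x, a < x < b -> Cmod (s x) <= Ms).
  { intros x Hx. eapply Rle_trans; [now apply Bs' | apply Rle_abs]. }
  assert (Bq : forall x, a < x < b -> Cmod (q x) <= Mq).
  { intros x Hx. eapply Rle_trans; [now apply Bq' | apply Rle_abs]. }
  assert (Bz : forall x, a < x < b -> Cmod (Z x) <= Mz).
  { intros x Hx. eapply Rle_trans; [now apply Bz' | apply Rle_abs]. }
  assert (Ps : 0 <= Ms) by apply Rabs_pos. assert (Pq : 0 <= Mq) by apply Rabs_pos.
  assert (Pz : 0 <= Mz) by apply Rabs_pos.
  set (hb := Cmult (CderB q 0 b) (RtoC (/ (b - a) ^ r))).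
  assert (Lh : Clim (at_left b) h hb).
  { apply Clim_mult; [now apply (CderB_lim a b Hab)|].
    apply Clim_RtoC, flim_inv; [apply pow_nonzero; lra|]. apply flim_pow, flim_at_left_id. }
  assert (Dpow : forall n x, a < x ->
    is_derive (fun x => / (x - a) ^ n) x (- INR n * / (x - a) ^ S n)).
  { intros n x Hx. eapply is_derive_eq.
    - apply is_derive_inv; [apply is_derive_pow, is_derive_sub_const | apply pow_nonzero; lra].
    - assert ((x - a) ^ n <> 0) by (apply pow_nonzero; lra).
      destruct n as [|n].
      + simpl. field. lra.
      + simpl Init.Nat.pred. generalize (INR (S n)). intros N.
        assert ((x - a) ^ n <> 0) by (apply pow_nonzero; lra).
        simpl pow. field. repeat split; try assumption; lra. }
  assert (Dh : forall x, a < x < b -> Cderiv h x (h' x)).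
  { intros x Hx. apply (Cderiv_mult q (fun x => RtoC (/ (x - a) ^ r)) x (CDer q x)
      (RtoC (- INR r * / (x - a) ^ S r))).
    - now apply (Csmooth_up_Cderiv a b).
    - apply (Cderiv_RtoC (fun x => / (x - a) ^ r)), Dpow. lra. }
  assert (Rq : Cleft_regular a b q) by now apply Csmooth_up_left_regular.
  assert (Rh : Cleft_regular a b h).
  { apply Cleft_regular_mult; [exact Rq|]. now apply Cleft_regular_RtoC, left_regular_inv_pow. }
  assert (Rh' : Cleft_regular a b h').
  { apply Cleft_regular_plus.
    - apply Cleft_regular_mult; [|now apply Cleft_regular_RtoC, left_regular_inv_pow].
      apply Csmooth_up_left_regular. now apply Csmooth_up_CDer.
    - apply Cleft_regular_mult; [exact Rq|].
      apply (Cleft_regular_ext a b Hab) with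
        (fun x => Cmult (RtoC (- INR r)) (RtoC (/ (x - a) ^ S r))).
      + intros x _. now rewrite RtoC_mult.
      + apply Cleft_regular_mult; [apply Cleft_regular_const|].
        now apply Cleft_regular_RtoC, left_regular_inv_pow. }
  (* Keeps the splitting point inside (a, b) for every omega >= 1; being at most 1, it also makes
     [D] below at least 1. *)
  set (kappa := Rmin 1 ((b - a) / 2)).
  assert (Hk1 : kappa <= 1) by apply Rmin_l.
  assert (Hkb : kappa <= (b - a) / 2) by apply Rmin_r.
  assert (Hk0 : 0 < kappa) by (apply Rmin_glb_lt; lra).
  (* The three terms come from the boundary at [b], the boundary at the splitting point, and the
     remaining integral. *)
  set (A := Cmod hb * K1 + Mq * K1 + 2 * (Mz * K1)).
  assert (HA : 0 <= A).
  { unfold A. pose proof (Cmod_ge_0 hb).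
    assert (0 <= Cmod hb * K1) by now apply Rmult_le_pos.
    assert (0 <= Mq * K1) by now apply Rmult_le_pos.
    assert (0 <= Mz * K1) by now apply Rmult_le_pos. lra. }
  exists (2 * (2 * (Ms * K0) + A * / kappa ^ r)). intros omega Hom.
  assert (Hom0 : omega <> 0) by lra.
  set (delta := Rpower omega (- / INR (S r))).
  assert (Hd0 : 0 < delta) by apply exp_pos.
  assert (Hd1 : delta <= 1).
  { unfold delta. rewrite <- (Rpower_O omega) by lra. apply Rle_Rpower; [exact Hom|].
    assert (0 < / INR (S r)) by (apply Rinv_0_lt_compat; lra). lra. }
  (* This balances the two parts: the far part, of order delta^(-r)/omega, becomes a multiple of
     delta like the near one. *)
  assert (Hdw : delta ^ S r * omega = 1).
  { unfold delta. rewrite <- Rpower_pow, Rpower_mult by apply exp_pos.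
    replace (- / INR (S r) * INR (S r)) with (- (1)) by (field; lra).
    rewrite Rpower_Ropp, Rpower_1 by lra. field. lra. }
  set (c := a + kappa * delta).
  assert (Hkd : 0 < kappa * delta) by now apply Rmult_lt_0_compat.
  assert (Hkd1 : kappa * delta <= kappa).
  { rewrite <- (Rmult_1_r kappa) at 2. apply Rmult_le_compat_l; lra. }
  assert (Hc : a < c < b) by (unfold c; lra).
  assert (Hnz : forall x, a < x < b -> omega * g x <> 0).
  { intros x Hx. apply Rmult_integral_contrapositive. split; [exact Hom0 | now apply Hg0]. }
  assert (Hmu2 : -1 < INR (S r) * Re mu) by nra.
  destruct (bessel_phase_integrable mu omega s Hmu2 ltac:(lra) Hs) as [l [RI LI]].
  rewrite (CInt_improper a b Hab _ l) by now split.
  set (phi := fun x => Cmult (s x) (BesselJ mu (RtoC (omega * g x)))) in *.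
  assert (Near : forall y, a < y < c -> Cmod (CRInt phi y c) <= 2 * (Ms * K0) * delta).
  { intros y Hy. eapply Rle_trans.
    - apply (CRInt_dominated a b Hab phi (fun x => Ms * K0 * (x - a)) (fun _ => Ms * K0) y c RI);
        try lra.
      + intros x _. eapply is_derive_eq; [apply is_derive_scal, is_derive_sub_const | ring].
      + intros x _. apply continuous_const.
      + intros x Hx. unfold phi. rewrite Cmod_mult.
        apply Rmult_le_compat; try apply Cmod_ge_0; [apply Bs | apply BK0, Hnz]; lra.
    - replace (2 * (Ms * K0 * (c - a) - Ms * K0 * (y - a))) with (2 * (Ms * K0) * (c - y)) by ring.
      apply Rmult_le_compat_l; [assert (0 <= Ms * K0) by (now apply Rmult_le_pos); lra|].
      unfold c in *. assert (kappa * delta <= delta); [|lra].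
      rewrite <- (Rmult_1_l delta) at 2. apply Rmult_le_compat_r; lra. }
  (* This is (c - a)^(-r). As D >= 1, the boundary term at [b], which is merely bounded, is absorbed
     into a multiple of D. *)
  set (D := / (kappa * delta) ^ r).
  assert (HD1 : 1 <= D).
  { unfold D. rewrite <- Rinv_1. apply Rinv_le_contravar; [now apply pow_lt|].
    rewrite <- (pow1 r). apply pow_incr. lra. }
  assert (EZ : forall x, a < x < b ->
     Cminus (h' x) (Cmult (Cmult e (h x)) (RtoC (log_deriv x))) =
     Cmult (Z x) (RtoC (/ (x - a) ^ S r))).
  { intros x Hx. unfold h', h, Z, log_deriv.
    assert ((x - a) ^ r <> 0) by (apply pow_nonzero; lra).
    change ((x - a) ^ S r) with ((x - a) * (x - a) ^ r). rewrite pow_1, !Rinv_mult.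
    rewrite !RtoC_mult.
    assert (Ei : Cmult (RtoC (x - a)) (RtoC (/ (x - a))) = RtoC 1).
    { rewrite <- RtoC_mult. f_equal. field. lra. }
    rewrite RtoC_opp.
    rewrite <- (Cmult_1_l (Cmult (CDer q x) _)), <- Ei. ring. }
  assert (Far : omega * Cmod (CRInt phi c b) <= A * D).
  { rewrite <- (Rabs_pos_eq omega), <- Cmod_R, <- Cmod_mult by lra.
    pose proof (bessel_by_parts mu hb omega c h h' Hmu1 Hom0 Hc Dh Rh Rh' Lh) as P.
    fold e in P.
    rewrite (CRInt_ext (fun x => Cmult (Cmult (h x) (RtoC (Derive g x)))
      (BesselJ mu (RtoC (omega * g x)))) phi c b) in P; [|lra|].
    2:{ intros x Hx. unfold phi, h, q. f_equal. rewrite Eg', RtoC_mult by lra.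
        replace (Cmult (Cmult (Cmult (s x) (RtoC (ip1 x))) (RtoC (/ (x - a) ^ r)))
                       (Cmult (RtoC ((x - a) ^ r)) (RtoC (p1 x)))) with
          (Cmult (s x) (Cmult (Cmult (RtoC (p1 x)) (RtoC (ip1 x)))
             (Cmult (RtoC ((x - a) ^ r)) (RtoC (/ (x - a) ^ r))))) by ring.
        rewrite <- !RtoC_mult, Eip1, Rinv_r by (try apply pow_nonzero; lra).
        rewrite Rmult_1_l. ring. }
    set (I2 := CRInt (fun x => Cmult (Cminus (h' x) (Cmult (Cmult e (h x)) (RtoC (log_deriv x))))
                 (BesselJ e (RtoC (omega * g x)))) c b) in P.
    assert (HI2 : Cmod I2 <= 2 * (Mz * K1) * D).
    { unfold I2.
      assert (RZ : Cleft_regular a b (fun x => Cmult (Cmult (Z x) (RtoC (/ (x - a) ^ S r)))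
                 (BesselJ e (RtoC (omega * g x))))).
      { apply Cleft_regular_mult; [apply Cleft_regular_mult|].
        - now apply Csmooth_up_left_regular.
        - now apply Cleft_regular_RtoC, left_regular_inv_pow.
        - apply bessel_phase_regular; lra. }
      rewrite (CRInt_ext _ (fun x => Cmult (Cmult (Z x) (RtoC (/ (x - a) ^ S r)))
                 (BesselJ e (RtoC (omega * g x)))));
        [|lra|intros x Hx; rewrite EZ by lra; reflexivity].
      eapply Rle_trans.
      (* The derivative of -(Mz K1)/(x - a)^r is r Mz K1/(x - a)^(r+1), a majorant of the integrand
         because r >= 1. *)
      - apply (CRInt_dominated a b Hab _ (fun x => - (Mz * K1) * / (x - a) ^ r)
          (fun x => - (Mz * K1) * (- INR r * / (x - a) ^ S r)) c b RZ); try lra.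
        + intros x Hx. apply is_derive_scal, Dpow, Hx.
        + intros x Hx.
          apply (@ex_derive_continuous R_AbsRing R_NormedModule
            (fun x => - (Mz * K1) * (- INR r * / (x - a) ^ S r))).
          eexists. apply is_derive_scal, is_derive_scal, Dpow, Hx.
        + intros x Hx. rewrite !Cmod_mult, Cmod_R.
          assert (Hi : 0 < / (x - a) ^ S r) by (apply Rinv_0_lt_compat, pow_lt; lra).
          rewrite Rabs_pos_eq by lra.
          assert (1 <= INR r) by (apply (le_INR 1 r), Hr).
          apply Rle_trans with (Mz * / (x - a) ^ S r * K1).
          * apply Rmult_le_compat; try apply Cmod_ge_0.
            -- apply Rmult_le_pos; [apply Cmod_ge_0 | lra].
            -- apply Rmult_le_compat_r; [lra | apply Bz; lra].
            -- apply BK1, Hnz. lra.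
          * replace (- (Mz * K1) * (- INR r * / (x - a) ^ S r))
              with (Mz * / (x - a) ^ S r * K1 * INR r) by ring.
            rewrite <- (Rmult_1_r (Mz * / (x - a) ^ S r * K1)) at 1.
            apply Rmult_le_compat_l; [|assumption].
            repeat apply Rmult_le_pos; lra.
      - replace (/ (c - a) ^ r) with D by (unfold D, c; f_equal; f_equal; ring).
        assert (0 < / (b - a) ^ r) by (apply Rinv_0_lt_compat, pow_lt; lra).
        assert (0 <= Mz * K1 * / (b - a) ^ r).
        { apply Rmult_le_pos; [now apply Rmult_le_pos | lra]. }
        lra. }
    assert (P' : Cmult (RtoC omega) (CRInt phi c b) =
      Cplus (Cplus (Cmult hb (BesselJ e (RtoC (omega * gb))))
                   (Copp (Cmult (h c) (BesselJ e (RtoC (omega * g c)))))) (Copp I2)).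
    { fold (Cminus (Cmult hb (BesselJ e (RtoC (omega * gb))))
                   (Cmult (h c) (BesselJ e (RtoC (omega * g c))))).
      rewrite <- P. ring. }
    rewrite P'.
    eapply Rle_trans; [apply Cmod_triangle|].
    rewrite Cmod_opp.
    eapply Rle_trans; [apply Rplus_le_compat_r, Cmod_triangle|].
    rewrite Cmod_opp, !Cmod_mult.
    assert (T1 : Cmod hb * Cmod (BesselJ e (RtoC (omega * gb))) <= Cmod hb * K1 * D).
    { rewrite <- (Rmult_1_r (Cmod hb * Cmod (BesselJ e (RtoC (omega * gb))))).
      apply Rmult_le_compat; try lra.
      - apply Rmult_le_pos; apply Cmod_ge_0.
      - apply Rmult_le_compat_l; [apply Cmod_ge_0|]. apply BK1.
        apply Rmult_integral_contrapositive. now split. }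
    assert (T2 : Cmod (h c) * Cmod (BesselJ e (RtoC (omega * g c))) <= Mq * D * K1).
    { apply Rmult_le_compat; try apply Cmod_ge_0; [|apply BK1, Hnz, Hc].
      unfold h. rewrite Cmod_mult, Cmod_R.
      replace (/ (c - a) ^ r) with D by (unfold D, c; f_equal; f_equal; ring).
      rewrite Rabs_pos_eq by lra. apply Rmult_le_compat_r; [lra | now apply Bq]. }
    unfold A. lra. }
  assert (Far' : Cmod (CRInt phi c b) <= A * / kappa ^ r * delta).
  { apply (Rmult_le_reg_l omega); [lra|]. apply Rle_trans with (1 := Far). apply Req_le.
    unfold D. rewrite Rpow_mult_distr, Rinv_mult.
    assert (delta ^ r <> 0) by (apply pow_nonzero; lra).
    assert (kappa ^ r <> 0) by (apply pow_nonzero; lra).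
    replace (/ delta ^ r) with (/ delta ^ r * (delta ^ S r * omega)) by (rewrite Hdw; ring).
    simpl pow. field. split; assumption. }
  replace (2 * (2 * (Ms * K0) + A * / kappa ^ r) * delta)
    with (2 * (2 * (Ms * K0) * delta + A * / kappa ^ r * delta)) by ring.
  apply (Clim_Cmod_le (F := at_right a) (fun y => CRInt phi y b) l); [exact LI|].
  generalize (at_right_between a c (proj1 Hc)). apply filter_imp. intros y Hy.
  rewrite (CRInt_Chasles a b Hab phi y c RI) by lra.
  eapply Rle_trans; [apply Cmod_triangle|]. apply Rplus_le_compat; [now apply Near | exact Far'].
Qed.

End Phase.

(** * The expansion *)

Lemma smooth_up_inv (a b : R) (phi : R -> R) (la lb : R) : smooth_up a b phi ->
  filterlim phi (at_right a) (locally la) -> la <> 0 ->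
  filterlim phi (at_left b) (locally lb) -> lb <> 0 ->
  (forall x, a < x < b -> phi x <> 0) -> smooth_up a b (fun x => / phi x).
Proof. intros H Ha Hla Hb Hlb H0 n. now apply Cn_up_inv with la lb. Qed.

(** The Taylor polynomial of order [r] is zero, so [g] equals its remainder (x - a)^(r+1) p. The
    bracket in the formula for g' tends to (r+1) p(a), nonzero as soon as p(a) is. *)
Lemma smooth_up_vanishing (a b : R) (r : nat) (g : R -> R) : a < b -> smooth_up a b g ->
  (forall j, (j <= r)%nat -> derA g j a = 0) ->
  exists p, smooth_up a b p /\
    filterlim p (at_right a) (locally (derA g (S r) a / INR (fact (S r)))) /\
    (forall x, a < x < b -> g x = (x - a) ^ S r * p x) /\
    (forall x, a < x < b -> Derive g x = (x - a) ^ r * (INR (S r) * p x + (x - a) * Derive p x)).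
Proof.
  intros Hab Hg H0. destruct (smooth_up_taylor a b Hab r g Hg) as [p [Hp [Ha E]]].
  assert (Eg : forall x, a < x < b -> g x = (x - a) ^ S r * p x).
  { intros x Hx. rewrite E by exact Hx.
    assert (Z : forall n, (n <= r)%nat ->
      sum_n (fun j => derA g j a / INR (fact j) * (x - a) ^ j) n = 0).
    { induction n as [|n IH]; intros Hn.
      - rewrite sum_O, H0 by lia. unfold Rdiv. now rewrite !Rmult_0_l.
      - rewrite sum_Sn, IH, H0 by lia. unfold Rdiv. rewrite !Rmult_0_l. apply Rplus_0_l. }
    rewrite Z by lia. ring. }
  exists p. split; [exact Hp|]. split; [|split; [exact Eg|]].
  - rewrite <- Ha. exact (derA_spec a b Hab p 0 Hp).
  - intros x Hx. apply is_derive_unique.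
    apply is_derive_ext_loc with (fun x => (x - a) ^ S r * p x).
    + generalize (locally_between a b x Hx). apply filter_imp. intros t Ht. symmetry. now apply Eg.
    + eapply is_derive_eq.
      * apply (Derive.is_derive_mult (fun x => (x - a) ^ S r) p);
          [apply is_derive_sub_pow | now apply (smooth_up_is_derive a b)].
      * change ((x - a) ^ S r) with ((x - a) * (x - a) ^ r). ring.
Qed.

Theorem theorem3p5 :
  forall (r : nat) (nu : C) (a b : R) (f g : R -> R) (m : nat),
    (1 <= r)%nat ->
    (Re nu > - / INR (S r))%R ->
    (a < b)%R ->
    Cinf_ab a b f ->
    Cinf_ab a b g ->
    g a = 0%R ->
    (forall j : nat, (1 <= j <= r)%nat -> derA g j a = 0%R) ->
    derA g (S r) a <> 0%R ->
    (forall x : R, (a < x <= b)%R -> g x <> 0%R) ->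
    (forall x : R, (a < x < b)%R -> Derive g x <> 0%R) ->
    derB g 1 b <> 0%R ->
    (1 <= m)%nat ->
    exists K omega0 : R,
      forall omega : R, (omega0 <= omega)%R ->
        (Cmod (Cminus (Hnu nu a b f g omega) (QmA m r nu a b f g omega))
           <= K * Rpower omega (- (INR m + / INR (S r))))%R.
Proof.
  intros r nu a b f g m Hr Hnu0 Hab Hf Hg Hga Hgj HgS Hg0 Hg'0 Hgb' Hm.
  pose proof (smooth_up_Cinf a b f Hf) as Sf. pose proof (smooth_up_Cinf a b g Hg) as Sg.
  assert (Lgb : filterlim g (at_left b) (locally (g b))) by apply Hg.
  assert (Lga : filterlim g (at_right a) (locally 0)) by (rewrite <- Hga; apply Hg).
  (* Order 0 is not among the hypotheses on [derA]: it comes from [g a = 0] and right continuity at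
     [a]. *)
  assert (Hgj' : forall j, (j <= r)%nat -> derA g j a = 0).
  { intros [|j] Hj; [|apply Hgj; lia].
    apply (flim_unique (F := at_right a) g); [exact (derA_spec a b Hab g 0 Sg) | exact Lga]. }
  destruct (smooth_up_vanishing a b r g Hab Sg Hgj') as [p [Hp [Lpa [Eg Eg']]]].
  set (p1 := fun x => INR (S r) * p x + (x - a) * Derive p x) in *.
  assert (Hp1 : smooth_up a b p1).
  { apply smooth_up_plus; apply smooth_up_mult; try exact Hp.
    - apply smooth_up_const.
    - apply smooth_up_id.
    - now apply smooth_up_Derive. }
  assert (Hpow : forall n, (b - a) ^ n <> 0) by (intros n; apply pow_nonzero; lra).
  assert (HSr : INR (S r) <> 0) by (apply not_0_INR; lia).
  assert (Hpa : derA g (S r) a / INR (fact (S r)) <> 0).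
  { apply Rmult_integral_contrapositive. split; [exact HgS | apply Rinv_neq_0_compat, INR_fact_neq_0]. }
  assert (Hpn : forall x, a < x < b -> p x <> 0).
  { intros x Hx E. apply (Hg0 x); [lra|]. rewrite Eg, E by exact Hx. ring. }
  assert (Hp1n : forall x, a < x < b -> p1 x <> 0).
  { intros x Hx E. apply (Hg'0 x); [lra|]. rewrite Eg' by exact Hx. fold (p1 x). rewrite E. ring. }
  (* The limits of [p] and [p1] at both endpoints are needed to be nonzero, so that 1/p and 1/p1 are
     smooth up to the boundary. At [b] this uses [g b <> 0] and the nonzero left limit of g'. *)
  assert (Lpb : filterlim p (at_left b) (locally (g b / (b - a) ^ S r))).
  { apply flim_ext with (fun x => g x / (x - a) ^ S r).
    - generalize (at_left_between a b Hab). apply filter_imp. intros x Hx.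
      rewrite Eg by exact Hx. field. apply pow_nonzero. lra.
    - apply flim_div; [apply Hpow | exact Lgb | apply flim_pow, flim_at_left_id]. }
  assert (Ldgb : filterlim (Derive g) (at_left b) (locally (derB g 1 b))).
  { exact (derB_spec a b Hab g 1 Sg). }
  assert (Lp1b : filterlim p1 (at_left b) (locally (derB g 1 b / (b - a) ^ r))).
  { apply flim_ext with (fun x => Derive g x / (x - a) ^ r).
    - generalize (at_left_between a b Hab). apply filter_imp. intros x Hx.
      rewrite Eg' by exact Hx. fold (p1 x). field. apply pow_nonzero. lra.
    - apply flim_div; [apply Hpow | exact Ldgb | apply flim_pow, flim_at_left_id]. }
  assert (Lp1a : filterlim p1 (at_right a)
            (locally (INR (S r) * (derA g (S r) a / INR (fact (S r))) + 0 * derA p 1 a))).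
  { apply flim_plus; apply flim_mult.
    - apply flim_const.
    - exact Lpa.
    - apply flim_at_right_id.
    - exact (derA_spec a b Hab p 1 Hp). }
  assert (Hip : smooth_up a b (fun x => / p x)).
  { apply smooth_up_inv with (3 := Hpa) (4 := Lpb); try assumption.
    apply Rmult_integral_contrapositive. split; [apply Hg0; lra | apply Rinv_neq_0_compat, Hpow]. }
  assert (Hip1 : smooth_up a b (fun x => / p1 x)).
  { apply smooth_up_inv with (2 := Lp1a) (4 := Lp1b); try assumption.
    - rewrite Rmult_0_l, Rplus_0_r. apply Rmult_integral_contrapositive. now split.
    - apply Rmult_integral_contrapositive. split; [exact Hgb' | apply Rinv_neq_0_compat, Hpow]. }
  assert (Hgn : forall x, a < x < b -> g x <> 0) by (intros x Hx; apply Hg0; lra).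
  assert (Eip : forall x, a < x < b -> p x * / p x = 1) by (intros x Hx; apply Rinv_r; auto).
  assert (Eip1 : forall x, a < x < b -> p1 x * / p1 x = 1) by (intros x Hx; apply Rinv_r; auto).
  assert (Hgbn : g b <> 0) by (apply Hg0; lra).
  set (mu := fun k : nat => Cplus nu (RtoC (INR k))).
  set (s := sigma_hat nu r a f g).
  (* The assumption on [nu] multiplied by r + 1; raising the order only helps. *)
  assert (Hmu : forall k, -1 < INR (S r) * Re (mu k)).
  { intros k. change (Re (mu k)) with (Re nu + INR k).
    assert (0 < INR (S r)) by (apply lt_0_INR; lia).
    assert (0 <= INR (S r) * INR k) by (apply Rmult_le_pos; [lra | apply pos_INR]).
    assert (INR (S r) * - / INR (S r) < INR (S r) * Re nu) by (apply Rmult_lt_compat_l; lra).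
    replace (INR (S r) * - / INR (S r)) with (-1) in * by (field; exact HSr). lra. }
  assert (Emu : forall k, mu (S k) = Cplus (mu k) (RtoC 1)).
  { intros k. unfold mu. rewrite S_INR, RtoC_plus. ring. }
  assert (Es : forall k, s (S k) = sigma_next a r g (mu (S k)) (s k)) by reflexivity.
  pose proof (fun k Hk => bessel_step a b (g b) r g p _ p1 _ Hab Hr Sg Hgn Lgb Hgbn Hp Hip Hp1 Hip1
       Eg Eg' Eip Eip1 (derB g 1 b) Ldgb Hgb' (mu k) (s k) (Hmu k) Hk) as STEP.
  assert (Hs : forall k, Csmooth_up a b (s k)).
  { induction k as [|k IH].
    - now apply Csmooth_up_RtoC.
    - rewrite Es, Emu. apply STEP, IH. }
  pose (I := fun (k : nat) omega =>
    CInt (fun x => Cmult (s k x) (BesselJ (mu k) (RtoC (omega * g x)))) a b).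
  destruct (bessel_remainder a b (g b) r g p _ p1 _ Hab Hr Sg Hgn Lgb Hgbn Hp Hip Hp1 Hip1
       Eg Eg' Eip Eip1 (mu m) (s m)) as [K HK]; [|apply Hs|].
  (* Since r + 1 >= 2, the assumption gives Re nu > -1/2, and m >= 1 then makes the real part of nu
     + m nonnegative. *)
  { change (0 <= Re nu + INR m). pose proof (Hmu O) as H. change (Re (mu O)) with (Re nu + 0) in H.
    apply le_INR in Hm. simpl in Hm.
    assert (2 <= INR (S r)) by (rewrite S_INR; apply le_INR in Hr; simpl in Hr; lra). nra. }
  exists K, 1. intros omega Hom.
  set (w := RtoC (- omega)).
  assert (Hw : w <> RtoC 0) by (apply RtoC_neq_0; lra).
  assert (Hwk : forall k, Cpow w k <> RtoC 0) by (intros k; now apply Cpow_nz).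
  pose (T := fun k : nat => sum_n (fun j => Cmult (Cdiv (CderA (s k) j a) (RtoC (INR (fact j))))
                                      (Mj j a b g (mu k) omega)) r).
  pose (D := fun k : nat => Cdiv (Cminus (CderB (s k) 0 b) (Taylor r (s k) a b)) (RtoC (derB g 1 b))).
  pose (J := fun k : nat => BesselJ (mu (S k)) (RtoC (omega * g b))).
  (* With w = -omega the factor 1/omega of [bessel_step] is -1/w, which produces the signs of the
     expansion. *)
  assert (Erec : forall k, I k omega =
    Cplus (Cminus (T k) (Cmult (Cinv w) (Cmult (D k) (J k)))) (Cmult (Cinv w) (I (S k) omega))).
  { intros k. destruct (STEP k (Hs k)) as [_ H]. specialize (H omega ltac:(lra)).
    rewrite <- Emu in H. rewrite <- Es in H. fold (I k omega) (I (S k) omega) (D k) (J k) in H.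
    rewrite H. unfold T, Mj.
    replace (Cinv w) with (Copp (RtoC (/ omega))); [ring|].
    unfold w. rewrite <- RtoC_inv, <- RtoC_opp by lra. f_equal. field. lra. }
  assert (Esum : forall n, I O omega =
    Cplus (Cminus (sum_n (fun k => Cmult (Cinv (Cpow w k)) (T k)) n)
                  (sum_n (fun k => Cmult (Cmult (Cinv (Cpow w (S k))) (D k)) (J k)) n))
          (Cmult (Cinv (Cpow w (S n))) (I (S n) omega))).
  { induction n as [|n IH].
    - rewrite !sum_O, Erec. simpl. field. exact Hw.
    - rewrite IH, !sum_Sn, Erec. unfold plus; simpl. field. split; [apply Hwk | exact Hw]. }
  assert (EH : Hnu nu a b f g omega = I O omega).
  { assert (E0 : mu O = nu) by exact (Cplus_0_r nu). unfold I. rewrite E0. reflexivity. }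
  assert (EQ : Cminus (Hnu nu a b f g omega) (QmA m r nu a b f g omega) =
               Cmult (Cinv (Cpow w m)) (I m omega)).
  (* The sums of [QmA] run to m - 1, its second one with the index shifted by one; hence the
     unrolled recursion is taken at m - 1, and its last term is the one of index m. *)
  { rewrite EH, (Esum (m - 1)%nat). replace (S (m - 1)) with m by lia.
    change (QmA m r nu a b f g omega) with
      (Cminus (sum_n (fun k => Cmult (Cinv (Cpow w k)) (T k)) (m - 1))
              (sum_n (fun k => Cmult (Cmult (Cinv (Cpow w (S k))) (D k)) (J k)) (m - 1))).
    ring. }
  rewrite EQ, Cmod_mult.
  assert (Ew : Cmod (Cinv (Cpow w m)) = Rpower omega (- INR m)).
  { unfold w. rewrite <- RtoC_pow, <- RtoC_inv, Cmod_R by (apply pow_nonzero; lra).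
    rewrite Rabs_inv, <- RPow_abs, Rabs_Ropp, (Rabs_pos_eq omega) by lra.
    rewrite Rpower_Ropp, Rpower_pow by lra. reflexivity. }
  rewrite Ew. replace (- (INR m + / INR (S r))) with (- INR m + - / INR (S r)) by ring.
  rewrite Rpower_plus.
  replace (K * (Rpower omega (- INR m) * Rpower omega (- / INR (S r))))
    with (Rpower omega (- INR m) * (K * Rpower omega (- / INR (S r)))) by ring.
  apply Rmult_le_compat_l; [apply Rlt_le, exp_pos|]. exact (HK omega Hom).
Qed.
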